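(* The following conditions are equivalent. (1) $\mathfrak m S = (0)$ and $\operatorname{rank}_B S = 1$. (2) Either $S \cong B(-1)$ as graded $T$-modules, or $S \cong \mathfrak a$ as graded $T$-modules for some graded ideal $\mathfrak a$ $(\neq B)$ of $B$ with $\operatorname{ht}_B \mathfrak a \geq 2$.
   Context: Let $(A,\mathfrak m)$ be a Cohen-Macaulay local ring with $d = \dim A > 0$ and infinite residue field $k = A/\mathfrak m$. Let $I$ be an $\mathfrak m$-primary ideal of $A$ and let $Q = (a_1,\dots,a_d)$ be a minimal reduction of $I$. Let $t$ be an indeterminate and put $R = A[It]$, $T = A[Qt] \subseteq A[t]$, and $B = T/\mathfrak m T$, which is a polynomial ring in $d$ indeterminates over $k$. The Sally module of $I$ with respect to $Q$ is the finitely generated graded $T$-module $S = IR/IT$; if $\mathfrak m S = (0)$, then $S$ is a graded $B$-module. $B(-1)$ denotes the graded module with $[B(-1)]_n = B_{n-1}$ for all $n \in \mathbb Z$. *)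

(* Defs.v *)
From HB Require Import structures.
From mathcomp Require Import all_boot all_order all_algebra.
From mathcomp Require Import generic_quotient ring_quotient.
From mathcomp Require Import boolp classical_sets functions cardinality.

Set Implicit Arguments.
Unset Strict Implicit.
Unset Printing Implicit Defensive.

Import GRing.Theory.
Local Open Scope classical_set_scope.
Local Open Scope ring_scope.
Local Open Scope quotient_scope.

(* Ideals as classical sets.  Here an ideal may be the unit ideal, whereas the
   library's [idealr] are the proper (and boolean) ones. *)
Section Ideals.
Variable R : comNzRingType.
Implicit Types (I J P Q : set R) (m : idealr R).

Definition is_ideal I : Prop :=
  [/\ I 0, forall x y, I x -> I y -> I (x + y)
         & forall r x, I x -> I (r * x)].

Definition gen_ideal n (x : 'I_n -> R) : set R :=
  [set y | exists c : 'I_n -> R, y = \sum_i c i * x i].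

(* X Y = finite sums of products x y; this is the product ideal when X and Y
   are ideals, and the extension of X to the subring Y when Y is a subring. *)
Definition prod_set (X Y : set R) : set R :=
  [set z | exists n (x y : 'I_n -> R),
     [/\ forall i, X (x i), forall i, Y (y i) & z = \sum_i x i * y i]].

Definition ideal_pow I n : set R := iter n (prod_set I) setT.

Definition radical I : set R := [set x | exists n, I (x ^+ n)].

Definition prime_ideal P : Prop :=
  [/\ is_ideal P, ~ P 1 & forall x y, P (x * y) -> P x \/ P y].

Definition maximal_ideal P : Prop :=
  [/\ is_ideal P, ~ P 1 &
      forall J, is_ideal J -> P `<=` J -> J = P \/ J = setT].

Definition primary_ideal I : Prop :=
  [/\ is_ideal I, ~ I 1 & forall x y, I (x * y) -> I x \/ radical I y].

Definition primary_to m I : Prop := primary_ideal I /\ radical I = [set` m].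

Definition noetherian : Prop :=
  forall I, is_ideal I -> exists n (x : 'I_n -> R), I = gen_ideal x.

(* P_0 < P_1 < ... < P_n = P *)
Definition prime_chain n P : Prop :=
  exists c : nat -> set R,
    [/\ forall i, (i <= n)%N -> prime_ideal (c i),
        forall i, (i < n)%N -> c i `<` c i.+1 & c n = P].

Definition krull_dim n : Prop :=
  (exists P, prime_chain n P) /\ (forall P, ~ prime_chain n.+1 P).

(* ht I >= n, the height of I being the infimum of those of the primes that
   contain I *)
Definition height_ge n I : Prop :=
  forall P, prime_ideal P -> I `<=` P -> prime_chain n P.

Definition local_ring m : Prop :=
  maximal_ideal [set` m] /\ forall P, maximal_ideal P -> P = [set` m].

(* Only x_0, ..., x_(n-1) are relevant. *)
Definition regular_seq n (x : nat -> R) : Prop :=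
  ~ gen_ideal (fun j : 'I_n => x j) 1 /\
  forall i y, (i < n)%N -> gen_ideal (fun j : 'I_i => x j) (x i * y) ->
    gen_ideal (fun j : 'I_i => x j) y.

Definition depth m n : Prop :=
  (exists x, (forall i, (i < n)%N -> x i \in m) /\ regular_seq n x) /\
  (forall k x, (forall i, (i < k)%N -> x i \in m) -> regular_seq k x ->
     (k <= n)%N).

Definition cohen_macaulay_local m d : Prop :=
  [/\ noetherian, local_ring m, krull_dim d & depth m d].

Definition reduction J I : Prop :=
  [/\ is_ideal J, J `<=` I &
      exists n, ideal_pow I n.+1 = prod_set J (ideal_pow I n)].

Definition minimal_reduction J I : Prop :=
  reduction J I /\ forall K, reduction K I -> K `<=` J -> K = J.

Lemma minimal_reduction_sub J I : minimal_reduction J I -> J `<=` I.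
Proof. by case=> -[]. Qed.

Lemma prod_set0 X Y : prod_set X Y 0.
Proof.
by exists 0%N, (fun=> 0), (fun=> 0); split; [case|case|rewrite big_ord0].
Qed.

Lemma prod_setD X Y u v :
  prod_set X Y u -> prod_set X Y v -> prod_set X Y (u + v).
Proof.
move=> [n [x [y [Xx Yy ->]]]] [p [x' [y' [Xx' Yy' ->]]]].
exists (n + p)%N,
  (fun i => match fintype.split i with inl j => x j | inr j => x' j end),
  (fun i => match fintype.split i with inl j => y j | inr j => y' j end).
split=> [i|i|]; [by case: (fintype.split i)|by case: (fintype.split i)|].
rewrite big_split_ord /=; congr (_ + _); apply: eq_bigr => i _.
  by rewrite (unsplitK (inl i : 'I_n + 'I_p)).
by rewrite (unsplitK (inr i : 'I_n + 'I_p)).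
Qed.

Lemma prod_setMl (X Y : set R) u t :
  (forall y, Y y -> Y (t * y)) -> prod_set X Y u -> prod_set X Y (t * u).
Proof.
move=> YM [n [x [y [Xx Yy ->]]]]; exists n, x, (fun i => t * y i).
by split=> // [i|]; [exact: YM|rewrite mulr_sumr; under eq_bigr do rewrite mulrCA].
Qed.

End Ideals.

(* The Rees algebra A[Xt], the A-subalgebra of A[t] = {poly A} generated by the
   x t for x in X. *)
Section Rees.
Variable A : comNzRingType.
Implicit Types (Q I : set A) (m : idealr A).

Definition subring_set (U : set {poly A}) : Prop :=
  [/\ U 1, forall p q, U p -> U q -> U (p - q)
         & forall p q, U p -> U q -> U (p * q)].

Definition rees Q : set {poly A} :=
  smallest subring_set (range polyC `|` [set x *: 'X | x in Q]).

Lemma rees_subring Q : subring_set (rees Q).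
Proof.
split=> [|p q Hp Hq|p q Hp Hq] U HU; case: (HU) => -[U1 UB UM] _.
- exact: U1.
- exact: (UB _ _ (Hp U HU) (Hq U HU)).
- exact: (UM _ _ (Hp U HU) (Hq U HU)).
Qed.

Lemma reesC Q c : rees Q c%:P.
Proof. by move=> U [_]; apply; left; exists c. Qed.

Lemma rees_mono Q I : Q `<=` I -> rees Q `<=` rees I.
Proof.
move=> QI p Hp U [HU UI]; apply: Hp; split=> // q [Hq|[x Qx <-]].
  by apply: UI; left.
by apply: UI; right; exists x => //; exact: QI.
Qed.

Definition rees_pred Q : {pred {poly A}} := fun p => `[< rees Q p >].

Lemma rees_subring_closed Q : subring_closed (rees_pred Q).
Proof.
have [R1 RB RM] := rees_subring Q.
split=> [|p q /asboolP Hp /asboolP Hq|p q /asboolP Hp /asboolP Hq];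
  apply/asboolP => //; [exact: RB|exact: RM].
Qed.

HB.instance Definition _ Q :=
  GRing.isSubringClosed.Build {poly A} (rees_pred Q) (rees_subring_closed Q).

Record rees_ring Q :=
  ReesRing { rees_val :> {poly A}; _ : rees_val \in rees_pred Q }.

HB.instance Definition _ Q := [isSub for @rees_val Q].
HB.instance Definition _ Q := [Choice of rees_ring Q by <:].
HB.instance Definition _ Q := [SubChoice_isSubComNzRing of rees_ring Q by <:].

Definition rees_const Q (c : A) : rees_ring Q :=
  ReesRing (asboolT (@reesC Q c)).

(* the polynomials of the form c t^n; only 0 when n < 0 *)
Definition homog (n : int) : set {poly A} :=
  [set p | forall i : nat, p`_i != 0 -> i%:Z = n].

(* m T for T = A[Qt], as an ideal of T *)
Definition fiber_ideal Q m : set (rees_ring Q) :=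
  prod_set [set rees_const Q c | c in [set` m]] setT.

Definition fiber_pred Q m : {pred rees_ring Q} :=
  fun t => `[< fiber_ideal m t >].

Lemma fiber_idealr_closed Q m : idealr_closed (@fiber_pred Q m).
Proof.
split; first exact/asboolP/prod_set0.
  apply/asboolPn => -[n [x [y [Hx _ E]]]].
  have : (val (1 : rees_ring Q))`_0 = (val (\sum_i x i * y i))`_0 by rewrite E.
  rewrite raddf_sum /= coef_sum coef1 => H.
  have: 1 \in m by rewrite [1]H; apply: rpred_sum => i _;
    have [c mc <-] := Hx i; rewrite /= coefCM mulrC; exact: idealMr.
  by rewrite idealr1.
move=> t u v /asboolP Hu /asboolP Hv; apply/asboolP.
by apply: prod_setD => //; exact: prod_setMl.
Qed.

HB.instance Definition _ Q m :=
  isIdealr.Build (rees_ring Q) (@fiber_pred Q m) (fiber_idealr_closed Q m).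

(* B = T / m T *)
Definition fiber_ring Q m := {ideal_quot (@fiber_pred Q m)}.

HB.instance Definition _ Q m := GRing.ComNzRing.on (fiber_ring Q m).

Definition fiber_pi Q m (t : rees_ring Q) : fiber_ring Q m :=
  \pi_({ideal_quot (@fiber_pred Q m)}) t.

Definition fiber_gr Q m (n : int) : set (fiber_ring Q m) :=
  [set fiber_pi m t | t in [set t | homog n (rees_val t)]].

(* B as a T-module *)
Definition fiber_scale Q m (t : rees_ring Q) (b : fiber_ring Q m) :
  fiber_ring Q m := fiber_pi m t * b.

Fact fiber_scaleA Q m t u (b : fiber_ring Q m) :
  fiber_scale t (fiber_scale u b) = fiber_scale (t * u) b.
Proof. by rewrite /fiber_scale /fiber_pi rmorphM mulrA. Qed.
Fact fiber_scale1 Q m : left_id 1 (@fiber_scale Q m).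
Proof. by move=> b; rewrite /fiber_scale /fiber_pi rmorph1 mul1r. Qed.
Fact fiber_scaleDr Q m : right_distributive (@fiber_scale Q m) +%R.
Proof. by move=> t b c; rewrite /fiber_scale mulrDr. Qed.
Fact fiber_scaleDl Q m (b : fiber_ring Q m) :
  {morph (fun t => fiber_scale t b) : t u / t + u}.
Proof. by move=> t u; rewrite /fiber_scale /fiber_pi rmorphD mulrDl. Qed.

HB.instance Definition _ Q m :=
  GRing.Zmodule_isLmodule.Build (rees_ring Q) (fiber_ring Q m)
    (@fiber_scaleA Q m) (@fiber_scale1 Q m) (@fiber_scaleDr Q m)
    (@fiber_scaleDl Q m).

End Rees.

Arguments fiber_gr {A} Q m n.

Section QuotientModule.
Variables (R : comNzRingType) (M : lmodType R) (N : zmodClosed M).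
Hypothesis NM : submod_closed N.

Definition quot_lmod_of of submod_closed N := {ideal_quot N}.
Local Notation quot_lmod := (quot_lmod_of NM).

HB.instance Definition _ := GRing.Zmodule.on quot_lmod.

Definition quot_lmod_pi (x : M) : quot_lmod := \pi_({ideal_quot N}) x.

Definition quot_lmod_scale (r : R) (x : quot_lmod) : quot_lmod :=
  quot_lmod_pi (r *: repr (x : {ideal_quot N})).

Fact quot_lmod_pi_scale r x :
  quot_lmod_scale r (quot_lmod_pi x) = quot_lmod_pi (r *: x).
Proof.
apply/eqP; rewrite /quot_lmod_scale /quot_lmod_pi -Quotient.idealrBE.
have [_ NZ] := NM; rewrite -scalerBr -[_ *: _]addr0 NZ ?rpred0 //.
by rewrite Quotient.idealrBE reprK.
Qed.

Fact quot_lmod_scaleA r s x :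
  quot_lmod_scale r (quot_lmod_scale s x) = quot_lmod_scale (r * s) x.
Proof. by rewrite quot_lmod_pi_scale scalerA. Qed.
Fact quot_lmod_scale1 : left_id 1 quot_lmod_scale.
Proof.
by move=> x; rewrite /quot_lmod_scale scale1r /quot_lmod_pi reprK.
Qed.
Fact quot_lmod_scaleDr : right_distributive quot_lmod_scale +%R.
Proof.
move=> r x y; rewrite -[x](@reprK _ ({ideal_quot N})).
rewrite -[y](@reprK _ ({ideal_quot N})) -!/(quot_lmod_pi _).
rewrite /quot_lmod_pi -raddfD -!/(quot_lmod_pi _) !quot_lmod_pi_scale scalerDr.
exact: raddfD.
Qed.
Fact quot_lmod_scaleDl x : {morph quot_lmod_scale^~ x : r s / r + s}.
Proof.
by move=> r s; rewrite /quot_lmod_scale scalerDl; exact: raddfD.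
Qed.

HB.instance Definition _ := GRing.Zmodule_isLmodule.Build R quot_lmod
  quot_lmod_scaleA quot_lmod_scale1 quot_lmod_scaleDr quot_lmod_scaleDl.

End QuotientModule.

(* The module M over R / J when the ideal J annihilates M. *)
Section Annihilated.
Variables (R : comNzRingType) (J : idealr R) (M : lmodType R).
Hypothesis JM : forall r (x : M), r \in J -> r *: x = 0.

Definition annih_lmod of (forall r (x : M), r \in J -> r *: x = 0) : Type := M.
Local Notation MJ := (annih_lmod JM).

HB.instance Definition _ := GRing.Zmodule.copy MJ M.

Definition annih_scale (b : {ideal_quot J}) (x : MJ) : MJ := repr b *: (x : M).

Fact annih_scale_pi r (x : M) :
  annih_scale (\pi_({ideal_quot J}) r) x = r *: x.
Proof.
apply/eqP; rewrite -subr_eq0 /annih_scale -scalerBl; apply/eqP/JM.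
by rewrite Quotient.idealrBE reprK.
Qed.

Fact annih_scaleA b c x : annih_scale b (annih_scale c x) = annih_scale (b * c) x.
Proof.
rewrite -[b](@reprK _ {ideal_quot J}) -[c](@reprK _ {ideal_quot J}) -rmorphM.
by rewrite !annih_scale_pi scalerA.
Qed.
Fact annih_scale1 : left_id 1 annih_scale.
Proof. by move=> x; rewrite -(rmorph1 (\pi_({ideal_quot J}))) annih_scale_pi scale1r. Qed.
Fact annih_scaleDr : right_distributive annih_scale +%R.
Proof. by move=> b x y; exact: scalerDr. Qed.
Fact annih_scaleDl x : {morph annih_scale^~ x : b c / b + c}.
Proof.
move=> b c; rewrite -[b](@reprK _ {ideal_quot J}) -[c](@reprK _ {ideal_quot J}).
by rewrite -rmorphD !annih_scale_pi scalerDl.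
Qed.

HB.instance Definition _ := GRing.Zmodule_isLmodule.Build {ideal_quot J} MJ
  annih_scaleA annih_scale1 annih_scaleDr annih_scaleDl.

End Annihilated.

(* The T-module S = IR / IT with T = A[Qt], R = A[It].  The inclusion Q <= I
   makes T a subring of R, hence R a T-module. *)
Section Sally.
Variables (A : comNzRingType) (Q I : set A).
Hypothesis QI : Q `<=` I.

Definition poly_lmod of phant (rees_ring Q) : Type := {poly A}.
Local Notation AtT := (poly_lmod (Phant (rees_ring Q))).

HB.instance Definition _ := GRing.Zmodule.copy AtT {poly A}.

Definition poly_scale (t : rees_ring Q) (p : AtT) : AtT :=
  rees_val t * (p : {poly A}).

Fact poly_scaleA t u p : poly_scale t (poly_scale u p) = poly_scale (t * u) p.
Proof. exact: mulrA. Qed.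
Fact poly_scale1 : left_id 1 poly_scale.
Proof. by move=> p; exact: mul1r. Qed.
Fact poly_scaleDr : right_distributive poly_scale +%R.
Proof. by move=> t p q; exact: mulrDr. Qed.
Fact poly_scaleDl p : {morph poly_scale^~ p : t u / t + u}.
Proof. by move=> t u; exact: mulrDl. Qed.

HB.instance Definition _ := GRing.Zmodule_isLmodule.Build (rees_ring Q) AtT
  poly_scaleA poly_scale1 poly_scaleDr poly_scaleDl.

(* I R for J = I, and I T for J = Q *)
Definition ext_set (J : set A) : set {poly A} := prod_set (polyC @` I) (rees J).

Lemma ext_set_submod J : Q `<=` J ->
  submod_closed ((fun p => `[< ext_set J p >]) : {pred AtT}).
Proof.
move=> QJ; split; first exact/asboolP/prod_set0.
move=> t p q /asboolP Hp /asboolP Hq; apply/asboolP.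
apply: prod_setD => //; apply: prod_setMl => // y Hy.
have [_ _ RM] := rees_subring J; apply: RM => //.
by apply: (rees_mono QJ); case: t => t /= /asboolP.
Qed.

Definition IR_pred of Q `<=` I : {pred AtT} := fun p => `[< ext_set I p >].

HB.instance Definition _ :=
  GRing.isSubmodClosed.Build (rees_ring Q) AtT (IR_pred QI) (ext_set_submod QI).

Record IR_lmod := IRLmod { IR_val : AtT; _ : IR_val \in IR_pred QI }.

HB.instance Definition _ := [isSub for IR_val].
HB.instance Definition _ := [Choice of IR_lmod by <:].
HB.instance Definition _ := [SubChoice_isSubLmodule of IR_lmod by <:].

Definition IT_pred : {pred IR_lmod} :=
  fun x => `[< ext_set Q (IR_val x : {poly A}) >].

Fact IT_submod : submod_closed IT_pred.
Proof.
have [H0 H1] := ext_set_submod (@subset_refl _ Q).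
by split=> [|t x y Hx Hy]; [exact: H0|exact: H1].
Qed.

HB.instance Definition _ :=
  GRing.isSubmodClosed.Build (rees_ring Q) IR_lmod IT_pred IT_submod.

Definition sally := quot_lmod_of IT_submod.

HB.instance Definition _ := GRing.Lmodule.on sally.

Definition sally_gr (n : int) : set sally :=
  [set quot_lmod_pi IT_submod x | x in [set x | homog n (IR_val x)]].

Variable m : idealr A.

(* m S = (0) *)
Definition sally_annih : Prop :=
  forall c (s : sally), c \in m -> rees_const Q c *: s = 0.

Lemma sally_annih_fiber : sally_annih ->
  forall t (s : sally), t \in @fiber_pred A Q m -> t *: s = 0.
Proof.
move=> mS t s /asboolP[n [x [y [Hx _ ->]]]].
rewrite scaler_suml big1 // => i _; have [c mc <-] := Hx i.
by rewrite -scalerA mS.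
Qed.

(* S as a B-module, when m S = (0) *)
Definition sally_fiber (mS : sally_annih) :=
  annih_lmod (sally_annih_fiber mS).

HB.instance Definition _ (mS : sally_annih) :=
  GRing.Lmodule.copy (sally_fiber mS) (annih_lmod (sally_annih_fiber mS)).

End Sally.

Arguments sally_gr {A Q I} QI n.
Arguments sally_annih {A Q I} QI m.

(* Rank of a module over a domain B: the dimension of V = K tensor_B M over the
   fraction field K of B.  K and V are given up to isomorphism, as the
   localizations of B and of M at the nonzero elements of B. *)
Section Rank.
Variable B : comNzRingType.

Definition is_fraction_field (K : fieldType) (phi : {rmorphism B -> K}) : Prop :=
  injective phi /\
  forall z, exists b s, s != 0 /\ z = phi b / phi s.

Definition is_fraction_module (K : fieldType) (phi : {rmorphism B -> K})
    (M : lmodType B) (V : lmodType K) (psi : {linear M -> V | phi \; *:%R}) :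
    Prop :=
  (forall x, psi x = 0 <-> exists2 s, s != 0 & s *: x = 0) /\
  (forall v, exists s x, s != 0 /\ v = (phi s)^-1 *: psi x).

Definition has_rank (M : lmodType B) (r : nat) : Prop :=
  exists (K : fieldType) (phi : {rmorphism B -> K}) (V : vectType K)
         (psi : {linear M -> V | phi \; *:%R}),
    [/\ is_fraction_field phi, is_fraction_module psi & \dim {:V} = r].

End Rank.

(* A grading is given by its homogeneous components, indexed by int. *)
Section Graded.

Definition shift_gr (M : Type) (gr : int -> set M) (k : int) : int -> set M :=
  fun n => gr (k + n).

Definition graded_ideal (B : comNzRingType) (gr : int -> set B) (I : set B) :
    Prop :=
  is_ideal I /\
  forall x, I x -> exists k (y : 'I_k -> B),
    (forall i, I (y i) /\ exists n, gr n (y i)) /\ x = \sum_i y i.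

(* M is isomorphic, as a graded module, to the graded submodule P of N. *)
Definition graded_iso_onto (R : comNzRingType) (M N : lmodType R)
    (grM : int -> set M) (grN : int -> set N) (P : set N) : Prop :=
  exists f : {linear M -> N},
    [/\ injective f, range f = P & forall n, f @` grM n = P `&` grN n].

End Graded.

(* Main.v *)
Require Import Defs.
From HB Require Import structures.
From mathcomp Require Import all_boot all_order all_algebra.
From mathcomp Require Import generic_quotient ring_quotient.
From mathcomp Require Import ring.
From mathcomp Require Import boolp classical_sets functions cardinality.
From mathcomp Require Import mpoly.
Set Implicit Arguments.
Unset Strict Implicit.
Unset Printing Implicit Defensive.
Import GRing.Theory.
Local Open Scope classical_set_scope.
Local Open Scope ring_scope.

(** Why the theorem holds.

    The ideal Q is generated by d elements and its radical is m, while m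
    contains a regular sequence of length d.  Hence Q is generated by a regular
    sequence b_0, ..., b_(d-1) ([regular_generators]), and such generators are
    quasi-regular: a form of degree n whose value at b lies in Q^(n+1) has all
    its coefficients in Q ([quasi_regular]).  So B = T / m T is the polynomial
    ring k[X_0, ..., X_(d-1)] ([fiber_ring_polynomial]), a factorial domain
    ([mpoly_irreducibles_prime]).

    The homogeneous component S_n is I^(n+1) / I Q^n, with S_0 = 0.  Everything
    about S rests on [power_cancel_forms].  Let F_1, ..., F_s be forms of degree
    p over A such that a relation sum_l Y_l F_l = 0 over k with Y_l of degree at
    most n forces all Y_l to vanish.  Then sum_l x_l F_l(b) in I Q^(n+p) implies
    that all x_l lie in I Q^n.  Indeed quasi-regularity turns the assumption
    into a statement about coefficients, first modulo Q and then modulo I, and a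
    matrix over A that is injective modulo m is injective modulo every ideal.
    With one form this says that S is torsion-free over B.

    If S is isomorphic to B(-1) or to an ideal, it embeds into the domain B with
    nonzero image, whence m S = 0 and the rank is 1 ([embedding_annih],
    [embedding_rank]).

    Conversely let m S = 0 and rank S = 1.  Then S_1 contains some s_0 <> 0,
    and there are C <> 0 in B with C S contained in B s_0.  Choose such a C of
    minimal degree p, homogeneous.  Then s |-> C s / s_0 embeds S into B as a
    graded ideal J, with degrees raised by p - 1 ([rank_one_embedding]); by
    minimality of C the elements of J have no common divisor other than units,
    so that J = B or ht J >= 2 ([divisor_free_height]).  It remains to find p.

    If J = B, the preimage of 1 has degree 1 - p, which must be positive as
    S_0 = 0; so p = 0.  If J <> B, then p >= 1 because J contains C.  Suppose
    that p >= 2.  By factoriality J contains coprime forms u, g of a common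
    degree q ([coprime_pair]), the images of s_1, s_2 in S_n with
    n = q + 1 - p < q, and g s_1 = u s_2.  But over k a relation
    Y_1 g = Y_2 u with deg Y_1 < q = deg u forces Y_1 = 0, hence Y_2 = 0, and
    [power_cancel_forms] with two forms gives s_1 = 0, that is u = 0, which is
    absurd.  So p = 1, and S is isomorphic to J without a shift. *)

(** * Ideals and associated primes of a noetherian ring *)

Section IdealBasics.
Variable A : comNzRingType.
Implicit Types (J K P : set A) (x y z : A).

Lemma ideal0 J : is_ideal J -> J 0. Proof. by case. Qed.
Lemma idealD J x y : is_ideal J -> J x -> J y -> J (x + y).
Proof. by case=> _ + _; apply. Qed.
Lemma idealM J r x : is_ideal J -> J x -> J (r * x).
Proof. by case=> _ _; apply. Qed.
Lemma idealMr_set J r x : is_ideal J -> J x -> J (x * r).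
Proof. by move=> Jid Jx; rewrite mulrC; apply: idealM. Qed.
Lemma idealN J x : is_ideal J -> J x -> J (- x).
Proof. by move=> Jid Jx; rewrite -mulN1r; apply: idealM. Qed.
Lemma idealB J x y : is_ideal J -> J x -> J y -> J (x - y).
Proof. by move=> Jid Jx Jy; apply: idealD => //; apply: idealN. Qed.
Lemma ideal_sum J (T : Type) (r : seq T) (p : pred T) (F : T -> A) :
  is_ideal J -> (forall i, p i -> J (F i)) -> J (\sum_(i <- r | p i) F i).
Proof.
move=> Jid JF; elim/big_ind: _ => //; first exact: ideal0.
by move=> x y; apply: idealD.
Qed.

Lemma idealr_is_ideal (m : idealr A) : is_ideal [set` m].
Proof.
split=> /=; [exact: rpred0|by move=> x y; apply: rpredD|].
by move=> r x mx; apply: idealMr.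
Qed.

Lemma zero_is_ideal : is_ideal [set (0 : A)].
Proof. by split=> //= [u v -> ->|r u ->]; rewrite ?addr0 ?mulr0. Qed.

Lemma zero_prime :
  (forall x y : A, x * y = 0 -> x = 0 \/ y = 0) -> prime_ideal [set (0 : A)].
Proof.
move=> domA; split=> [||x y /domA//]; first exact: zero_is_ideal.
by move/eqP; rewrite oner_eq0.
Qed.

Lemma gen_ideal_is_ideal n (x : 'I_n -> A) : is_ideal (gen_ideal x).
Proof.
split=> [|y z [c ->] [e ->]|r y [c ->]].
- by exists (fun=> 0); rewrite big1 // => i _; rewrite mul0r.
- exists (fun i => c i + e i); rewrite -big_split /=.
  by apply: eq_bigr => i _; rewrite mulrDl.
- by exists (fun i => r * c i); rewrite mulr_sumr; apply: eq_bigr => i _; rewrite mulrA.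
Qed.

Lemma gen_ideal_gen n (x : 'I_n -> A) i : gen_ideal x (x i).
Proof.
exists (fun j => (j == i)%:R); rewrite (bigD1 i) //= eqxx mul1r big1 ?addr0 //.
by move=> j /negbTE->; rewrite mul0r.
Qed.

Lemma gen_ideal_min n (x : 'I_n -> A) J :
  is_ideal J -> (forall i, J (x i)) -> gen_ideal x `<=` J.
Proof. by move=> Jid Jx _ [c ->]; apply: ideal_sum => // i _; apply: idealM. Qed.

Definition adjoin J x : set A := [set u | exists r, J (u - r * x)].

Lemma adjoin_is_ideal J x : is_ideal J -> is_ideal (adjoin J x).
Proof.
move=> Jid; split=> [|u v [r Hr] [s Hs]|t u [r Hr]].
- by exists 0; rewrite mul0r subr0; apply: ideal0.
- exists (r + s); rewrite mulrDl opprD addrACA; exact: idealD.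
- by exists (t * r); rewrite -mulrA -mulrBr; apply: idealM.
Qed.

Lemma sub_adjoin J x : J `<=` adjoin J x.
Proof. by move=> u Ju; exists 0; rewrite mul0r subr0. Qed.

Lemma adjoin_gen J x : is_ideal J -> adjoin J x x.
Proof. by move=> Jid; exists 1; rewrite mul1r subrr; apply: ideal0. Qed.

Lemma adjoin_min J K x : is_ideal K -> J `<=` K -> K x -> adjoin J x `<=` K.
Proof.
move=> Kid JK Kx u [r Hr]; rewrite -[u](subrK (r * x)).
by apply: idealD => //; [exact: JK|exact: idealM].
Qed.

Lemma adjoinC J x y : is_ideal J -> adjoin (adjoin J x) y = adjoin (adjoin J y) x.
Proof.
move=> Jid.
have sub u v : adjoin (adjoin J u) v `<=` adjoin (adjoin J v) u.
  have Jv := adjoin_is_ideal v Jid; have Jvu := adjoin_is_ideal u Jv.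
  apply: adjoin_min => //; last exact/sub_adjoin/adjoin_gen.
  apply: adjoin_min => //; last exact: adjoin_gen.
  by move=> w Jw; do 2 apply: sub_adjoin.
by rewrite eqEsubset; split; apply: sub.
Qed.

(** The class of x is a nonzerodivisor of A / J. *)
Definition regular_on J x := forall y, J (x * y) -> J y.

(** The annihilator of the class of y in A / J. *)
Definition colon J y : set A := [set z | J (z * y)].

Lemma colon_is_ideal J y : is_ideal J -> is_ideal (colon J y).
Proof.
move=> Jid; split=> [|u v|r u]; rewrite /colon /=.
- by rewrite mul0r; apply: ideal0.
- by rewrite mulrDl; apply: idealD.
- by rewrite -mulrA; apply: idealM.
Qed.

(* noetherian rings *)
Section Noetherian.
Hypothesis noethA : noetherian A.

Lemma noetherian_max (F : set (set A)) I0 :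
  (forall I, F I -> is_ideal I) -> F I0 ->
  exists I, [/\ F I, I0 `<=` I & forall K, F K -> I `<=` K -> K = I].
Proof.
move=> Fid FI0; apply: contrapT => nomax.
pose G := {I | F I /\ I0 `<=` I}.
have next (g : G) : exists h : G, sval g `<` sval h.
  case: g => I /= [FI I0I]; apply: contrapT => no; apply: nomax; exists I.
  split=> // K FK IK; apply: contrapT => KI; apply: no.
  have I0K : I0 `<=` K by apply: (subset_trans I0I).
  exists (exist _ K (conj FK I0K)) => /=; split=> // KsubI.
  by apply: KI; rewrite eqEsubset.
pose g0 : G := exist _ I0 (conj FI0 (@subset_refl _ I0)).
pose s n := iter n (fun g => sval (cid (next g))) g0.
have sS n : sval (s n) `<` sval (s n.+1) by exact: svalP (cid (next (s n))).
have smono p n : (p <= n)%N -> sval (s p) `<=` sval (s n).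
  elim: n => [|n IHn]; first by rewrite leqn0 => /eqP->.
  rewrite leq_eqVlt => /orP[/eqP->//|/IHn]; move/subset_trans; apply.
  by case: (sS n).
have sid n : is_ideal (sval (s n)) by apply: Fid; case: (svalP (s n)).
pose U : set A := [set x | exists n, sval (s n) x].
have Uid : is_ideal U.
  split=> [|x y [n xn] [p yp]|r x [n xn]].
  - by exists 0%N; apply: ideal0.
  - exists (maxn n p); apply: idealD => //.
    + by apply: smono xn; rewrite leq_maxl.
    + by apply: smono yp; rewrite leq_maxr.
  - by exists n; apply: idealM.
have [n [x Ux]] := noethA Uid.
have /choice [N HN] : forall i, exists n, sval (s n) (x i).
  by move=> i; have : U (x i) by rewrite Ux; apply: gen_ideal_gen.
have [_] := sS (\max_i N i); apply => u su.
have: gen_ideal x u by rewrite -Ux; exists (\max_i N i).+1.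
apply: gen_ideal_min => // i; apply: smono (HN i); exact: leq_bigmax.
Qed.

Lemma noetherian_fin_gen J (Y : set A) : is_ideal J ->
  exists ys : seq A, (forall y, y \in ys -> Y y) /\
    forall z, Y z -> foldr (fun y K => adjoin K y) J ys z.
Proof.
move=> Jid.
pose F : set (set A) := [set K | exists2 ys : seq A, (forall y, y \in ys -> Y y)
   & K = foldr (fun y K => adjoin K y) J ys].
have Fid (ys : seq A) : is_ideal (foldr (fun y K => adjoin K y) J ys).
  by elim: ys => //= y ys IH; apply: adjoin_is_ideal.
have [||K [[ys Yys ->] _ maxK]] := @noetherian_max F J.
- by move=> I [ys _ ->].
- by exists [::].
exists ys; split=> // z Yz; rewrite -(maxK (foldr (fun y K => adjoin K y) J (z :: ys))) /=.
- exact: adjoin_gen.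
- by exists (z :: ys) => // y; rewrite inE => /orP[/eqP->//|]; apply: Yys.
- exact: sub_adjoin.
Qed.

Lemma annihilator_notin_prime P J (ys : seq A) : prime_ideal P -> is_ideal J ->
  (forall y, y \in ys -> exists r, J (r * y) /\ ~ P r) ->
  exists r, ~ P r /\ forall y, y \in ys -> J (r * y).
Proof.
move=> [Pid P1 PM] Jid; elim: ys => [_|y ys IH Hys]; first by exists 1.
have [r [Pr Hr]] : exists r, ~ P r /\ forall y, y \in ys -> J (r * y).
  by apply: IH => z zys; apply: Hys; rewrite inE zys orbT.
have [t [Jt Pt]] := Hys y (mem_head _ _); exists (r * t); split.
  by case/PM.
move=> z; rewrite inE => /orP[/eqP->|zys]; first by rewrite -mulrA; apply: idealM.
by rewrite mulrAC mulrC; apply: idealM => //; apply: Hr.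
Qed.

(** The maximal members of the family of all (J : y) with y outside J are
    prime, and every zero divisor modulo J lies in one of them.  There are
    finitely many: if y_1, ..., y_n generate all the y in question modulo J,
    then the intersection of the (J : y_i) lies in each of the primes, which
    therefore contains, hence equals, one of the (J : y_i). *)
Lemma finite_maximal_assassins J : is_ideal J ->
  exists ys : seq A, (forall y, y \in ys -> ~ J y /\ prime_ideal (colon J y)) /\
    forall z, ~ regular_on J z -> exists2 y, y \in ys & J (z * y).
Proof.
move=> Jid.
(* the elements y whose annihilator modulo J is maximal *)
pose Y : set A := [set y | ~ J y /\
  forall y', ~ J y' -> colon J y `<=` colon J y' -> colon J y' = colon J y].
have Yprime y : Y y -> prime_ideal (colon J y).
  move=> [Jy ymax]; split; first exact: colon_is_ideal.
    by rewrite /colon /= mul1r.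
  move=> a b Jab; case: (EM (J (b * y))); [by right|move=> Jby; left].
  rewrite -(ymax (b * y)) //; first by rewrite /colon /= mulrA.
  by move=> z; rewrite /colon /= mulrCA; apply: idealM.
have [ys [Yys genY]] := noetherian_fin_gen Y Jid; exists ys; split.
  by move=> y /Yys Yy; split; [case: Yy|apply: Yprime].
move=> z zreg.
have [y [Jy Jzy]] : exists y, ~ J y /\ J (z * y).
  apply: contrapT => no; apply: zreg => y Jzy; apply: contrapT => Jy.
  by apply: no; exists y.
have [||_ [[y' Jy' <-] yy' y'max]] :=
   @noetherian_max [set colon J y | y in ~` J] (colon J y).
- by move=> _ [u _ <-]; apply: colon_is_ideal.
- by exists y.
have Yy' : Y y' by split=> // u Ju; apply: y'max; exists u.
have Py' := Yprime _ Yy'.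
apply: contrapT => no.
have [|r [Pr Hr]] := annihilator_notin_prime (J := J) (ys := ys) Py' Jid.
  move=> u uys; apply: contrapT => no'; apply: no; exists u => //.
  have [Ju umax] := Yys _ uys.
  rewrite -[J _]/(colon J u z) -(umax y') //; first exact: yy'.
  by move=> r Jr; apply: contrapT => Pr; apply: no'; exists r.
apply: Pr; have := genY _ Yy'; elim: {Yys genY no} ys y' Hr {Yy' Jy' yy' y'max Py'} => [|u ys IH] v Hr /=.
  exact: idealM.
move=> [w Hw]; rewrite /colon /= -[v](subrK (w * u)) mulrDr.
apply: idealD => //.
  by apply: IH => // t tys; apply: Hr; rewrite inE tys orbT.
by rewrite mulrCA; apply: idealM => //; apply: Hr; rewrite mem_head.
Qed.

End Noetherian.
End IdealBasics.

(** Inverses are stated as a property, since the rings to which this is applied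
    carry no inversion operation. *)
Definition invertible (A : comNzRingType) (x : A) := exists y, y * x = 1.

(** * Regular elements by avoidance of associated primes *)

Section Avoidance.
Variable A : comNzRingType.
Implicit Types (J K P : set A) (x y z : A).

Lemma ideal_invertible J x y : is_ideal J -> invertible x -> J (x * y) -> J y.
Proof.
move=> Jid [u ux] Jxy; have -> : y = u * (x * y) by rewrite mulrA ux mul1r.
exact: idealM.
Qed.

Lemma invertibleM x y : invertible x -> invertible y -> invertible (x * y).
Proof.
by move=> [u ux] [v vy]; exists (u * v); rewrite mulrACA ux vy mulr1.
Qed.

(** The determinant of the Vandermonde matrix is a product of the differences
    of the c i, hence invertible. *)
Lemma ideal_vandermonde J s (c : 'I_s -> A) (a : 'I_s -> A) : is_ideal J ->
  (forall i j, i != j -> invertible (c i - c j)) ->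
  (forall i, J (\sum_(j < s) c i ^+ j * a j)) -> forall j, J (a j).
Proof.
move=> Jid cinv Ja j.
pose V := Vandermonde s (\row_i c i).
pose va : 'rV[A]_s := \row_j a j.
have HV i : (va *m V) ord0 i = \sum_(j < s) c i ^+ j * a j.
  by rewrite !mxE; apply: eq_bigr => l _; rewrite !mxE mulrC.
apply: (@ideal_invertible J (\det V)) => //.
  rewrite det_Vandermonde; elim/big_ind: _ => [|x y|i _].
  - by exists 1; rewrite mulr1.
  - exact: invertibleM.
  elim/big_ind: _ => [|x y|l il]; [by exists 1; rewrite mulr1|exact: invertibleM|].
  by rewrite !mxE; apply: cinv; rewrite neq_ltn il orbT.
have <- : (va *m V *m \adj V) ord0 j = \det V * a j.
  by rewrite -mulmxA mul_mx_adj mul_mx_scalar !mxE.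
rewrite mxE; apply: ideal_sum => // i _; rewrite HV; exact: idealMr_set.
Qed.

Variable c : nat -> A.
Hypothesis noethA : noetherian A.
Hypothesis c_inv : forall u v, u != v -> invertible (c u - c v).

Lemma finite_vandermonde J s (a : 'I_s -> A) : is_ideal J ->
  (exists j, ~ J (a j)) -> finite_set [set u | J (\sum_(j < s) c u ^+ j * a j)].
Proof.
move=> Jid [j Ja]; apply: contrapT => /infiniteP/ppcard_leP[f].
apply: Ja; apply: (@ideal_vandermonde J s (fun i : 'I_s => c (f i)) a) => //.
  move=> i l il; apply: c_inv; apply: contra il => /eqP fil; apply/eqP/val_inj.
  by apply: (@inj _ _ _ f); rewrite ?inE.
by move=> i; have /= := @funS _ _ _ _ f i I.
Qed.

(** Prime avoidance along the moment curve u |-> (1, c u, c u ^ 2, ...).  An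
    associated prime that contains the combination of the a j for s values of u
    contains all the a j, so each of the finitely many maximal ones excludes
    only finitely many u.  The coefficient of a 0 being 1, the combination can
    replace a 0 in a generating system. *)
Lemma vandermonde_avoidance n (J : 'I_n -> set A) s (a : 'I_s -> A) :
  (forall i, is_ideal (J i)) ->
  (forall i y, ~ J i y -> prime_ideal (colon (J i) y) ->
     exists j, ~ J i (a j * y)) ->
  exists u, forall i, regular_on (J i) (\sum_(j < s) c u ^+ j * a j).
Proof.
move=> Jid Ja; pose b u := \sum_(j < s) c u ^+ j * a j.
have fin i : finite_set [set u | ~ regular_on (J i) (b u)].
  have [ys [Hys ysP]] := finite_maximal_assassins noethA (Jid i).
  apply: (@sub_finite_set _ _ (\bigcup_(y in [set` ys]) [set u | colon (J i) y (b u)])).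
    by move=> u /ysP[y yys Jy]; exists y.
  apply: bigcup_finite; first exact: finite_seq.
  move=> y /= /Hys[Jy Py]; apply: finite_vandermonde; first exact: colon_is_ideal.
  exact: Ja.
apply: contrapT => no; apply: infinite_nat.
apply: (@sub_finite_set _ _ (\bigcup_(i in [set: 'I_n]) [set u | ~ regular_on (J i) (b u)])).
  move=> u _; apply: contrapT => no'; apply: no; exists u => i.
  by apply: contrapT => r; apply: no'; exists i.
by apply: bigcup_finite => //; exact: finite_finset.
Qed.

End Avoidance.

(** * Depth of a local ring and regular generators *)

Section Local.
Variables (A : comNzRingType) (m : idealr A).
Implicit Types (J : set A) (x y z b : A).
Hypothesis noethA : noetherian A.
Hypothesis localA : local_ring m.

Lemma local_invertible x : x \notin m -> invertible x.
Proof.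
move=> xm; apply: contrapT => xinv.
have x1 : ~ adjoin [set (0:A)] x 1.
  by move=> [r /= /eqP]; rewrite subr_eq0 => /eqP h; apply: xinv; exists r.
have [||P [[Pid P1] xP Pmax]] :=
  @noetherian_max A noethA [set K | is_ideal K /\ ~ K 1] (adjoin [set 0] x).
- by move=> I [].
- by split=> //; apply/adjoin_is_ideal/zero_is_ideal.
have Pm : P = [set` m].
  apply: localA.2; split=> // J Jid PJ; case: (EM (J 1)) => J1; last first.
    by left; apply: Pmax.
  by right; rewrite eqEsubset; split=> // u _; rewrite -[u]mulr1; apply: idealM.
have : P x by apply: xP; apply: adjoin_gen; apply: zero_is_ideal.
by rewrite Pm /= => xm'; rewrite xm' in xm.
Qed.

Hypothesis residue_infinite : infinite_set [set: {ideal_quot m}].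

(** Representatives of infinitely many residue classes. *)
Lemma unit_differences : exists c : nat -> A,
  forall u v, u != v -> invertible (c u - c v).
Proof.
pose T : pointedType := HB.pack {ideal_quot m} (isPointed.Build {ideal_quot m} 0).
have /pcard_injP[f finj] : ([set: nat] #<= [set: T])%card by exact/infiniteP.
exists (fun u => repr (f u : {ideal_quot m})) => u v uv.
apply: local_invertible; apply: contra uv.
rewrite Quotient.idealrBE !reprK => /eqP fuv; apply/eqP.
by apply: finj; rewrite ?inE.
Qed.

(** A / J has a regular sequence of length k in m: the recursion passes to the
    quotient by its first element. *)
Fixpoint depth_ge k (J : set A) : Prop :=
  if k is l.+1 then exists x : A, [/\ x \in m, regular_on J x & depth_ge l (adjoin J x)]
  else True.

(** Hom (A / m, A / J) = 0. *)
Definition no_socle (J : set A) := forall y, (forall z, z \in m -> J (z * y)) -> J y.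

Lemma regular_no_socle J x : x \in m -> regular_on J x -> no_socle J.
Proof. by move=> xm xreg y Hy; apply/xreg/Hy. Qed.

Lemma regular_swap J x z : is_ideal J -> regular_on J x -> regular_on J z ->
  regular_on (adjoin J x) z -> regular_on (adjoin J z) x.
Proof.
move=> Jid xreg zreg xzreg u [v Hv].
have [w Hw] : adjoin J x v.
  apply: xzreg; exists u; rewrite (_ : _ - _ = - (x * u - v * z)); last by ring.
  exact: idealN.
exists w; apply: xreg.
have -> : x * (u - w * z) = (x * u - v * z) + z * (v - w * x) by ring.
by apply: idealD => //; apply: idealM.
Qed.

(** Both Hom (A / m, A / (J + x)) and Hom (A / m, A / (J + b)) are
    Ext^1 (A / m, A / J).  Concretely, if m y lies in J + (b) and x y = h b
    modulo J, then m h lies in J + (x); dividing h by x corrects y. *)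
Lemma no_socle_exchange J x b : is_ideal J -> x \in m -> regular_on J x ->
  b \in m -> regular_on J b -> no_socle (adjoin J x) -> no_socle (adjoin J b).
Proof.
move=> Jid xm xreg bm breg socx y Hy.
have [h Hh] := Hy x xm.
have [h' Hh'] : adjoin J x h.
  apply: socx => z zm; have [k Hk] := Hy z zm; exists k; apply: breg.
  have -> : b * (z * h - k * x) = x * (z * y - k * b) - z * (x * y - h * b) by ring.
  by apply: idealB => //; apply: idealM.
exists h'; apply: xreg.
have -> : x * (y - h' * b) = (x * y - h * b) + b * (h - h' * x) by ring.
by apply: idealD => //; apply: idealM.
Qed.

Lemma common_regular_element n (J : 'I_n -> set A) :
  (forall i, is_ideal (J i)) -> (forall i, no_socle (J i)) ->
  exists2 z, z \in m & forall i, regular_on (J i) z.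
Proof.
move=> Jid Jsoc; have [c cinv] := unit_differences.
have [s [a ma]] := noethA (idealr_is_ideal m).
have am j : a j \in m.
  by have : [set` m] (a j) by rewrite ma; apply: gen_ideal_gen.
have [|u Hu] := vandermonde_avoidance noethA cinv (a := a) Jid.
  move=> i y Jy _; apply: contrapT => no; apply/Jy/Jsoc => z zm.
  have : gen_ideal a z by rewrite -ma.
  apply: (@gen_ideal_min _ _ _ (colon (J i) y)); first exact: colon_is_ideal.
  by move=> j; apply: contrapT => aj; apply: no; exists j.
exists (\sum_(j < s) c u ^+ j * a j) => //.
by apply: rpred_sum => j _; apply: idealMr.
Qed.

Lemma depth_ge_no_socle k J : depth_ge k.+1 J -> no_socle J.
Proof. by case=> x [xm xreg _]; apply: regular_no_socle xm xreg. Qed.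

(** The length of a maximal regular sequence does not depend on its first
    element.  If x starts a given sequence and z is regular on J, J + (x) and
    J + (b), then by induction x can be replaced by z, and then z by b. *)
Lemma depth_ge_adjoin k J b : is_ideal J -> b \in m -> regular_on J b ->
  depth_ge k.+1 J -> depth_ge k (adjoin J b).
Proof.
elim: k J b => [//|k IH] J b Jid bm breg.
case=> x [xm xreg dx].
have Jx := adjoin_is_ideal x Jid; have Jb := adjoin_is_ideal b Jid.
have socx := depth_ge_no_socle dx.
have socb := no_socle_exchange Jid xm xreg bm breg socx.
have socJ := regular_no_socle xm xreg.
have [||z zm zr] := @common_regular_element 3
  (fun i => nth J [:: J; adjoin J x; adjoin J b] i).
- by case=> [[|[|[|[]]]]].
- by case=> [[|[|[|[]]]]].
have zJ : regular_on J z := zr (Ordinal (isT : 0 < 3)%N).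
have zx : regular_on (adjoin J x) z := zr (Ordinal (isT : 1 < 3)%N).
have zb : regular_on (adjoin J b) z := zr (Ordinal (isT : 2 < 3)%N).
have Jz := adjoin_is_ideal z Jid.
have dz : depth_ge k.+1 (adjoin J z).
  exists x; split=> //; first exact: regular_swap.
  by rewrite adjoinC //; apply: IH.
exists z; split=> //; rewrite adjoinC //; apply: IH => //.
exact: regular_swap.
Qed.

Lemma gen_ideal_adjoin (x : nat -> A) i : gen_ideal (fun j : 'I_i.+1 => x j) =
    adjoin (gen_ideal (fun j : 'I_i => x j)) (x i).
Proof.
rewrite eqEsubset; split.
  apply: gen_ideal_min; first exact/adjoin_is_ideal/gen_ideal_is_ideal.
  move=> j; have [ji|ij] := ltnP j i.
    exact/sub_adjoin/(gen_ideal_gen (fun j : 'I_i => x j) (Ordinal ji)).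
  have -> : val j = i by apply/eqP; rewrite eqn_leq ij -ltnS ltn_ord.
  exact/adjoin_gen/gen_ideal_is_ideal.
apply: adjoin_min; first exact: gen_ideal_is_ideal.
  apply: gen_ideal_min; first exact: gen_ideal_is_ideal.
  by move=> j; apply: (gen_ideal_gen (fun j : 'I_i.+1 => x j) (widen_ord (leqnSn i) j)).
exact: (gen_ideal_gen (fun j : 'I_i.+1 => x j) ord_max).
Qed.

Lemma regular_seq_depth_ge n (x : nat -> A) :
  (forall i, (i < n)%N -> x i \in m) -> regular_seq n x ->
  depth_ge n [set 0].
Proof.
move=> xm [_ xreg].
have gen0 : gen_ideal (fun j : 'I_0 => x j) = [set 0].
  rewrite eqEsubset; split=> [_ [c ->]|_ ->]; rewrite ?big_ord0 //.
  by exists (fun=> 0); rewrite big_ord0.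
suff H k : (k <= n)%N -> depth_ge k (gen_ideal (fun j : 'I_(n - k) => x j)).
  by have := H n (leqnn n); rewrite subnn gen0.
elim: k => // k IH kn; exists (x (n - k.+1)%N).
have lt : (n - k.+1 < n)%N by rewrite ltn_subrL (leq_trans _ kn).
split; [exact: xm|by move=> y; apply: xreg|].
by rewrite -gen_ideal_adjoin -subSn // subSS; apply: IH; apply: ltnW.
Qed.

Lemma prime_radical P J x : prime_ideal P -> J `<=` P -> radical J x -> P x.
Proof.
move=> [Pid P1 PM] JP [n /JP]; elim: n => [|n IH]; first by rewrite expr0.
by rewrite exprS => /PM[//|/IH].
Qed.

(** An ideal with d generators and radical m is generated by a regular sequence
    when the depth is at least d: the generators are replaced one after the
    other by combinations that are regular modulo the preceding ones.  These
    combinations exist because a prime annihilator of an element modulo J which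
    contains all the generators contains m, against [depth_ge_no_socle]. *)
Lemma regular_generators d (a : 'I_d -> A) :
  (forall i, a i \in m) -> (forall x, x \in m -> radical (gen_ideal a) x) ->
  depth_ge d [set 0] ->
  exists b : nat -> A, gen_ideal (fun i : 'I_d => b i) = gen_ideal a /\
    forall i, (i < d)%N -> regular_on (gen_ideal (fun j : 'I_i => b j)) (b i).
Proof.
move=> am rada depthA.
suff H k : (k <= d)%N -> exists b : nat -> A,
    [/\ gen_ideal (fun i : 'I_d => b i) = gen_ideal a,
        forall i, (i < k)%N -> regular_on (gen_ideal (fun j : 'I_i => b j)) (b i)
      & depth_ge (d - k) (gen_ideal (fun j : 'I_k => b j))].
  by have [b [? ? _]] := H d (leqnn d); exists b.
elim: k => [_|k IH kd].
  (* the value 0 beyond the index range is arbitrary *)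
  exists (fun i => if insub i is Some j then a j else 0); split=> //.
    by congr gen_ideal; apply: funext => i; rewrite valK.
  rewrite subn0 (_ : gen_ideal _ = [set 0]) //.
  rewrite eqEsubset; split=> [_ [c ->]|_ ->]; rewrite ?big_ord0 //.
  by exists (fun=> 0); rewrite big_ord0.
have [b [gen_b b_reg]] := IH (ltnW kd).
set J := gen_ideal (fun j : 'I_k => b j) => depthJ.
have Jid : is_ideal J := gen_ideal_is_ideal _.
have bm i : (i < d)%N -> b i \in m.
  move=> id; have : gen_ideal a (b i).
    by rewrite -gen_b; apply: (gen_ideal_gen (fun i : 'I_d => b i) (Ordinal id)).
  by apply: (gen_ideal_min (J := [set` m])); first exact: idealr_is_ideal.
have soc : no_socle J by apply: (@depth_ge_no_socle (d - k.+1)); rewrite subnSK.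
have [c cinv] := unit_differences.
have [||u zreg] := @vandermonde_avoidance _ c noethA cinv 1 (fun=> J)
    (d - k) (fun j => b (k + j)%N).
- by [].
- move=> _ y Jy yprime; apply: contrapT => no; apply/Jy/soc => z zm.
  apply: (prime_radical yprime _ (rada z zm)); rewrite -gen_b.
  apply: gen_ideal_min; first exact: colon_is_ideal.
  move=> j; have [jk|kj] := ltnP j k.
    apply: idealMr_set => //.
    exact: (gen_ideal_gen (fun j : 'I_k => b j) (Ordinal jk)).
  have jkd : (j - k < d - k)%N by rewrite ltn_sub2r.
  apply: contrapT => bj; apply: no; exists (Ordinal jkd) => /=.
  by rewrite subnKC.
have {zreg} := zreg ord0; set z := \sum_(_ < _) _ => zreg.
pose b' i := if i == k then z else b i.
have Jb' : gen_ideal (fun j : 'I_k => b' j) = J.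
  by congr gen_ideal; apply: funext => j; rewrite /b' ltn_eqF.
have b'k : b' k = z by rewrite /b' eqxx.
have gen_b' : gen_ideal (fun i : 'I_d => b' i) = gen_ideal (fun i : 'I_d => b i).
  have gb i : (i < d)%N -> gen_ideal (fun i : 'I_d => b i) (b i).
    by move=> id; apply: (gen_ideal_gen (fun i : 'I_d => b i) (Ordinal id)).
  have gb' i : (i < d)%N -> gen_ideal (fun i : 'I_d => b' i) (b' i).
    by move=> id; apply: (gen_ideal_gen (fun i : 'I_d => b' i) (Ordinal id)).
  have lt (j : 'I_(d - k)) : (k + j < d)%N by rewrite -ltn_subRL.
  rewrite eqEsubset; split; apply: gen_ideal_min; try exact: gen_ideal_is_ideal.
    move=> i; rewrite /b'; case: eqP => // _; last exact: gb.
    apply: ideal_sum => [|j _]; first exact: gen_ideal_is_ideal.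
    by apply: idealM; [exact: gen_ideal_is_ideal|apply: gb; apply: lt].
  move=> i; have [->|ik] := eqVneq (val i) k; last first.
    by have := gb' i (ltn_ord i); rewrite /b' (negbTE ik).
  have d0 : (0 < d - k)%N by rewrite subn_gt0.
  have zE : z = b k + \sum_(j < d - k | j != Ordinal d0) c u ^+ j * b (k + j)%N.
    by rewrite /z (bigD1 (Ordinal d0)) //= expr0 mul1r addn0.
  rewrite -[b k](addrK (\sum_(j < d - k | j != Ordinal d0) c u ^+ j * b (k + j)%N)) -zE.
  have gid := gen_ideal_is_ideal (fun i : 'I_d => b' i).
  apply: idealB => //; first by rewrite -b'k; apply: gb'.
  apply: ideal_sum => // j j0; apply: idealM => //.
  have := gb' _ (lt j); rewrite /b' -[X in _ == X]addn0 eqn_add2l.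
  by rewrite -[0%N]/(val (Ordinal d0)) (inj_eq val_inj) (negbTE j0).
exists b'; split.
- by rewrite gen_b'.
- move=> i; rewrite ltnS leq_eqVlt => /orP[/eqP->|ik]; first by rewrite Jb' b'k.
  rewrite {2}/b' ltn_eqF // (_ : gen_ideal _ = gen_ideal (fun j : 'I_i => b j)).
    exact: b_reg.
  by congr gen_ideal; apply: funext => j; rewrite /b' ltn_eqF // (ltn_trans _ ik).
- rewrite gen_ideal_adjoin Jb' b'k; apply: depth_ge_adjoin => //; last first.
    by rewrite subnSK.
  apply: rpred_sum => j _; apply/idealMr/bm.
  by rewrite -ltn_subRL.
Qed.

End Local.

(** * Unique factorization in polynomial rings *)

Section Divisibility.
Variable R : comNzRingType.
Implicit Types x y : R.

Definition divides x y := exists q, y = q * x.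

Definition irreducible_elt x := [/\ x != 0, ~ invertible x &
  forall u v, x = u * v -> invertible u \/ invertible v].

Definition prime_elt x := forall u v, divides x (u * v) -> divides x u \/ divides x v.

(** With an [additive_norm] this is unique factorization; the norm, a degree in
    the applications, replaces induction on factorizations. *)
Definition irreducibles_prime := forall x, irreducible_elt x -> prime_elt x.

Definition additive_norm (N : R -> nat) :=
  (forall x y, x != 0 -> y != 0 -> N (x * y) = (N x + N y)%N) /\
  (forall x, x != 0 -> N x = 0%N -> invertible x).

Lemma dividesMl x y z : divides x y -> divides x (z * y).
Proof. by move=> [q ->]; exists (z * q); rewrite mulrA. Qed.

Lemma dividesD x y z : divides x y -> divides x z -> divides x (y + z).
Proof. by move=> [q ->] [r ->]; exists (q + r); rewrite mulrDl. Qed.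

Lemma divides_trans x y z : divides x y -> divides y z -> divides x z.
Proof. by move=> [q ->] [r ->]; exists (r * q); rewrite mulrA. Qed.

Lemma divides_invertible x y : invertible x -> divides x y.
Proof. by move=> [u ux]; exists (y * u); rewrite -mulrA ux mulr1. Qed.

Lemma invertible_Ml x y : invertible (x * y) -> invertible x.
Proof. by move=> [u uxy]; exists (u * y); rewrite -uxy; ring. Qed.

Lemma invertible_Mr x y : invertible (x * y) -> invertible y.
Proof. by rewrite mulrC; apply: invertible_Ml. Qed.
End Divisibility.

Section NormFactor.
Variables (R : comNzRingType) (N : R -> nat).
Implicit Types x y : R.
Hypothesis N_norm : additive_norm N.

Lemma norm_invertible x : invertible x -> N x = 0%N.
Proof.
have N1 : N 1 = 0%N.
  have := N_norm.1 1 1 (oner_neq0 _) (oner_neq0 _).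
  by rewrite mulr1 => /eqP; rewrite -{1}[N 1]addn0 eqn_add2l eq_sym => /eqP.
move=> [u ux]; have x0 : x != 0 by apply: contra_eq_neq ux => ->; rewrite mulr0 eq_sym oner_neq0.
have u0 : u != 0 by apply: contra_eq_neq ux => ->; rewrite mul0r eq_sym oner_neq0.
by have := N_norm.1 u x u0 x0; rewrite ux N1 => /esym/eqP; rewrite addn_eq0 => /andP[_ /eqP].
Qed.

Lemma irreducible_factor x : x != 0 -> ~ invertible x ->
  exists2 p, irreducible_elt p & divides p x.
Proof.
have [n] := ubnP (N x); elim: n x => // n IH x Nx x0 xu.
case: (EM (irreducible_elt x)) => [xirr|xred]; first by exists x => //; exists 1; rewrite mul1r.
have [u [v [xE uu vu]]] : exists u v, [/\ x = u * v, ~ invertible u & ~ invertible v].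
  apply: contrapT => no; apply: xred; split=> // u v xE; apply: contrapT => no'.
  by apply: no; exists u, v; split=> // ?; apply: no'; [left|right].
have u0 : u != 0 by apply: contraNneq x0 => u0; rewrite xE u0 mul0r.
have v0 : v != 0 by apply: contraNneq x0 => v0; rewrite xE v0 mulr0.
have Nv : (0 < N v)%N by rewrite lt0n; apply/eqP => /(N_norm.2 v v0).
have [|p pirr pu] := IH u _ u0 uu.
  apply: leq_trans (_ : N x <= n)%N; last by rewrite -ltnS.
  by rewrite xE N_norm.1 // -{1}[N u]addn0 ltn_add2l.
by exists p => //; rewrite xE mulrC; apply: dividesMl.
Qed.

End NormFactor.

Section Gauss.
Variables (R : idomainType) (N : R -> nat).
Hypothesis N_norm : additive_norm N.
Hypothesis R_prime : irreducibles_prime R.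
Implicit Types (f g h w : {poly R}) (p r c : R).

Lemma dividesCP c f : divides c%:P f <-> forall i, divides c f`_i.
Proof.
split=> [[q ->] i|/choice[q Hq]]; first by exists q`_i; rewrite coefMC.
exists (\poly_(i < size f) q i); apply/polyP => i; rewrite coefMC coef_poly.
by case: ltnP => [_|/leq_sizeP ->] //; rewrite mul0r.
Qed.

(** Gauss's argument: look at the first coefficients of f and of g that p does
    not divide. *)
Lemma prime_constant p : irreducible_elt p -> prime_elt p%:P.
Proof.
move=> pirr f g pfg; have pp := R_prime pirr.
have first_coef h : ~ divides p%:P h ->
    exists i, ~ divides p h`_i /\ forall j, (j < i)%N -> divides p h`_j.
  move=> ph; pose P i := `[< ~ divides p h`_i >].
  have exP : exists i, P i.
    apply: contrapT => no; apply/ph/dividesCP => i; apply: contrapT => pi.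
    by apply: no; exists i; apply/asboolP.
  exists (ex_minn exP); case: ex_minnP => i /asboolP pi imin; split=> // j ji.
  apply: contrapT => pj; have /imin : P j by apply/asboolP.
  by rewrite leqNgt ji.
apply: contrapT => no.
have [|i [pi imin]] := first_coef f; first by move=> ?; apply: no; left.
have [|j [pj jmin]] := first_coef g; first by move=> ?; apply: no; right.
have : divides p (f`_i * g`_j).
  have ij : (i < (i + j).+1)%N by rewrite ltnS leq_addr.
  have -> : f`_i * g`_j = (f * g)`_(i + j) +
      (-1) * \sum_(l < (i + j).+1 | l != Ordinal ij) f`_l * g`_(i + j - l).
    by rewrite coefM (bigD1 (Ordinal ij)) //= addKn mulN1r addrK.
  apply: dividesD; first by move/dividesCP: pfg; apply.
  apply: dividesMl; elim/big_ind: _ => [||l il]; [by exists 0; rewrite mul0r|exact: dividesD|].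
  have := il; rewrite -val_eqE /= neq_ltn => /orP[li|il'].
    by rewrite mulrC; apply/dividesMl/imin.
  have lij : (l <= i + j)%N by rewrite -ltnS ltn_ord.
  by apply/dividesMl/jmin; rewrite -(ltn_add2r l) subnK // [(j + l)%N]addnC ltn_add2r.
by case/pp.
Qed.

(** Content 1, expressed by prime constants instead of a gcd of coefficients. *)
Definition primitive f := forall p, irreducible_elt p -> ~ divides p%:P f.

(** The prime factors of r are cancelled one at a time: each divides the
    cofactor, since it does not divide f. *)
Lemma primitive_cancel r f h : r != 0 -> primitive f ->
  divides f (r%:P * h) -> divides f h.
Proof.
move=> + fprim; have [n] := ubnP (N r); elim: n r h => // n IH r h Nr r0.
case: (EM (invertible r)) => [[u ur] [q Hq]|ru].
  exists (u%:P * q); rewrite -mulrA -Hq mulrA -polyCM ur; by rewrite mul1r.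
have [p pirr [s rE]] := irreducible_factor N_norm r0 ru.
have [p0 pu _] := pirr; have s0 : s != 0 by apply: contraNneq r0 => s0; rewrite rE s0 mul0r.
have Np : (0 < N p)%N by rewrite lt0n; apply/eqP => /(N_norm.2 p p0).
move=> [q Hq]; have [|[q' qE]|/fprim] // := prime_constant pirr (u := q) (v := f).
  by rewrite -Hq rE polyCM mulrAC mulrC; exists (s%:P * h); rewrite mulrC.
apply: (IH s) => //.
  apply: leq_trans (_ : N r <= n)%N; last by rewrite -ltnS.
  by rewrite rE N_norm.1 // -{1}[N s]addn0 ltn_add2l.
exists q'; apply: (mulfI (_ : p%:P != 0)); first by rewrite polyC_eq0.
by rewrite mulrA -polyCM [p * s]mulrC -rE Hq qE; ring.
Qed.

Lemma primitive_part w : w != 0 -> exists c w0,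
  [/\ c != 0, w = c%:P * w0 & primitive w0].
Proof.
have [n] := ubnP (N (lead_coef w)); elim: n w => // n IH w Nw w0.
case: (EM (primitive w)) => [wp|wp].
  by exists 1, w; split=> //; [exact: oner_neq0|rewrite mul1r].
have [p [pirr [q wE]]] : exists p, irreducible_elt p /\ divides p%:P w.
  by apply: contrapT => no; apply: wp => p pirr pw; apply: no; exists p.
have [p0 pu _] := pirr; have q0 : q != 0 by apply: contraNneq w0 => q0; rewrite wE q0 mul0r.
have Np : (0 < N p)%N by rewrite lt0n; apply/eqP => /(N_norm.2 p p0).
have lq0 : lead_coef q != 0 by rewrite lead_coef_eq0.
have [|c [w1 [c0 qE w1p]]] := IH q _ q0.
  apply: leq_trans (_ : N (lead_coef w) <= n)%N; last by rewrite -ltnS.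
  by rewrite wE lead_coefM lead_coefC N_norm.1 // -{1}[N (lead_coef q)]addn0 ltn_add2l.
exists (c * p), w1; split=> //; last by rewrite wE qE polyCM; ring.
by rewrite mulf_neq0.
Qed.

Lemma invertible_polyC c : invertible c%:P -> invertible c.
Proof.
by move=> [u uc]; exists u`_0; rewrite -coefMC uc coef1.
Qed.

Lemma invertible_size f : invertible f -> (size f <= 1)%N.
Proof.
move=> [u uf]; have f0 : f != 0 by apply: contra_eq_neq uf => ->; rewrite mulr0 eq_sym oner_neq0.
have u0 : u != 0 by apply: contra_eq_neq uf => ->; rewrite mul0r eq_sym oner_neq0.
have := size_mul u0 f0; rewrite uf size_poly1 => E.
move: u0 f0; rewrite -!size_poly_gt0 => u0 f0.
case: (size u) E u0 => [|n] E u0 //; move: E; case: (size f) f0 => [|[|l]] f0 //; by rewrite addSn /= !addnS.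
Qed.

Lemma irreducible_primitive f : irreducible_elt f -> (1 < size f)%N -> primitive f.
Proof.
move=> [f0 fu firr] sf p [p0 pu _] [q fE].
have [/invertible_size sq|/invertible_polyC//] := firr _ _ fE.
move: sf; rewrite fE ltnNge => /negP; apply.
by rewrite mulrC mul_polyC (leq_trans (size_scale_leq _ _)).
Qed.

(** An element w of least degree in the ideal (f, g); pseudo-division by w leaves
    remainder 0 on that ideal. *)
Lemma bezout_divides f g : f != 0 -> exists w,
  [/\ w != 0, exists u v, w = u * f + v * g &
    forall h, (exists u v, h = u * f + v * g) ->
      exists2 r, r != 0 & divides w (r%:P * h)].
Proof.
move=> f0.
pose P n := `[< exists w, [/\ w != 0, exists u v, w = u * f + v * g & size w = n] >].
have exP : exists n, P n.
  exists (size f); apply/asboolP; exists f; split=> //.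
  by exists 1, 0; rewrite mul1r mul0r addr0.
have [n /asboolP[w [w0 [u [v wE]] sw]] nmin] := ex_minnP exP.
exists w; split=> //; first by exists u, v.
move=> h [s [t hE]].
have := Pdiv.Idomain.divp_eq h w; set r := lead_coef w ^+ _ => dE.
exists r.
  by rewrite expf_neq0 // lead_coef_eq0.
suff rem0 : h %% w = 0 by exists (h %/ w); rewrite mul_polyC dE rem0 addr0.
apply/eqP; apply: contrapT => /negP rem0; have : P (size (h %% w)).
  apply/asboolP; exists (h %% w); split=> //.
  exists (r%:P * s - h %/ w * u), (r%:P * t - h %/ w * v).
  have -> : h %% w = r *: h - h %/ w * w by rewrite dE addrC addKr.
  by rewrite -mul_polyC {2}wE hE; ring.
move/nmin; rewrite leqNgt -sw ltn_modp.
by rewrite w0.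
Qed.

(** Let f be irreducible and nonconstant, f | g h and not f | g.  The primitive
    part of the element w of [bezout_divides] divides both f and g, so it is a
    unit and w is a constant; then f divides w h, and w can be cancelled. *)
Theorem poly_irreducibles_prime : irreducibles_prime {poly R}.
Proof.
move=> f firr; have [f0 fu fM] := firr.
have [sf|sf] := leqP (size f) 1.
  have [c fE] : exists c, f = c%:P by exists f`_0; apply: size1_polyC.
  rewrite fE; apply: prime_constant; split.
  - by apply: contraNneq f0 => c0; rewrite fE c0.
  - by move=> [u uc]; apply: fu; exists u%:P; rewrite fE -polyCM uc.
  - move=> u v cE; have [||] := fM u%:P v%:P; first by rewrite fE cE polyCM.
      by left; apply: invertible_polyC.
    by right; apply: invertible_polyC.
move=> g h fgh; case: (EM (divides f g)) => fg; [by left|right].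
have fprim := irreducible_primitive firr sf.
have [w [w0 [u [v wE]] wdiv]] := bezout_divides g f0.
have [c [w1 [c0 wE' w1p]]] := primitive_part w0.
have w1div e : (exists u v, e = u * f + v * g) -> divides w1 e.
  move=> /wdiv[r r0 [q rq]]; apply: (primitive_cancel r0) => //.
  by exists (q * c%:P); rewrite rq wE'; ring.
have [q fE] : divides w1 f by apply: w1div; exists 1, 0; rewrite mul1r mul0r addr0.
have w1g : divides w1 g by apply: w1div; exists 0, 1; rewrite mul1r mul0r add0r.
have [[q' q'q]|w1u] := fM _ _ fE.
  case: fg; apply: divides_trans w1g; exists q'; by rewrite fE mulrA q'q mul1r.
have w1C : w1 = (w1`_0)%:P by apply/size1_polyC/invertible_size.
apply: (primitive_cancel (r := c * w1`_0)) => //.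
  by apply: contraNneq w0 => cw; rewrite wE' w1C -polyCM cw.
rewrite polyCM -w1C -wE' wE.
have -> : (u * f + v * g) * h = (u * h) * f + v * (g * h) by ring.
by apply: dividesD; [exists (u * h)|exact: dividesMl].
Qed.

End Gauss.

Lemma irreducibles_prime_transport (R S : comNzRingType) (phi : {rmorphism R -> S}) :
  bijective phi -> irreducibles_prime S -> irreducibles_prime R.
Proof.
move=> [psi phiK psiK] Sprime x [x0 xu xM].
have inv_phi y : invertible (phi y) -> invertible y.
  move=> [u uy]; exists (psi u); apply: (can_inj phiK).
  by rewrite rmorphM psiK uy rmorph1.
have div_phi y z : divides (phi y) (phi z) -> divides y z.
  move=> [q qz]; exists (psi q); apply: (can_inj phiK).
  by rewrite rmorphM psiK.
have phix : irreducible_elt (phi x).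
  split; [|by move=> /inv_phi|move=> u v xE].
    by apply: contraNneq x0 => phix0; rewrite -[x]phiK phix0 -(rmorph0 phi) phiK.
  have [|[w wu]|[w wv]] := xM (psi u) (psi v).
  - by apply: (can_inj phiK); rewrite rmorphM !psiK.
  - by left; exists (phi w); rewrite -[u]psiK -rmorphM wu rmorph1.
  - by right; exists (phi w); rewrite -[v]psiK -rmorphM wv rmorph1.
move=> u v [q uvE].
have [||] := Sprime _ phix (phi u) (phi v).
- by exists (phi q); rewrite -!rmorphM uvE.
- by move=> /div_phi; left.
- by move=> /div_phi; right.
Qed.

Section MpolyFactorial.
Variable k : fieldType.

Lemma mpoly_norm n : additive_norm (fun p : {mpoly k[n]} => (msize p).-1).
Proof.
split=> [x y x0 y0|x x0 xs].
  rewrite msizeM //; move: x0 y0; rewrite -!msize_poly_eq0.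
  by case: (msize x) => // a _; case: (msize y) => // c _; rewrite addSn /= addnS.
have [c c0 ->] : exists2 c, c != 0 & x = c%:MP.
  apply/msize_poly1P; move: x0 xs; rewrite -msize_poly_eq0.
  by case: (msize x) => // -[].
by exists (c^-1)%:MP; rewrite -mpolyCM mulVf.
Qed.

Lemma muni_widen n (c : {mpoly k[n]}) : muni (mwiden c) = c%:P.
Proof.
elim/mpolyind: c => [|a m p _ _ IH]; first by rewrite mwiden0 muni0 polyC0.
rewrite mwidenD muniD IH polyCD; congr (_ + _).
rewrite mwidenZ mwidenX muniZ muniE msuppX big_seq1 mcoeffX eqxx scale1r.
rewrite mnmwiden_ordmax expr0 alg_polyC -mul_polyC -polyCM mul_mpolyC.
congr (_ *: 'X_[_])%:P.
by apply/mnmP => i; rewrite mnmE mnmwiden_widen.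
Qed.

(** The inverse evaluates at the last variable. *)
Lemma muni_bij n : bijective (@muni n k).
Proof.
pose psi (q : {poly {mpoly k[n]}}) : {mpoly k[n.+1]} :=
  (map_poly (@mwiden n k) q).['X_ord_max].
have psiD p q : psi (p + q) = psi p + psi q by rewrite /psi rmorphD hornerD.
have psiM p q : psi (p * q) = psi p * psi q by rewrite /psi rmorphM hornerM.
have psiC c : psi c%:P = mwiden c by rewrite /psi map_polyC hornerC.
have psiX : psi 'X = 'X_ord_max by rewrite /psi map_polyX hornerX.
have psi0 : psi 0 = 0 by rewrite /psi rmorph0 horner0.
have muniX : muni ('X_ord_max : {mpoly k[n.+1]}) = 'X.
  rewrite muniE msuppX big_seq1 mcoeffX eqxx scale1r mnm1E eqxx expr1.
  rewrite (_ : [multinom _ | i < n] = 0%MM) ?mpolyX0 ?scale1r //.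
  by apply/mnmP => i; rewrite mnmE mnm0E mnm1E -val_eqE /= gtn_eqF.
exists psi => [p|q].
  rewrite muniE (big_morph psi psiD psi0) [RHS]mpolyE; apply: eq_bigr => m _.
  rewrite -mul_polyC psiM psiC mwidenZ mwidenX /psi map_polyXn hornerXn -scalerAl.
  congr (_ *: _); rewrite mpolyXn -mpolyXD; congr 'X_[_].
  apply/mnmP => i; rewrite mnmDE mulmnE mnm1E.
  case: (unliftP ord_max i) => [j|] ->.
    have -> : lift ord_max j = widen_ord (leqnSn n) j by apply/val_inj; rewrite /= /bump leqNgt ltn_ord.
    rewrite mnmwiden_widen mnmE -val_eqE /= gtn_eqF ?ltn_ord // mul0n addn0.
    by congr (m _); apply: val_inj.
  by rewrite mnmwiden_ordmax eqxx mul1n.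
elim/poly_ind: q => [|q c IH]; first by rewrite psi0 rmorph0.
by rewrite psiD psiM psiX psiC raddfD /= rmorphM /= IH muniX muni_widen.
Qed.

Theorem mpoly_irreducibles_prime n : irreducibles_prime {mpoly k[n]}.
Proof.
elim: n => [|n IH]; last first.
  exact: irreducibles_prime_transport (muni_bij n) (poly_irreducibles_prime (mpoly_norm n) IH).
move=> x [x0 xu _]; case: xu; apply: (mpoly_norm 0).2 => //.
by rewrite (nvar0_mpolyC x) msizeC; case: (_ != 0).
Qed.
End MpolyFactorial.

(** * Quasi-regularity of a regular sequence *)

Section QuasiRegular.
Variables (A : comNzRingType) (d : nat) (b : nat -> A).
Implicit Types (J : set A) (F G H : {mpoly A[d]}).

Definition ev F : A := F.@[fun i => b i].

Definition coefs_in J F := forall m, J F@_m.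

Lemma coefs_inM J F G : is_ideal J -> coefs_in J F -> coefs_in J (G * F).
Proof.
move=> Jid JF m; rewrite mcoeffM; apply: ideal_sum => // k _.
exact: idealM.
Qed.

Lemma coefs_inD J F G : is_ideal J ->
  coefs_in J F -> coefs_in J G -> coefs_in J (F + G).
Proof. by move=> Jid JF JG m; rewrite mcoeffD; apply: idealD. Qed.

(** The monomials of degree n in the first j variables.  The number d of
    variables is kept fixed, so that inductions on the length of a regular
    sequence take place in one ring {mpoly A[d]}. *)
Definition admissible j n (m : 'X_{1..d}) : Prop :=
  mdeg m = n /\ forall i : 'I_d, (j <= i)%N -> m i = 0%N.

Definition homog_form J j n F : Prop :=
  coefs_in J F /\ forall m, F@_m != 0 -> admissible j n m.

Lemma homog_form0 J j n : is_ideal J -> homog_form J j n 0.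
Proof. by move=> Jid; split=> m; rewrite mcoeff0 ?eqxx //; apply: ideal0. Qed.

Lemma homog_formD J j n F G : is_ideal J -> homog_form J j n F -> homog_form J j n G ->
  homog_form J j n (F + G).
Proof.
move=> Jid [JF aF] [JG aG]; split; first exact: coefs_inD.
move=> m; rewrite mcoeffD; have [->|/aF//] := eqVneq F@_m 0.
by rewrite add0r => /aG.
Qed.

Lemma homog_formZ J j n c F : is_ideal J -> homog_form J j n F -> homog_form J j n (c *: F).
Proof.
move=> Jid [JF aF]; split=> m; rewrite mcoeffZ; first exact: idealM.
by move=> cF; apply: aF; apply: contra cF => /eqP->; rewrite mulr0.
Qed.

Lemma homog_formX J j n c m : is_ideal J -> J c -> admissible j n m ->
  homog_form J j n (c *: 'X_[m]).
Proof.
move=> Jid Jc am; split=> k; rewrite mcoeffZ mcoeffX.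
  by case: eqP => _; rewrite ?mulr1 ?mulr0 //; apply: ideal0.
by have [<-//|] := eqVneq m k; rewrite mulr0 eqxx.
Qed.

Lemma homog_form_ind J j n (K : set {mpoly A[d]}) :
  K 0 -> (forall F G, K F -> K G -> K (F + G)) ->
  (forall c m, J c -> admissible j n m -> K (c *: 'X_[m])) ->
  homog_form J j n `<=` K.
Proof.
move=> K0 KD KX F [JF aF]; rewrite [F]mpolyE big_seq.
elim/big_ind: _ => // m; rewrite mcoeff_msupp => Fm.
by apply: KX; [exact: JF|exact: aF].
Qed.

(** The ideal J (b_0, ..., b_(j-1))^n, see [ideal_pow_power] and
    [prod_set_power]; written with forms rather than products, so that quasi-
    regularity can be applied to its elements. *)
Definition power J j n : set A := [set ev F | F in homog_form J j n].

Lemma evM F G : ev (F * G) = ev F * ev G. Proof. exact: mevalM. Qed.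
Lemma evD F G : ev (F + G) = ev F + ev G. Proof. exact: mevalD. Qed.
Lemma evZ c F : ev (c *: F) = c * ev F. Proof. exact: mevalZ. Qed.
Lemma ev0 : ev 0 = 0. Proof. exact: meval0. Qed.
Lemma evXU i : ev 'X_i = b i. Proof. exact: mevalXU. Qed.

Lemma power_is_ideal J j n : is_ideal J -> is_ideal (power J j n).
Proof.
move=> Jid; split=> [|_ _ [F HF <-] [G HG <-]|r _ [F HF <-]].
- by exists 0; [exact: homog_form0|exact: ev0].
- by exists (F + G); [exact: homog_formD|exact: evD].
- by exists (r *: F); [exact: homog_formZ|exact: evZ].
Qed.

Lemma power_ind J j n (K : set A) : is_ideal K ->
  (forall c m, J c -> admissible j n m -> K (c * ev 'X_[m])) ->
  power J j n `<=` K.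
Proof.
move=> Kid KX _ [F HF <-]; apply: (homog_form_ind _ _ _ HF (K := [set F | K (ev F)])).
- by rewrite /= ev0; apply: ideal0.
- by move=> ? ? ? ?; rewrite /= evD; apply: idealD.
- by move=> c m Jc am; rewrite /= evZ; apply: KX.
Qed.

Lemma powerX J j n c m : is_ideal J -> J c -> admissible j n m ->
  power J j n (c * ev 'X_[m]).
Proof. by move=> Jid Jc am; exists (c *: 'X_[m]); [exact: homog_formX|exact: evZ]. Qed.

Lemma setT_ideal : is_ideal [set: A]. Proof. by []. Qed.

Lemma evX0 : ev 'X_[0] = 1.
Proof. by rewrite /ev mevalX big1 // => i _; rewrite mnm0E. Qed.

Lemma power0 j u : power setT j 0 u.
Proof.
rewrite -[u]mulr1 -evX0; apply: powerX => //.
by split=> [|i _]; rewrite ?mdeg0 ?mnm0E.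
Qed.

Lemma ev_monomial0_eq0 F : (forall m, F@_m != 0 -> m = 0%MM) -> ev F = 0 -> F = 0.
Proof.
move=> F0; have -> : F = F@_0 *: 'X_[0].
  apply/mpolyP => m; rewrite mcoeffZ mcoeffX eq_sym.
  have [->|m0] := eqVneq m 0%MM; first by rewrite mulr1.
  by rewrite mulr0; apply/eqP; apply: contraNT m0 => /F0 ->.
by rewrite evZ evX0 mulr1 => ->; rewrite scale0r.
Qed.

Local Notation Qj j := (gen_ideal (fun i : 'I_j => b i)).

Lemma admissibleU j n (i : 'I_d) m : (i < j)%N ->
  admissible j n m -> admissible j n.+1 (U_(i) + m).
Proof.
move=> ij [mn mj]; split=> [|l jl]; first by rewrite mdegD mdeg1 mn.
rewrite mnmDE mnm1E mj // addn0; case: eqP => // il.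
by move: jl; rewrite -il leqNgt ij.
Qed.

Lemma power_gen_sub j n : (j <= d)%N -> power (Qj j) j n `<=` power setT j n.+1.
Proof.
move=> jd; apply: power_ind; first exact/power_is_ideal/setT_ideal.
move=> _ m [c ->] am; rewrite mulr_suml.
have Pid := power_is_ideal j n.+1 setT_ideal.
apply: ideal_sum => // i _; rewrite -mulrA; apply: idealM => //.
have -> : b i * ev 'X_[m] = 1 * ev 'X_[U_(widen_ord jd i) + m].
  by rewrite mpolyXD evM evXU mul1r.
exact: (powerX setT_ideal I (admissibleU (i := widen_ord jd i) (ltn_ord i) am)).
Qed.

Lemma power_sub_gen j n : power setT j n.+1 `<=` power (Qj j) j n.
Proof.
have Qid := gen_ideal_is_ideal (fun i : 'I_j => b i).
apply: power_ind; first exact/power_is_ideal.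
move=> c m _ [mn mj].
have [i mi] : exists i, m i != 0%N.
  apply: contrapT => no; have m0 : m = 0%MM.
    apply/mnmP => i; rewrite mnm0E; apply/eqP; apply: contrapT => /negP mi.
    by apply: no; exists i.
  by rewrite m0 mdeg0 in mn.
have ij : (i < j)%N by rewrite ltnNge; apply: contra mi => /mj->.
have Um : (U_(i) <= m)%MM by rewrite lep1mP.
rewrite -(submK Um) addmC mpolyXD evM evXU mulrA.
apply: powerX => //.
  by apply: idealM => //; exact: (gen_ideal_gen (fun i : 'I_j => b i) (Ordinal ij)).
split=> [|l jl]; first by have := mn; rewrite -{1}(submK Um) mdegD mdeg1 addn1 => -[].
by rewrite mnmBE mj.
Qed.

Lemma homog_form_split (j : 'I_d) n F : homog_form setT j.+1 n.+1 F ->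
  exists G H, [/\ homog_form setT j n.+1 G, homog_form setT j.+1 n H & F = G + 'X_j * H].
Proof.
pose K := [set F | exists G H, [/\ homog_form setT j n.+1 G, homog_form setT j.+1 n H & F = G + 'X_j * H]].
apply: (homog_form_ind (K := K)).
- by exists 0, 0; rewrite mulr0 addr0; split=> //; apply: homog_form0.
- move=> _ _ [G [H [HG HH ->]]] [G' [H' [HG' HH' ->]]].
  exists (G + G'), (H + H'); rewrite mulrDr addrACA.
  by split=> //; apply: homog_formD.
move=> c m _ [mn mj]; have [m0|m1] := eqVneq (m j) 0%N.
  exists (c *: 'X_[m]), 0; rewrite mulr0 addr0; split=> //; last exact: homog_form0.
  apply: homog_formX => //; split=> // l; rewrite leq_eqVlt => /orP[/eqP jl|/mj//].
  by rewrite -m0; congr (m _); apply: val_inj.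
have Um : (U_(j) <= m)%MM by rewrite lep1mP.
exists 0, (c *: 'X_[m - U_(j)]); split=> //; first exact: homog_form0.
- apply: homog_formX => //; split=> [|l jl].
    by have := mn; rewrite -{1}(submK Um) mdegD mdeg1 addn1 => -[].
  by rewrite mnmBE mj.
- by rewrite add0r -scalerAr -mpolyXD addmC submK.
Qed.

Lemma homog_form_widen J j n F : homog_form J j n F -> homog_form J j.+1 n F.
Proof.
case=> JF aF; split=> // m /aF[mn mj]; split=> // i ji.
by apply: mj; apply: ltnW.
Qed.

Hypothesis b_regular : forall i, (i < d)%N -> regular_on (Qj i) (b i).

(** If b_j u lies in the (n+1)-st power, by induction u is the value of a form F
    of degree n; then quasi-regularity puts the coefficients of b_j F, hence
    those of F, into the ideal of the preceding b_i. *)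
Lemma power_regular j n u : (j < d)%N ->
  (forall n F, homog_form setT j n F -> power setT j n.+1 (ev F) -> coefs_in (Qj j) F) ->
  power setT j n (b j * u) -> power setT j n u.
Proof.
move=> jd quasi; elim: n => [_|n IH Hbu]; first exact: power0.
have Qid := gen_ideal_is_ideal (fun i : 'I_j => b i).
have [F HF uE] : power setT j n u.
  by apply: IH; have [F [_ aF] <-] := power_sub_gen Hbu; exists F.
rewrite -uE; apply: (power_gen_sub (ltnW jd)); exists F => //; split; last by case: HF.
move=> m; apply: (b_regular jd); rewrite -mcoeffZ.
by apply: (quasi n); [exact: homog_formZ|rewrite evZ uE].
Qed.

(** An element of the (n+1)-st power is the value of a form of degree n with
    coefficients in the ideal of the b_i; subtracting it reduces to value 0. *)
Lemma quasi_of_kernel j n :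
  (forall F, homog_form setT j n F -> ev F = 0 -> coefs_in (Qj j) F) ->
  forall F, homog_form setT j n F -> power setT j n.+1 (ev F) -> coefs_in (Qj j) F.
Proof.
move=> ker F HF HevF; have Qid := gen_ideal_is_ideal (fun i : 'I_j => b i).
have [G [QG aG] evG] := power_sub_gen HevF.
rewrite -[F](subrK G); apply: coefs_inD => //; apply: ker.
  by rewrite -scaleN1r; apply: homog_formD => //; apply: homog_formZ.
by rewrite -scaleN1r evD evZ evG mulN1r subrr.
Qed.

(** Write F = G + X_j H with G free of X_j.  Then b_j H(b) = - G(b) lies in the
    n-th power of the preceding ideal, hence so does H(b), say H(b) = h(b).  The
    coefficients of H are in the ideal by induction on the degree, and those of
    G + b_j h by induction on the number of variables. *)
Lemma quasi_regular_kernel j n F : (j <= d)%N ->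
  homog_form setT j n F -> ev F = 0 -> coefs_in (Qj j) F.
Proof.
elim: j n F => [|j IHj] n F jd HF F0.
  have Qid := gen_ideal_is_ideal (fun i : 'I_0 => b i).
  suff -> : F = 0 by move=> m; rewrite mcoeff0; apply: ideal0.
  apply: ev_monomial0_eq0 F0 => m /HF.2[_ mi].
  by apply/mnmP => i; rewrite mi // mnm0E.
have Qid := gen_ideal_is_ideal (fun i : 'I_j.+1 => b i).
have QjS c : Qj j c -> Qj j.+1 c by rewrite gen_ideal_adjoin; apply: sub_adjoin.
have Qjb : Qj j.+1 (b j) := gen_ideal_gen (fun i : 'I_j.+1 => b i) ord_max.
have quasij n' F' := quasi_of_kernel (IHj n' ^~ (ltnW jd)) (F := F').
elim: n F HF F0 => [|n IHn] F HF F0.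
  suff -> : F = 0 by move=> m; rewrite mcoeff0; apply: ideal0.
  apply: ev_monomial0_eq0 F0 => m /HF.2[m0 _].
  by apply/eqP; rewrite -mdeg_eq0 m0.
have [G [H [HG HH FE]]] := homog_form_split (j := Ordinal jd) HF.
have bH : b j * ev H = - ev G.
  by apply/eqP; rewrite -addr_eq0 addrC -F0 FE evD evM evXU.
have [h Hh evh] : power setT j n.+1 (ev H).
  apply: power_regular => // ; rewrite bH -mulN1r -evZ.
  by exists (-1 *: G) => //; apply: homog_formZ.
have QH : coefs_in (Qj j.+1) H.
  apply: (quasi_of_kernel IHn) => //; rewrite -evh.
  by exists h => //; apply: homog_form_widen.
have QG : coefs_in (Qj j.+1) G.
  have QGh : coefs_in (Qj j) (G + b j *: h).
    apply: (IHj n.+1) => //; first exact: ltnW.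
      by apply: homog_formD => //; apply: homog_formZ.
    by rewrite evD evZ evh bH subrr.
  move=> m; rewrite -[G@_m](addrK (b j * h@_m)); apply: idealB => //.
    by rewrite -mcoeffZ -mcoeffD; apply: QjS.
  exact: idealMr_set.
by rewrite FE; apply: coefs_inD => //; apply: coefs_inM.
Qed.

Lemma quasi_regular n F : homog_form setT d n F -> power setT d n.+1 (ev F) ->
  coefs_in (Qj d) F.
Proof.
by move=> HF; apply: (quasi_of_kernel (n := n)) => // G; apply: quasi_regular_kernel.
Qed.

End QuasiRegular.

(** * Linear systems that are injective modulo the maximal ideal *)

Section ReductionModM.
Variables (A : comNzRingType) (k : fieldType) (pi : {rmorphism A -> k}).
Hypothesis pi_surj : forall x, exists a, pi a = x.
Hypothesis pi_local : forall a, pi a != 0 -> invertible a.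

(** A left inverse modulo m lifts to a matrix whose product with M has
    determinant invertible in the local ring A. *)
Lemma mx_injective_mod n p (M : 'M[A]_(n, p)) :
  (forall v : 'rV[k]_n, v *m map_mx pi M = 0 -> v = 0) ->
  forall (J : set A) (y : 'rV[A]_n), is_ideal J ->
    (forall j, J ((y *m M) ord0 j)) -> forall i, J (y ord0 i).
Proof.
move=> Minj J y Jid JyM i.
have : row_free (map_mx pi M).
  rewrite -kermx_eq0; apply/eqP/row_matrixP => l; rewrite row0.
  by apply: Minj; rewrite -row_mul mulmx_ker row0.
case/row_freeP => N' MN'.
have [g gK] := choice pi_surj.
pose N : 'M[A]_(p, n) := map_mx g N'.
have piN : map_mx pi N = N' by apply/matrixP => r s; rewrite !mxE gK.
apply: (@ideal_invertible A J (\det (M *m N))) => //.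
  by apply: pi_local; rewrite -det_map_mx map_mxM piN MN' det1 oner_eq0.
have -> : \det (M *m N) * y ord0 i = (y *m M *m (N *m \adj (M *m N))) ord0 i.
  by rewrite !mulmxA -(mulmxA y) -mulmxA mul_mx_adj mul_mx_scalar mxE.
by rewrite mxE; apply: ideal_sum => // j _; apply: idealMr_set.
Qed.

Lemma fin_injective_mod (U W : finType) (M : U -> W -> A) :
  (forall v : U -> k, (forall w, \sum_u v u * pi (M u w) = 0) ->
     forall u, v u = 0) ->
  forall (J : set A) (y : U -> A), is_ideal J ->
    (forall w, J (\sum_u y u * M u w)) -> forall u, J (y u).
Proof.
move=> Minj J y Jid JyM u.
pose MM := \matrix_(i < #|U|, j < #|W|) M (enum_val i) (enum_val j).
have := @mx_injective_mod _ _ MM _ J (\row_i y (enum_val i)) Jid _ (enum_rank u).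
rewrite mxE enum_rankK; apply=> [v vM|j].
  apply/rowP => i; rewrite mxE -[i]enum_valK.
  apply: (Minj (fun u => v ord0 (enum_rank u))) => w.
  have := congr1 (fun N : 'rV_ _ => N ord0 (enum_rank w)) vM.
  rewrite !mxE => {2}<-; rewrite (reindex _ (onW_bij _ (@enum_rank_bij U))) /=.
  by apply: eq_bigr => u' _; rewrite !mxE !enum_rankK.
rewrite mxE (reindex _ (onW_bij _ (@enum_rank_bij U))) /=.
by under eq_bigr do rewrite !mxE enum_rankK; apply: JyM.
Qed.

Variable d : nat.

Lemma mpoly_injective_mod s (F : 'I_s -> {mpoly A[d]}) N :
  (forall Y : 'I_s -> {mpoly k[d]}, (forall l, (msize (Y l) <= N)%N) ->
     \sum_l Y l * map_mpoly pi (F l) = 0 -> forall l, Y l = 0) ->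
  forall (J : set A) (Y : 'I_s -> {mpoly A[d]}), is_ideal J ->
    (forall l, (msize (Y l) <= N)%N) ->
    coefs_in J (\sum_l Y l * F l) -> forall l, coefs_in J (Y l).
Proof.
move=> Finj J Y Jid Ysize JYF.
(* N' bounds the degrees of all monomials in the products Y_l F_l *)
pose N' := (N + \sum_l msize (F l)).+1.
pose M (u : 'I_s * 'X_{1..d < N}) (w : 'X_{1..d}) := ('X_[u.2] * F u.1)@_w.
have M0 u w : (N' <= mdeg w)%N -> M u w = 0.
  move=> wN; apply: memN_msupp_eq0; apply: msize_mdeg_ge; apply: leq_trans wN.
  apply: (leq_trans (msizeM_le _ _)); rewrite msizeX ltnS leq_add //.
    exact: bmdeg.
  by rewrite (bigD1 u.1) //= leq_addr.
have YF Z w : (forall l, (msize (Z l) <= N)%N) ->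
    (\sum_l Z l * F l)@_w =
      \sum_(u : 'I_s * 'X_{1..d < N}) (Z u.1)@_(bmnm u.2) * M u w.
  move=> Zs; rewrite raddf_sum /= -(pair_bigA _ (fun l m => (Z l)@_(bmnm m) * M (l, m) w)) /=.
  apply: eq_bigr => l _; rewrite {1}(mpolywE (Zs l)) mulr_suml raddf_sum /=.
  by apply: eq_bigr => m _; rewrite -scalerAl mcoeffZ.
move=> l m; have [mN|Nm] := ltnP (mdeg m) N; last first.
  by rewrite memN_msupp_eq0; [exact: ideal0|apply/msize_mdeg_ge/(leq_trans (Ysize l))].
apply: (@fin_injective_mod _ 'X_{1..d < N'} (fun u w => M u (val w)) _ J
  (fun u => (Y u.1)@_(bmnm u.2)) Jid _ (l, BMultinom mN)) => [v vM|w]; last first.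
  by rewrite -YF.
pose Z l := \sum_(m : 'X_{1..d < N}) v (l, m) *: 'X_[m].
have Zs l' : (msize (Z l') <= N)%N.
  rewrite (leq_trans (msize_sum _ _ _)) //; apply/bigmax_leqP => m' _.
  by rewrite (leq_trans (msizeZ_le _ _)) // msizeX bmdeg.
have ZF : \sum_l Z l * map_mpoly pi (F l) = 0.
  apply/mpolyP => w; rewrite mcoeff0 raddf_sum /=.
  transitivity (\sum_u v u * pi (M u w)).
    rewrite [RHS](eq_bigr (fun u => v (u.1, u.2) * pi (M (u.1, u.2) w))); last by case.
    rewrite -(pair_bigA _ (fun l m => v (l, m) * pi (M (l, m) w))) /=.
    apply: eq_bigr => l' _; rewrite mulr_suml raddf_sum /=.
    apply: eq_bigr => m' _; rewrite -scalerAl mcoeffZ; congr (_ * _).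
    by rewrite /M -mcoeff_map_mpoly rmorphM /= map_mpolyX.
  have [wN|Nw] := ltnP (mdeg w) N'; first exact: (vM (BMultinom wN)).
  by rewrite big1 // => u _; rewrite M0 // rmorph0 mulr0.
move=> [l' m']; have := congr1 (mcoeff (bmnm m')) (Finj Z Zs ZF l').
rewrite mcoeff0 raddf_sum /= (bigD1 m') //= mcoeffZ mcoeffX eqxx mulr1.
rewrite big1 ?addr0 // => m'' /negbTE; rewrite -val_eqE /= => mm.
by rewrite mcoeffZ mcoeffX mm mulr0.
Qed.

End ReductionModM.

Section Power.
Variables (A : comNzRingType) (d : nat) (b : nat -> A).
Implicit Types (J : set A) (F G H : {mpoly A[d]}).
Local Notation Q := (gen_ideal (fun i : 'I_d => b i)).

Lemma homog_formP J n F : homog_form J d n F <-> coefs_in J F /\ F \is n.-homog.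
Proof.
split=> -[JF HF]; split=> //.
  by apply/dhomogP => m; rewrite mcoeff_msupp => /HF[].
move=> m Fm; split; first by apply: (dhomogP _ _ _ HF); rewrite mcoeff_msupp.
by move=> i; rewrite leqNgt ltn_ord.
Qed.

Lemma homog_formM J n p F G : is_ideal J -> homog_form setT d n F -> homog_form J d p G ->
  homog_form J d (n + p) (F * G).
Proof.
move=> Jid /homog_formP[_ HF] /homog_formP[JG HG]; apply/homog_formP.
by split; [exact: coefs_inM|exact: dhomogM].
Qed.

Lemma power_sub J K n : J `<=` K -> power d b J d n `<=` power d b K d n.
Proof. by move=> JK _ [F [JF aF] <-]; exists F => //; split=> // m; apply: JK. Qed.

Lemma power_leq n p : (n <= p)%N -> power d b setT d p `<=` power d b setT d n.
Proof.
elim: p => [|p IH]; first by rewrite leqn0 => /eqP->.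
rewrite leq_eqVlt => /orP[/eqP->//|/IH]; apply: subset_trans.
by move=> u /power_sub_gen; apply: power_sub.
Qed.

Hypothesis b_regular : forall i, (i < d)%N ->
  regular_on (gen_ideal (fun j : 'I_i => b j)) (b i).
Variables (k : fieldType) (pi : {rmorphism A -> k}).
Hypothesis pi_surj : forall x, exists a, pi a = x.
Hypothesis pi_local : forall a, pi a != 0 -> invertible a.

(** First x_l lies in Q^i for i = 0, ..., n: if x_l = Y_l(b) with Y_l a form of
    degree i < n, then sum_l Y_l F_l takes a value in Q^(i+p+1), so its
    coefficients are in Q, and [mpoly_injective_mod] applies modulo Q.  For
    i = n the same argument modulo J finishes the proof. *)
Lemma power_cancel_forms s (F : 'I_s -> {mpoly A[d]}) p n :
  (forall l, F l \is p.-homog) ->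
  (forall Y : 'I_s -> {mpoly k[d]}, (forall l, (msize (Y l) <= n.+1)%N) ->
     \sum_l Y l * map_mpoly pi (F l) = 0 -> forall l, Y l = 0) ->
  forall (J : set A) (x : 'I_s -> A), is_ideal J -> Q `<=` J ->
    power d b J d (n + p) (\sum_l x l * ev b (F l)) ->
    forall l, power d b J d n (x l).
Proof.
move=> HF Finj J x Jid QJ Hx.
have Fform l : homog_form setT d p (F l) by apply/homog_formP.
have Qid := gen_ideal_is_ideal (fun i : 'I_d => b i).
have lift i (Y : 'I_s -> {mpoly A[d]}) K : (i <= n)%N -> is_ideal K ->
    (forall l, homog_form setT d i (Y l)) -> coefs_in K (\sum_l Y l * F l) ->
    forall l, coefs_in K (Y l).
  move=> iN Kid HY; apply: (mpoly_injective_mod pi_surj pi_local Finj) => // l.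
  rewrite msizeE; apply/bigmax_leqP_seq => m; rewrite mcoeff_msupp.
  by move=> /((HY l).2 m)[-> _] _; rewrite ltnS.
have formS i (Y : 'I_s -> {mpoly A[d]}) : (forall l, homog_form setT d i (Y l)) ->
    homog_form setT d (i + p) (\sum_l Y l * F l).
  move=> HY; elim/big_ind: _ => [|? ?|l _]; [exact: homog_form0|exact: homog_formD|exact: homog_formM].
have evS (Y : 'I_s -> {mpoly A[d]}) : (forall l, ev b (Y l) = x l) ->
    ev b (\sum_l Y l * F l) = \sum_l x l * ev b (F l).
  move=> HY; rewrite /ev raddf_sum /=; apply: eq_bigr => l _.
  by rewrite rmorphM /= -/(ev b _) HY.
have Hpow i : (i <= n)%N -> forall l, power d b setT d i (x l).
  elim: i => [_ l|i IH iN]; first exact: power0.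
  have {IH} /choice[Y HY] : forall l, exists F, homog_form setT d i F /\ ev b F = x l.
    by move=> l; have [Y HY YE] := IH (ltnW iN) l; exists Y.
  have HY1 l := (HY l).1; have HY2 l := (HY l).2.
  move=> l; rewrite -HY2; apply: power_gen_sub => //; exists (Y l) => //.
  split; last by case: (HY1 l).
  move: l; apply: (lift i) => //; first exact: ltnW.
  apply: (quasi_regular b_regular (n := i + p)); first exact: formS.
  rewrite evS //; apply: (power_leq (p := n + p)); first by rewrite -addSn leq_add2r.
  by apply: (power_sub (J := J)).
have /choice[Y HY] : forall l, exists F, homog_form setT d n F /\ ev b F = x l.
  by move=> l; have [Y HY YE] := Hpow n (leqnn n) l; exists Y.
have HY1 l := (HY l).1; have HY2 l := (HY l).2.
have [H HH evH] := Hx.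
suff JY l : coefs_in J (Y l).
  by move=> l; rewrite -HY2; exists (Y l) => //; split; [exact: JY|case: (HY1 l)].
move: l; apply: (lift n) => //.
rewrite -[\sum_l _](subrK H); apply: coefs_inD => //; last by case: HH.
suff : coefs_in Q (\sum_l Y l * F l - H) by move=> QYH m; apply: QJ.
have HT : homog_form setT d (n + p) H by case: HH.
apply: (quasi_of_kernel (j := d) (n := n + p)).
- by move=> G; apply: quasi_regular_kernel.
- by rewrite -scaleN1r; apply: homog_formD => //; [exact: formS|exact: homog_formZ].
- rewrite -scaleN1r evD evZ evS // evH mulN1r subrr.
  by apply: ideal0; apply: power_is_ideal; apply: setT_ideal.
Qed.

End Power.

(** * Rees algebras and powers of ideals *)

Section ProductSets.
Variable A : comNzRingType.
Implicit Types (I J K X Y : set A).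

Lemma prod_set_min X Y K : is_ideal K ->
  (forall x y, X x -> Y y -> K (x * y)) -> prod_set X Y `<=` K.
Proof. by move=> Kid HK _ [n [x [y [Xx Yy ->]]]]; apply: ideal_sum => // i _; apply: HK. Qed.

Lemma prod_set_mem X Y x y : X x -> Y y -> prod_set X Y (x * y).
Proof.
move=> Xx Yy; exists 1%N, (fun=> x), (fun=> y).
by split=> //; rewrite big_ord1.
Qed.

Lemma prod_set_ideal X Y : is_ideal Y -> is_ideal (prod_set X Y).
Proof.
move=> Yid; split; [exact: prod_set0|exact: prod_setD|].
by move=> r x; apply: prod_setMl => y; apply: idealM.
Qed.

Lemma ideal_powS J n : ideal_pow J n.+1 = prod_set J (ideal_pow J n).
Proof. by []. Qed.

Lemma ideal_pow_ideal J n : is_ideal (ideal_pow J n).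
Proof. by elim: n => // n IH; rewrite ideal_powS; apply: prod_set_ideal. Qed.

Lemma ideal_powM J i j x y : ideal_pow J i x -> ideal_pow J j y ->
  ideal_pow J (i + j) (x * y).
Proof.
elim: i x => [|i IH] x; first by move=> _ Jy; apply: idealM => //; apply: ideal_pow_ideal.
rewrite addSn !ideal_powS => Jx Jy; move: x Jx.
apply: (@prod_set_min _ _ [set x | prod_set J (ideal_pow J (i + j)) (x * y)]).
  have Pid := prod_set_ideal J (ideal_pow_ideal J (i + j)).
  split=> [|u v|r u] /=; first by rewrite mul0r; apply: ideal0.
    by rewrite mulrDl; apply: idealD.
  by rewrite -mulrA; apply: idealM.
by move=> u v Ju Jv /=; rewrite -mulrA; apply: prod_set_mem => //; apply: IH.
Qed.

Lemma prod_set_gen X Y K Z : is_ideal K ->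
  (forall x y z, X x -> Y y -> Z z -> K (x * y * z)) ->
  forall u z, prod_set X Y u -> Z z -> K (u * z).
Proof.
move=> Kid HK u z Hu Zz; move: u Hu.
apply: (@prod_set_min _ _ [set u | K (u * z)]) => [|x y Xx Yy /=]; last exact: HK.
split=> [|u v|r u] /=; first by rewrite mul0r; apply: ideal0.
  by rewrite mulrDl; apply: idealD.
by rewrite -mulrA; apply: idealM.
Qed.
End ProductSets.

Section Rees.
Variable A : comNzRingType.
Implicit Types (I J K : set A) (p q : {poly A}).

Lemma rees_monomial J n c : ideal_pow J n c -> rees J (c *: 'X^n).
Proof.
have [R1 RB RM] := rees_subring J.
have R0 : rees J 0 by rewrite -(subrr 1); apply: RB.
have RD p q : rees J p -> rees J q -> rees J (p + q).
  by move=> Hp Hq; rewrite -[q]opprK; apply: (RB) => //; rewrite -sub0r; apply: (RB).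
elim: n c => [c _|n IH c]; first by rewrite expr0 alg_polyC; apply: reesC.
rewrite ideal_powS => -[l [x [y [Jx Jy ->]]]]; rewrite scaler_suml.
elim/big_ind: _ => // i _.
have -> : (x i * y i) *: 'X^(n.+1) = (x i *: 'X) * (y i *: 'X^n) :> {poly A}.
  by rewrite -scalerAl -scalerAr scalerA -exprS.
apply: RM; last exact: IH.
by move=> U [_]; apply; right; exists (x i).
Qed.


Lemma rees_coefP J p : is_ideal J -> rees J p <-> forall n, ideal_pow J n p`_n.
Proof.
move=> Jid; split=> [Hp|Jp]; last first.
  rewrite -[p]coefK poly_def; have [R1 RB RM] := rees_subring J.
  have R0 : rees J 0 by rewrite -(subrr 1); apply: RB.
  elim/big_ind: _ => // [u v Hu Hv|i _]; last exact: rees_monomial.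
  by rewrite -[v]opprK; apply: (RB) => //; rewrite -sub0r; apply: (RB).
have Pid n := ideal_pow_ideal J n.
apply: (Hp [set p | forall n, ideal_pow J n p`_n]); split.
  split=> [n|u v Hu Hv n|u v Hu Hv n] /=.
  - by rewrite coef1; case: n => // n; apply: ideal0.
  - by rewrite coefB; apply: idealB.
  rewrite coefM; apply: ideal_sum => // i _.
  have : ideal_pow J (i + (n - i)) (u`_i * v`_(n - i)) by apply: ideal_powM.
  by rewrite subnKC // -ltnS.
move=> q [[c _ <-] n|[x Jx <-] n].
  by rewrite coefC; case: n => // n; apply: ideal0.
rewrite coefZ coefX; case: n => [|[|n]] //=; rewrite ?mulr1 ?mulr0.
- by rewrite -[x]mulr1; apply: prod_set_mem.
- exact: (ideal0 (Pid n.+2)).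
Qed.

(** The homogeneous component of degree n of I T is I Q^n. *)
Lemma ext_set_coefP I J p : is_ideal I -> is_ideal J ->
  ext_set I J p <-> forall n, prod_set I (ideal_pow J n) p`_n.
Proof.
move=> Iid Jid; have Pid n := prod_set_ideal I (ideal_pow_ideal J n).
split=> [[l [x [y [Ix Jy ->]]]] n|Hp].
  rewrite coef_sum; apply: ideal_sum => // i _; have [c Ic <-] := Ix i.
  by rewrite coefCM; apply: prod_set_mem => //; have /(rees_coefP _ Jid) := Jy i.
rewrite -[p]coefK poly_def; elim/big_ind: _ => [||i _]; [exact: prod_set0|exact: prod_setD|].
have [l [x [y [Ix Jy ->]]]] := Hp i; rewrite scaler_suml.
elim/big_ind: _ => [||j _]; [exact: prod_set0|exact: prod_setD|].
rewrite -scalerA -mul_polyC; apply: prod_set_mem; first by exists (x j).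
exact: rees_monomial.
Qed.

Lemma fiber_ideal_coefP Q (m : idealr A) (t : rees_ring Q) : is_ideal Q ->
  fiber_ideal m t <-> forall n, prod_set [set` m] (ideal_pow Q n) (rees_val t)`_n.
Proof.
move=> Qid; have Pid n := prod_set_ideal [set` m] (ideal_pow_ideal Q n).
have mono n c : ideal_pow Q n c -> c *: 'X^n \in rees_pred Q.
  by move=> Qc; rewrite unfold_in; apply/asboolP; apply: rees_monomial.
split=> [[l [x [y [mx _ ->]]]] n|Ht].
  rewrite -[rees_val _]/(val (\sum_i x i * y i)) raddf_sum /= coef_sum; apply: ideal_sum => // i _.
  have [c mc <-] := mx i; rewrite /= coefCM; apply: prod_set_mem => //.
  by case: (y i) => q /= /asboolP /(rees_coefP _ Qid).
have -> : t = \sum_(i < size (rees_val t))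
    insubd 0 ((rees_val t)`_i *: 'X^i : {poly A}).
  apply: val_inj; rewrite raddf_sum /= -{1}[rees_val t]coefK poly_def.
  apply: eq_bigr => i _; rewrite insubdK //; apply: mono.
  apply: (prod_set_min _ _ (Ht i)) => [|x y _ Qy]; first exact: ideal_pow_ideal.
  by apply: idealM => //; exact: ideal_pow_ideal.
elim/big_ind: _ => [||i _]; [exact: prod_set0|exact: prod_setD|].
have [l [x [y [Ix Jy E]]]] := Ht i; exists l.
exists (fun j => rees_const Q (x j)), (fun j => insubd 0 (y j *: 'X^i : {poly A})).
split=> // [j|]; first by exists (x j).
apply: val_inj; rewrite raddf_sum insubdK; last first.
  apply: mono; rewrite E; apply: ideal_sum => [|j _]; first exact: ideal_pow_ideal.
  by apply: idealM => //; exact: ideal_pow_ideal.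
rewrite E scaler_suml; apply: eq_bigr => j _.
by rewrite -scalerA -mul_polyC /= insubdK //; apply: mono.
Qed.

End Rees.

Section Power.
Variables (A : comNzRingType) (d : nat) (b : nat -> A).
Local Notation Q := (gen_ideal (fun i : 'I_d => b i)).

Lemma prod_set_power (K : set A) n : is_ideal K ->
  prod_set K (power d b setT d n) = power d b K d n.
Proof.
move=> Kid; rewrite eqEsubset; split.
  apply: prod_set_min => [|x _ Kx [F [_ aF] <-]]; first exact: power_is_ideal.
  exists (x *: F); last exact: evZ.
  split=> m; rewrite mcoeffZ; first exact: idealMr_set.
  by move=> xF; apply: aF; apply: contra xF => /eqP->; rewrite mulr0.
apply: power_ind; first exact/prod_set_ideal/power_is_ideal/setT_ideal.
move=> c m Kc am; apply: prod_set_mem => //; rewrite -[ev _ _]mul1r.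
by apply: powerX.
Qed.

Lemma ideal_pow_power n : ideal_pow Q n = power d b setT d n.
Proof.
elim: n => [|n IH].
  by rewrite eqEsubset; split=> // u _; apply: power0.
rewrite ideal_powS IH prod_set_power; last exact: gen_ideal_is_ideal.
by rewrite eqEsubset; split; [apply: power_gen_sub|apply: power_sub_gen].
Qed.

End Power.

(** The homomorphism theorem for rings. *)
Lemma rmorphism_factor (P B R : comNzRingType) (beta : {rmorphism P -> B})
    (phi : {rmorphism P -> R}) :
  (forall x, exists F, beta F = x) -> (forall F, beta F = 0 -> phi F = 0) ->
  exists lam : {rmorphism B -> R}, forall F, lam (beta F) = phi F.
Proof.
move=> /choice[g gK] ker; pose f x := phi (g x).
have fE F : f (beta F) = phi F.
  by apply/eqP; rewrite -subr_eq0 /f -rmorphB ker // rmorphB gK subrr.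
have fB : {morph f : x y / x - y}.
  by move=> x y; rewrite -{1}(gK x) -{1}(gK y) -rmorphB fE rmorphB.
have fM : monoid_morphism f.
  split=> [|x y]; first by rewrite -(rmorph1 beta) fE rmorph1.
  by rewrite -{1}(gK x) -{1}(gK y) -rmorphM fE rmorphM.
pose lam : {rmorphism B -> R} := HB.pack f
  (GRing.isZmodMorphism.Build _ _ f fB) (GRing.isMonoidMorphism.Build _ _ f fM).
by exists lam.
Qed.

Lemma mcoeff_pihomog (A : comNzRingType) d n (F : {mpoly A[d]}) u :
  (pihomog mdeg n F)@_u = if mdeg u == n then F@_u else 0.
Proof.
elim/mpolyind: F => [|c v F _ _ IH]; first by rewrite raddf0 mcoeff0; case: ifP.
rewrite raddfD /= linearZ /= pihomogX !mcoeffD !mcoeffZ IH mcoeffX.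
have [->|ne] := eqVneq v u.
  by case: eqP => _; rewrite ?mcoeffX ?eqxx ?mcoeff0 ?mulr0 ?addr0.
by rewrite (fun_if (mcoeff u)) mcoeffX (negbTE ne) mcoeff0 if_same mulr0 !add0r.
Qed.

(** * The fiber ring is a polynomial ring *)

Section ReesLift.
Variables (A : comNzRingType) (d : nat) (b : nat -> A) (Q : set A).
Hypothesis QE : Q = gen_ideal (fun i : 'I_d => b i).
Implicit Types F G : {mpoly A[d]}.

(** The substitution of b_i t for X_i, with t the indeterminate of {poly A}. *)
Definition rees_eval F : {poly A} :=
  mmap (@polyC A) (fun i : 'I_d => b i *: 'X) F.

Lemma rees_evalX c m :
  rees_eval (c *: 'X_[m]) = (c * ev b 'X_[m]) *: 'X^(mdeg m).
Proof.
rewrite /rees_eval mmapZ mmapX /mmap1 mul_polyC -scalerA; congr (_ *: _).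
rewrite /ev mevalX mdegE.
elim/big_ind3: _ => [|x1 x2 e1 y1 y2 e2 -> ->|i _].
- by rewrite expr0 scale1r.
- by rewrite exprD -scalerAl -scalerAr scalerA.
- by rewrite exprZn.
Qed.

Lemma rees_eval_homog n F : F \is n.-homog -> rees_eval F = ev b F *: 'X^n.
Proof.
move=> Fn; rewrite {2}[F]mpolyE /ev raddf_sum scaler_suml /=.
rewrite {1}[F]mpolyE [LHS]raddf_sum /= big_seq [RHS]big_seq.
apply: eq_bigr => m mF; rewrite -/(rees_eval _) rees_evalX -/(ev b _) evZ.
by rewrite (dhomogP _ _ _ Fn).
Qed.

Lemma coef_rees_eval F n : (rees_eval F)`_n = ev b (pihomog mdeg n F).
Proof.
elim/mpolyind: F => [|c m F _ _ IH].
  by rewrite /rees_eval mmap0 coef0 raddf0 ev0.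
rewrite raddfD /= /rees_eval mmapD coefD -/(rees_eval _) -/(rees_eval F) IH evD.
congr (_ + _); rewrite rees_evalX linearZ /= pihomogX coefZ coefXn (eq_sym n) evZ.
by case: (mdeg m == n); rewrite ?mulr1 // ev0 !mulr0.
Qed.

Lemma rees_eval_in F : rees_eval F \in rees_pred Q.
Proof.
rewrite unfold_in; apply/asboolP; rewrite QE.
apply/(rees_coefP _ (gen_ideal_is_ideal _)) => n.
rewrite ideal_pow_power coef_rees_eval; exists (pihomog mdeg n F) => //.
by apply/homog_formP; split=> //; apply: pihomogP.
Qed.

Definition rees_lift F : rees_ring Q := ReesRing (rees_eval_in F).

Fact rees_lift_zmod : {morph rees_lift : x y / x - y}.
Proof. by move=> F G; apply: val_inj; rewrite /= /rees_eval mmapB. Qed.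

Fact rees_lift_monoid : monoid_morphism rees_lift.
Proof.
split=> [|F G]; apply: val_inj; rewrite /= /rees_eval; first exact: rmorph1.
exact: rmorphM.
Qed.

HB.instance Definition _ :=
  GRing.isZmodMorphism.Build {mpoly A[d]} (rees_ring Q) rees_lift rees_lift_zmod.
HB.instance Definition _ :=
  GRing.isMonoidMorphism.Build {mpoly A[d]} (rees_ring Q) rees_lift rees_lift_monoid.

Lemma rees_coef_lift (t : rees_ring Q) n :
  exists2 F : {mpoly A[d]}, F \is n.-homog & ev b F = (rees_val t)`_n.
Proof.
have : power d b setT d n (rees_val t)`_n.
  rewrite -ideal_pow_power -QE; case: t => p /= /asboolP.
  by rewrite rees_coefP // QE; apply: gen_ideal_is_ideal.
by case=> F /homog_formP[_ Fn] FE; exists F.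
Qed.

Lemma rees_lift_homog (t : rees_ring Q) (n : nat) : Defs.homog n (rees_val t) ->
  exists2 F : {mpoly A[d]}, F \is n.-homog & rees_lift F = t.
Proof.
move=> tn; have [F Fn FE] := rees_coef_lift t n; exists F => //.
apply: val_inj => /=; rewrite (rees_eval_homog Fn) FE; apply/polyP => i.
rewrite coefZ coefXn; have [->|ne] := eqVneq i n; first by rewrite mulr1.
rewrite mulr0; apply/esym/eqP; apply: contraNT ne => /tn/eqP.
by rewrite eqz_nat.
Qed.

Lemma rees_lift_surj (t : rees_ring Q) : exists F : {mpoly A[d]}, rees_lift F = t.
Proof.
have /choice[G HG] : forall n, exists F : {mpoly A[d]}, F \is n.-homog /\ ev b F = (rees_val t)`_n.
  by move=> n; have [F ? ?] := rees_coef_lift t n; exists F.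
exists (\sum_(n < size (rees_val t)) G n); apply: val_inj.
rewrite rmorph_sum raddf_sum /= -[RHS]coefK poly_def.
apply: eq_bigr => n _; have [Gn GE] := HG n.
by rewrite (rees_eval_homog Gn) GE.
Qed.

Hypothesis b_regular : forall i, (i < d)%N ->
  regular_on (gen_ideal (fun j : 'I_i => b j)) (b i).
Variable m : idealr A.
Hypothesis Qm : Q `<=` [set` m].

Lemma fiber_pi0 : fiber_pi m 0 = 0 :> fiber_ring Q m.
Proof. by rewrite /fiber_pi rmorph0. Qed.

Lemma fiber_pi_eq0 (t : rees_ring Q) : fiber_pi m t = 0 <-> fiber_ideal m t.
Proof.
have E : (t - 0 \in @fiber_pred A Q m) = (fiber_pi m t == fiber_pi m 0).
  exact: Quotient.idealrBE.
rewrite subr0 fiber_pi0 in E; split=> [/eqP|tm]; last by apply/eqP; rewrite -E; apply/asboolP.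
by rewrite -E => /asboolP.
Qed.

(** In degree n the element of m T is the value of a form G over m; the form
    F - G has value 0, hence coefficients in Q, which is contained in m. *)
Lemma fiber_rees_lift_eq0 F : fiber_pi m (rees_lift F) = 0 <-> coefs_in [set` m] F.
Proof.
have mid := idealr_is_ideal m; have Qid : is_ideal Q.
  by rewrite QE; apply: gen_ideal_is_ideal.
have homF n : homog_form setT d n (pihomog mdeg n F).
  by apply/homog_formP; split=> //; apply: pihomogP.
rewrite fiber_pi_eq0 (fiber_ideal_coefP _ _ Qid); split=> [H u|H n]; last first.
  rewrite /= coef_rees_eval QE ideal_pow_power prod_set_power //.
  exists (pihomog mdeg n F) => //; split; last by case: (homF n).
  by move=> u; rewrite mcoeff_pihomog; case: ifP => // _; apply: ideal0.
pose n := mdeg u; have := H n.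
rewrite /= coef_rees_eval QE ideal_pow_power prod_set_power // => -[G [mG aG] evG].
have QG : coefs_in [set` m] (pihomog mdeg n F - G).
  have HG : homog_form setT d n G by [].
  move=> v; apply: Qm; rewrite QE; move: v.
  apply: (quasi_regular_kernel b_regular (n := n)) => //.
    rewrite -scaleN1r; apply: homog_formD => //; exact: homog_formZ.
  by rewrite -scaleN1r evD evZ evG mulN1r subrr.
have -> : F@_u = (pihomog mdeg n F - G)@_u + G@_u.
  by rewrite mcoeffB subrK mcoeff_pihomog eqxx.
exact: (idealD mid (QG u) (mG u)).
Qed.

Variables (k : fieldType) (pi : {rmorphism A -> k}).
Hypothesis pi_surj : forall x, exists a, pi a = x.
Hypothesis pi_ker : forall x, pi x = 0 <-> x \in m.

Lemma map_mpoly_eq0 F : map_mpoly pi F = 0 <-> coefs_in [set` m] F.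
Proof.
split=> [F0 u|mF]; first by rewrite /=; apply/pi_ker; rewrite -mcoeff_map_mpoly F0 mcoeff0.
by apply/mpolyP => u; rewrite mcoeff_map_mpoly mcoeff0; apply/pi_ker/mF.
Qed.

Lemma map_mpoly_homog_surj n (p : {mpoly k[d]}) : p \is n.-homog ->
  exists2 F : {mpoly A[d]}, F \is n.-homog & map_mpoly pi F = p.
Proof.
have /choice[g gK] := pi_surj.
move=> pn; exists (\sum_(u <- msupp p) g p@_u *: 'X_[u]).
  rewrite big_seq; apply: rpred_sum => u up; apply: rpredZ.
  by rewrite dhomogX; apply/eqP; apply: (dhomogP _ _ _ pn).
rewrite raddf_sum /= [RHS]mpolyE; apply: eq_bigr => u _.
by rewrite map_mpolyZ map_mpolyX gK.
Qed.

Lemma map_mpoly_surj (p : {mpoly k[d]}) : exists F : {mpoly A[d]}, map_mpoly pi F = p.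
Proof.
have /choice[G HG] : forall n : nat, exists F : {mpoly A[d]}, map_mpoly pi F = pihomog mdeg n p.
  by move=> n; have [F _ ?] := map_mpoly_homog_surj (pihomogP mdeg n p); exists F.
exists (\sum_(i < msize p) G i); rewrite raddf_sum /=.
by rewrite [RHS](pihomog_partitionE (mf := mdeg) (leqnn _)); apply: eq_bigr => i _.
Qed.

Lemma fiber_ring_polynomial : exists lam : {rmorphism fiber_ring Q m -> {mpoly k[d]}},
  [/\ bijective lam, forall F, lam (fiber_pi m (rees_lift F)) = map_mpoly pi F,
      forall (n : nat) x, fiber_gr Q m n x <-> lam x \is n.-homog &
      forall n x, fiber_gr Q m (Negz n) x -> x = 0].
Proof.
pose beta0 F : fiber_ring Q m := fiber_pi m (rees_lift F).
have betaB : {morph beta0 : x y / x - y}.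
  by move=> x y; rewrite /beta0 /fiber_pi rmorphB rmorphB.
have betaM : monoid_morphism beta0.
  by split=> [|x y]; rewrite /beta0 /fiber_pi ?rmorph1 ?rmorphM ?rmorph1 ?rmorphM.
pose beta : {rmorphism {mpoly A[d]} -> fiber_ring Q m} := HB.pack beta0
  (GRing.isZmodMorphism.Build _ _ beta0 betaB) (GRing.isMonoidMorphism.Build _ _ beta0 betaM).
have beta_surj x : exists F, beta F = x.
  have [F HF] := rees_lift_surj (repr x); exists F.
  by rewrite /= /beta0 HF /fiber_pi reprK.
have [|lam lamE] := @rmorphism_factor _ _ _ beta (map_mpoly pi) beta_surj.
  by move=> F /fiber_rees_lift_eq0 /map_mpoly_eq0.
have lam_inj : injective lam.
  move=> x y xy; apply/eqP; rewrite -subr_eq0; apply/eqP.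
  have [F FE] := beta_surj (x - y); rewrite -FE; apply/fiber_rees_lift_eq0.
  by apply/map_mpoly_eq0; rewrite -lamE FE rmorphB xy subrr.
have lam_surj p : exists x, lam x = p.
  by have [F <-] := map_mpoly_surj p; exists (beta F).
have [g gK] := choice lam_surj.
exists lam; split=> //.
- by exists g => // x; apply: lam_inj; rewrite gK.
- move=> n x; split=> [[t tn <-]|lamn].
    have [F Fn <-] := rees_lift_homog tn; rewrite -/(beta0 F) -[beta0 F]/(beta F) lamE.
    apply/dhomogP => u; rewrite mcoeff_msupp mcoeff_map_mpoly => Fu.
    apply: (dhomogP _ _ _ Fn); rewrite mcoeff_msupp.
    by apply: contra Fu => /eqP->; rewrite raddf0.
  have [F Fn FE] := map_mpoly_homog_surj lamn; exists (rees_lift F).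
    move=> i /=; rewrite (rees_eval_homog Fn) coefZ coefXn.
    by have [->|_] := eqVneq i n; rewrite ?mulr0 ?eqxx.
  by apply: lam_inj; rewrite -FE; apply: lamE.
- move=> n _ [t tn <-]; suff -> : t = 0 by apply: fiber_pi0.
  apply: val_inj; apply/polyP => i; rewrite coef0; apply/eqP.
  by apply: contraT => /tn.
Qed.

End ReesLift.

(** * Graded modules over graded factorial domains *)

(** The projections onto the homogeneous components are part of the data, as
    the components of an element are computed explicitly in all examples.
    Degrees are natural numbers: B and S vanish in negative degrees. *)
Record grading (V : zmodType) (gr : nat -> set V) (c : nat -> V -> V) : Prop :=
  Grading {
    componentD : forall n, {morph c n : x y / x + y};
    component_gr : forall n x, gr n (c n x);
    component_sum : forall x, exists N, x = \sum_(i < N) c i x /\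
      forall i, (N <= i)%N -> c i x = 0;
    component_id : forall n x, gr n x -> c n x = x;
    component_neq : forall n i x, gr n x -> i != n -> c i x = 0 }.

Section Grading.
Variables (V : zmodType) (gr : nat -> set V) (c : nat -> V -> V).
Hypothesis grV : grading gr c.
Local Notation cD := (componentD grV).

Lemma component0 n : c n 0 = 0.
Proof. by apply: (addrI (c n 0)); rewrite -cD !addr0. Qed.

Lemma componentN n x : c n (- x) = - c n x.
Proof. by apply: (addrI (c n x)); rewrite -cD !subrr component0. Qed.

Lemma component_big n (T : Type) (r : seq T) (P : pred T) (F : T -> V) :
  c n (\sum_(i <- r | P i) F i) = \sum_(i <- r | P i) c n (F i).
Proof. exact: (big_morph _ (cD n) (component0 n)). Qed.

Lemma grD n x y : gr n x -> gr n y -> gr n (x + y).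
Proof.
move=> /(component_id grV) xE /(component_id grV) yE.
by rewrite -xE -yE -cD; apply: (component_gr grV).
Qed.

Lemma gr0 n : gr n 0.
Proof. by rewrite -(component0 n); apply: (component_gr grV). Qed.

Lemma grN n x : gr n x -> gr n (- x).
Proof.
move=> /(component_id grV) xE; rewrite -xE -componentN.
exact: (component_gr grV).
Qed.

Lemma gr_of_components n x : (forall i, i != n -> c i x = 0) -> gr n x.
Proof.
move=> xn; have [N [xE _]] := component_sum grV x; rewrite xE.
elim/big_ind: _ => [||i _]; [exact: gr0|exact: grD|].
have [->|/xn->] := eqVneq (val i) n; [exact: (component_gr grV)|exact: gr0].
Qed.

Lemma component_eq0 x : (forall n, c n x = 0) -> x = 0.
Proof.
by move=> xn; have [N [-> _]] := component_sum grV x; apply: big1 => i _.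
Qed.

End Grading.

Section GradedModule.
Variables (B : comNzRingType) (grB : nat -> set B) (cB : nat -> B -> B).
Hypothesis gradedB : grading grB cB.
Variables (M : lmodType B) (grM : nat -> set M) (cM : nat -> M -> M).
Hypothesis gradedM : grading grM cM.
Hypothesis gr_scale : forall i j b x, grB i b -> grM j x -> grM (i + j)%N (b *: x).

Lemma component_scale_gr n p b x : grM p x ->
  cM n (b *: x) = if (p <= n)%N then cB (n - p) b *: x else 0.
Proof.
move=> xp; have [N [bE b0]] := component_sum gradedB b.
rewrite {1}bE scaler_suml (component_big gradedM).
have term i : cM n (cB i b *: x) = if (i + p)%N == n then cB i b *: x else 0.
  have := gr_scale (component_gr gradedB i b) xp => h.
  case: eqP => [<-|/eqP ne]; first exact: (component_id gradedM).
  by apply: (component_neq gradedM h); rewrite eq_sym.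
under eq_bigr do rewrite term.
case: leqP => pn; last first.
  apply: big1 => i _; case: eqP => // ipn; move: pn.
  by rewrite -ipn ltnNge leq_addl.
have [nN|Nn] := ltnP (n - p) N; last first.
  rewrite b0 // scale0r; apply: big1 => i _; case: eqP => // ipn; move: Nn.
  by rewrite -ipn addnK leqNgt ltn_ord.
rewrite (bigD1 (Ordinal nN)) //= subnK // eqxx big1 ?addr0 // => i.
rewrite -val_eqE /= => /negP iN; case: eqP => // ipn; case: iN.
by rewrite -ipn addnK.
Qed.

Lemma component_scale n b x :
  cM n (b *: x) = \sum_(i < n.+1) cB (n - i) b *: cM i x.
Proof.
have [N [xE x0]] := component_sum gradedM x.
rewrite {1}xE scaler_sumr (component_big gradedM).
under eq_bigr => i _ do rewrite (component_scale_gr n b (component_gr gradedM i x)).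
rewrite -(big_mkord xpredT (fun i => if (i <= n)%N then cB (n - i) b *: cM i x else 0)).
rewrite -(big_mkord xpredT (fun i => cB (n - i) b *: cM i x)).
rewrite [LHS](big_nat_widen _ _ (N + n.+1)) ?leq_addr //.
rewrite [RHS](big_nat_widen _ _ (N + n.+1)) ?leq_addl //.
rewrite big_mkcond [RHS]big_mkcond /=; apply: eq_bigr => i _.
rewrite ltnS; case: ltnP => // /x0->.
by rewrite scaler0; case: (_ <= _)%N.
Qed.

Lemma component_gr_scale n p b x : grB p b ->
  cM n (b *: x) = if (p <= n)%N then b *: cM (n - p) x else 0.
Proof.
move=> bp; rewrite component_scale.
case: leqP => pn; last first.
  apply: big1 => i _; rewrite (component_neq gradedB bp) ?scale0r //.
  by rewrite neq_ltn (leq_ltn_trans _ pn) ?leq_subr.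
have lt : (n - p < n.+1)%N by rewrite ltnS leq_subr.
rewrite (bigD1 (Ordinal lt)) //= subKn // (component_id gradedB bp).
rewrite big1 ?addr0 // => i; rewrite -val_eqE /= => ine.
rewrite (component_neq gradedB bp) ?scale0r //; apply: contra ine => /eqP <-.
by rewrite subKn // -ltnS.
Qed.

Variable N : B -> nat.
Hypothesis N_top : forall x, x != 0 -> cB (N x) x != 0.
Hypothesis N_max : forall x i, (N x < i)%N -> cB i x = 0.

Lemma top_component (x : M) : x != 0 ->
  exists n, cM n x != 0 /\ forall j, (n < j)%N -> cM j x = 0.
Proof.
move=> x0; have [K [xE xK]] := component_sum gradedM x.
have exP : exists i, cM i x != 0.
  apply: contrapT => no; move/eqP: x0; apply; apply: (component_eq0 gradedM) => n.
  by apply/eqP; apply: contrapT => /negP nx; apply: no; exists n.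
have bound i : cM i x != 0 -> (i <= K)%N.
  by apply: contraNT; rewrite -ltnNge => /ltnW/xK->.
have [n nx nmax] := ex_maxnP exP bound; exists n; split=> // j nj.
by apply/eqP; apply: contraLR nj => /nmax; rewrite -leqNgt.
Qed.

(** Compare the components of highest degree. *)
Lemma graded_torsion_free :
  (forall i j b x, grB i b -> grM j x -> b *: x = 0 -> b = 0 \/ x = 0) ->
  forall (b : B) (x : M), b *: x = 0 -> b = 0 \/ x = 0.
Proof.
move=> hom b x bx; have [->|b0] := eqVneq b 0; first by left.
have [->|x0] := eqVneq x 0; first by right.
have [n [xn nmax]] := top_component x0.
have := component_scale (N b + n) b x; rewrite bx (component0 gradedM).
have lt : (n < (N b + n).+1)%N by rewrite ltnS leq_addl.
rewrite (bigD1 (Ordinal lt)) //= addnK big1 ?addr0 => [/esym|l]; last first.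
  rewrite -val_eqE /= neq_ltn => /orP[ln|/nmax->]; last by rewrite scaler0.
  have lbn : (l <= N b + n)%N by rewrite -ltnS ltn_ord.
  by rewrite N_max ?scale0r // -(ltn_add2r l) subnK // ltn_add2l.
case/(hom _ _ _ _ (component_gr gradedB _ _) (component_gr gradedM _ _)) => /eqP.
  by rewrite (negbTE (N_top b0)).
by rewrite (negbTE xn).
Qed.

End GradedModule.

Section GradedDomain.
Variables (B : comNzRingType) (grB : nat -> set B) (cB : nat -> B -> B).
Variable N : B -> nat.
Hypothesis gradedB : grading grB cB.
Hypothesis gr_mul : forall i j b x, grB i b -> grB j x -> grB (i + j)%N (b * x).
Hypothesis domainB : forall x y : B, x * y = 0 -> x = 0 \/ y = 0.
Hypothesis N_norm : additive_norm N.
Hypothesis N_gr : forall n x, x != 0 -> grB n x -> N x = n.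
Hypothesis N_top : forall x, x != 0 -> cB (N x) x != 0.
Hypothesis N_max : forall x i, (N x < i)%N -> cB i x = 0.
Hypothesis B_prime : irreducibles_prime B.
Implicit Types (x y u v f g h p : B).

Lemma domain_mulf x y : x != 0 -> y != 0 -> x * y != 0.
Proof.
by move=> x0 y0; apply/eqP => /domainB[xy|xy]; [move: x0|move: y0]; rewrite xy eqxx.
Qed.

Lemma domain_mulfI x y z : x != 0 -> x * y = x * z -> y = z.
Proof.
move=> x0 /eqP; rewrite -subr_eq0 -mulrBr => /eqP/domainB[xE|/eqP].
  by rewrite xE eqxx in x0.
by rewrite subr_eq0 => /eqP.
Qed.

Let gr_regular i j b (x : B^o) : grB i b -> grB j x -> grB (i + j)%N (b *: x).
Proof. exact: gr_mul. Qed.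

Lemma component_mul n u v : cB n (u * v) = \sum_(i < n.+1) cB (n - i) u * cB i v.
Proof. exact: (component_scale gradedB (M := B^o) gradedB gr_regular). Qed.

Lemma lowest_component u : u != 0 ->
  exists i, cB i u != 0 /\ forall j, (j < i)%N -> cB j u = 0.
Proof.
move=> u0; have exP : exists i, cB i u != 0 by exists (N u); apply: N_top.
exists (ex_minn exP); case: ex_minnP => i ui imin; split=> // j ji.
by apply/eqP; apply: contraLR ji => /imin; rewrite -leqNgt.
Qed.

(** In a product the lowest components multiply to a nonzero element, and so do
    the highest ones; both have degree n, so u has only one component. *)
Lemma divisor_homogeneous n u v : u * v != 0 -> grB n (u * v) ->
  exists i, grB i u.
Proof.
move=> uv0 uvn.
have u0 : u != 0 by apply: contraNneq uv0 => ->; rewrite mul0r.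
have v0 : v != 0 by apply: contraNneq uv0 => ->; rewrite mulr0.
have [i [ui imin]] := lowest_component u0.
have [j [vj jmin]] := lowest_component v0.
have cij : cB (i + j) (u * v) != 0.
  have lt : (j < (i + j).+1)%N by rewrite ltnS leq_addl.
  rewrite component_mul (bigD1 (Ordinal lt)) //= addnK.
  rewrite big1 ?addr0 => [|l]; first exact: domain_mulf.
  rewrite -val_eqE /= neq_ltn => /orP[/jmin->|jl]; first by rewrite mulr0.
  rewrite imin ?mul0r //.
  have lij : (l <= i + j)%N by rewrite -ltnS ltn_ord.
  by rewrite -(ltn_add2r l) subnK // ltn_add2l.
have ijn : (i + j)%N = n.
  by apply/eqP; apply: contraNT cij => /(component_neq gradedB uvn)->.
have uvN : N (u * v) = n := N_gr uv0 uvn.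
have iN : (i <= N u)%N by rewrite leqNgt; apply: contra ui => /N_max->.
have jN : (j <= N v)%N by rewrite leqNgt; apply: contra vj => /N_max->.
have iE : i = N u.
  apply/eqP; rewrite eqn_leq iN /= -(leq_add2r j) ijn -uvN N_norm.1 //.
  by rewrite leq_add2l.
exists i; apply: (gr_of_components gradedB) => l; rewrite neq_ltn => /orP[/imin//|].
by rewrite iE => /N_max.
Qed.

Definition coprime_elt f g := forall p, irreducible_elt p -> divides p f -> ~ divides p g.

Lemma irreducible_divides p q : irreducible_elt p -> irreducible_elt q ->
  divides p q -> divides q p.
Proof.
move=> [p0 pu _] [_ _ qM] [r qE]; have [[w wr]|//] := qM _ _ qE.
by exists w; rewrite qE mulrA wr mul1r.
Qed.

(** Cancel the prime factors of f one at a time. *)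
Lemma coprime_divides f g y : f != 0 -> coprime_elt f g ->
  divides f (g * y) -> divides f y.
Proof.
have [n] := ubnP (N f); elim: n f y => // n IH f y Nf f0 fg [q gyE].
case: (EM (invertible f)) => fu; first exact: divides_invertible.
have [p pirr [f' fE]] := irreducible_factor N_norm f0 fu.
have [p0 pu _] := pirr.
have f'0 : f' != 0 by apply: contraNneq f0 => f'0; rewrite fE f'0 mul0r.
have [/(fg _ pirr)[]|[y' yE]] : divides p g \/ divides p y.
- by apply: (B_prime pirr); exists (q * f'); rewrite gyE fE mulrA.
- by exists f'.
have [|||r y'E] := IH f' y' _ f'0.
- rewrite (leq_trans _ (_ : N f <= n)%N) //.
  rewrite fE N_norm.1 // -{1}[N f']addn0 ltn_add2l lt0n.
  by apply/eqP => /(N_norm.2 p p0).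
- by move=> r rirr rf'; apply: fg => //; rewrite fE mulrC; apply: dividesMl.
- exists q; apply: (domain_mulfI p0).
  by move: gyE; rewrite yE fE => gyE; rewrite [p * _]mulrC -mulrA gyE; ring.
by exists r; rewrite yE y'E fE mulrA.
Qed.

Lemma prime_divides_exp p f n : irreducible_elt p -> divides p (f ^+ n) -> divides p f.
Proof.
move=> pirr; elim: n => [[q]|n IH].
  by have [_ pu _] := pirr; move=> qp; case: pu; exists q; rewrite -qp expr0.
by rewrite exprS => /(B_prime pirr)[|/IH].
Qed.

Lemma coprime_exp f g n l : coprime_elt f g -> coprime_elt (f ^+ n) (g ^+ l).
Proof.
move=> fg p pirr /(prime_divides_exp pirr) pf /(prime_divides_exp pirr).
exact: fg.
Qed.

Lemma gr1 : grB 0 1.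
Proof.
have N1 : N 1 = 0%N by apply: (norm_invertible N_norm); exists 1; rewrite mulr1.
by apply: (gr_of_components gradedB) => i i0; apply: N_max; rewrite N1 lt0n.
Qed.

Lemma gr_exp n x l : grB n x -> grB (n * l)%N (x ^+ l).
Proof.
move=> xn; elim: l => [|l IH]; first by rewrite muln0 expr0; apply: gr1.
by rewrite exprS mulnS; apply: gr_mul.
Qed.

Lemma domain_expf_neq0 x l : x != 0 -> x ^+ l != 0.
Proof.
by move=> x0; elim: l => [|l IH]; rewrite ?expr0 ?oner_neq0 // exprS domain_mulf.
Qed.

Section Ideal.
Variable J : set B.
Hypothesis J_ideal : is_ideal J.
Hypothesis J_components : forall n x, J x -> J (cB n x).
Hypothesis J_neq0 : exists2 x, J x & x != 0.
Hypothesis J_divisor : forall g, (forall x, J x -> divides g x) -> invertible g.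

Lemma homogeneous_not_divisible p : irreducible_elt p ->
  exists n x, [/\ J x, grB n x & ~ divides p x].
Proof.
move=> [_ pu _]; apply: contrapT => no; apply/pu/J_divisor => x Jx.
have [K [-> _]] := component_sum gradedB x.
elim/big_ind: _ => [||i _]; [by exists 0; rewrite mul0r|exact: dividesD|].
apply: contrapT => pi; apply: no; exists i, (cB i x).
by split; [exact: J_components|exact: component_gr gradedB _ _|].
Qed.

Hypothesis J_proper : ~ J 1.

Lemma proper_degree n x : J x -> x != 0 -> grB n x -> (0 < n)%N.
Proof.
move=> Jx x0 xn; rewrite lt0n; apply/eqP => n0; apply: J_proper.
have [] := N_norm.2 x x0; first by rewrite (N_gr x0 xn).
by move=> u <-; apply: idealM.
Qed.

(** Prime avoidance by induction on the degree of h = h' p with p prime.  Let g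
    be coprime to h' and divisible by p, and let g' in J be prime to p.  Then
    g is prime to all factors of h' but not to p, and g' h' the other way
    round, so a sum of powers of the two is prime to h.  Homogeneity asks for
    equal degrees, which the exponents provide; this needs h' homogeneous, see
    [divisor_homogeneous]. *)
Lemma homogeneous_coprime n h : h != 0 -> grB n h ->
  exists l g, [/\ J g, g != 0, grB l g & coprime_elt h g].
Proof.
have [K] := ubnP (N h); elim: K n h => // K IH n h NK h0 hn.
case: (EM (invertible h)) => hu.
  have [x Jx x0] := J_neq0; exists (N x), (cB (N x) x).
  split; [exact: J_components|exact: N_top|exact: component_gr gradedB _ _|].
  by move=> p [_ pu _] [q hE]; case: pu; move: hu; rewrite hE; apply: invertible_Mr.
have [p pirr [h' hE]] := irreducible_factor N_norm h0 hu.
have [p0 pu _] := pirr.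
have h'0 : h' != 0 by apply: contraNneq h0 => h'0; rewrite hE h'0 mul0r.
have [n' h'n] : exists i, grB i h'.
  by apply: (@divisor_homogeneous n h' p); rewrite -hE.
have [l [g [Jg g0 gl h'g]]] : exists l g, [/\ J g, g != 0, grB l g & coprime_elt h' g].
  apply: IH h'n => //; rewrite (leq_trans _ (_ : N h <= K)%N) //.
  rewrite hE N_norm.1 // -{1}[N h']addn0 ltn_add2l lt0n.
  by apply/eqP => /(N_norm.2 p p0).
have split_prime r : irreducible_elt r -> divides r h -> divides r h' \/ divides p r.
  move=> rirr; rewrite hE => /(B_prime rirr)[|rp]; [by left|right].
  exact: irreducible_divides.
case: (EM (divides p g)) => pg; last first.
  exists l, g; split=> // r rirr /(split_prime r rirr)[|pr rg]; first exact: h'g.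
  by apply/pg/(divides_trans pr).
have [l' [g' [Jg' g'l pg']]] := homogeneous_not_divisible pirr.
have g'0 : g' != 0 by apply/eqP => g'0; apply: pg'; rewrite g'0; exists 0; rewrite mul0r.
pose u := g' * h'; have ul : grB (l' + n')%N u by apply: gr_mul.
have Ju : J u by apply: idealMr_set.
have u0 : u != 0 by apply: domain_mulf.
have l0 := proper_degree Jg g0 gl; have ul0 := proper_degree Ju u0 ul.
have pu' : ~ divides p u.
  move=> /(B_prime pirr)[//|ph']; exact: (h'g p).
(* degrees: g has degree l, and u = g' h' has degree l' + n' *)
pose w := g ^+ (l' + n') + u ^+ l.
have wcop : coprime_elt h w.
  move=> r rirr rh [q wE].
  have sum a c : w = a + c -> divides r a -> divides r c.
    move=> wac [s aE]; exists (q - s); rewrite mulrBl -wE wac aE; ring.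
  have divX s x : (0 < s)%N -> divides r x -> divides r (x ^+ s).
    by case: s => // s _ rx; rewrite exprSr; apply: dividesMl.
  have [rh'|pr] := split_prime r rirr rh.
    have ru : divides r u by apply: dividesMl.
    apply: (h'g r) => //; apply: (prime_divides_exp rirr (n := (l' + n')%N)).
    by apply: (sum (u ^+ l)); [rewrite /w addrC|exact: divX].
  have rp : divides r p by apply: irreducible_divides.
  apply: pu'; apply: (divides_trans pr); apply: (prime_divides_exp rirr (n := l)).
  apply: (sum (g ^+ (l' + n'))) => //; apply: divX => //.
  exact: divides_trans rp pg.
exists (l * (l' + n'))%N, w; split=> //.
- apply: idealD => //; last by rewrite -(prednK l0) exprS; apply: idealMr_set.
  by rewrite -(prednK ul0) exprS; apply: idealMr_set.
- apply/eqP => w0; apply: (wcop p) => //; first by rewrite hE; exists h'.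
  by rewrite w0; exists 0; rewrite mul0r.
apply: (grD gradedB); first exact: gr_exp.
by rewrite mulnC; apply: gr_exp.
Qed.

(** Passing to powers equalizes the degrees of two coprime forms. *)
Lemma coprime_pair n f : J f -> f != 0 -> grB n f ->
  exists q a, exists2 g, [/\ J (f ^+ a), J g & coprime_elt (f ^+ a) g] &
    [/\ (n <= q)%N, (0 < q)%N, grB q (f ^+ a) & grB q g].
Proof.
move=> Jf f0 fn; have [l [g [Jg g0 gl fg]]] := homogeneous_coprime f0 fn.
have l0 := proper_degree Jg g0 gl; have n0 := proper_degree Jf f0 fn.
exists (n * l)%N, l, (g ^+ n); split.
- by rewrite -(prednK l0) exprS; apply: idealMr_set.
- by rewrite -(prednK n0) exprS; apply: idealMr_set.
- exact: coprime_exp.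
- by rewrite leq_pmulr.
- by rewrite muln_gt0 n0.
- exact: gr_exp.
- by rewrite mulnC; apply: gr_exp.
Qed.

End Ideal.

(** An element h of least degree in P is irreducible, hence prime, and 0 < (h) < P
    is a chain of primes: (h) = P would make h a common divisor of J. *)
Lemma divisor_free_height J : (exists2 x, J x & x != 0) ->
  (forall g, (forall x, J x -> divides g x) -> invertible g) -> height_ge 2 J.
Proof.
move=> [x0 Jx0 x0n] Jdiv P Pprime JP; have [Pid P1 PM] := Pprime.
pose Z n := `[< exists x, [/\ P x, x != 0 & N x = n] >].
have exZ : exists n, Z n.
  by exists (N x0); apply/asboolP; exists x0; split=> //; apply: JP.
have [n /asboolP[h [Ph h0 hn]] nmin] := ex_minnP exZ.
have hirr : irreducible_elt h.
  split=> // [[u uh]|u v hE]; first by apply: P1; rewrite -uh; apply: idealM.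
  have u0 : u != 0 by apply: contraNneq h0 => u0; rewrite hE u0 mul0r.
  have v0 : v != 0 by apply: contraNneq h0 => v0; rewrite hE v0 mulr0.
  have NE : N h = (N u + N v)%N by rewrite hE N_norm.1.
  (* the factor in P has at least the degree of h, so the other has degree 0 *)
  move: Ph; rewrite hE => /PM[Pu|Pv]; [right|left].
    apply: N_norm.2 => //; apply/eqP; rewrite -leqn0 -(leq_add2l (N u)) addn0 -NE hn.
    by apply: nmin; apply/asboolP; exists u.
  apply: N_norm.2 => //; apply/eqP; rewrite -leqn0 -(leq_add2r (N v)) add0n -NE hn.
  by apply: nmin; apply/asboolP; exists v.
have hprime : prime_ideal [set x | divides h x].
  split; last exact: B_prime.
  - split=> [|x y|r x]; [by exists 0; rewrite mul0r|exact: dividesD|exact: dividesMl].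
  - by move=> [q hq]; have [_ + _] := hirr; apply; exists q.
have zprime := zero_prime domainB.
have hP : [set x | divides h x] `<=` P by move=> _ [q ->]; apply: idealM.
exists (fun i => if i is i'.+1 then if i' is _.+1 then P else [set x | divides h x]
                 else [set 0]); split=> //.
- by case=> [|[|i]].
case=> [|[|i]] // _; split.
- by move=> _ ->; exists 0; rewrite mul0r.
- move=> /(_ h) /= hz; move/eqP: h0; apply; apply: hz.
  by exists 1; rewrite mul1r.
- exact: hP.
- move=> Ph'; have [_ hu _] := hirr; apply/hu/Jdiv => x Jx.
  by apply: Ph'; apply: JP.
Qed.

End GradedDomain.

(** * Graded modules of rank one *)

Section RankOne.
Variables (B : comNzRingType) (grB : nat -> set B) (cB : nat -> B -> B).
Variable N : B -> nat.
Hypothesis gradedB : grading grB cB.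
Hypothesis gr_mul : forall i j b x, grB i b -> grB j x -> grB (i + j)%N (b * x).
Hypothesis domainB : forall x y : B, x * y = 0 -> x = 0 \/ y = 0.
Hypothesis N_norm : additive_norm N.
Hypothesis N_gr : forall n x, x != 0 -> grB n x -> N x = n.
Hypothesis N_top : forall x, x != 0 -> cB (N x) x != 0.
Variables (M : lmodType B) (grM : nat -> set M) (cM : nat -> M -> M).
Hypothesis gradedM : grading grM cM.
Hypothesis gr_scale : forall i j (b : B) (x : M),
  grB i b -> grM j x -> grM (i + j)%N (b *: x).
Hypothesis torsion_free : forall (b : B) (x : M), b *: x = 0 -> b = 0 \/ x = 0.
Variable s0 : M.
Hypothesis s0_neq0 : s0 != 0.
Hypothesis s0_gr : grM 1 s0.
Hypothesis rank_one : forall s : M, exists b c : B, c != 0 /\ c *: s = b *: s0.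
Hypothesis fin_gen : exists gs : seq M, forall P : set M,
  P 0 -> (forall s t, P s -> P t -> P (s + t)) ->
  (forall (b : B) s, P s -> P (b *: s)) ->
  (forall g, g \in gs -> P g) -> forall s, P s.

Definition denominator (C : B) := C != 0 /\ forall s, exists b, C *: s = b *: s0.

Lemma scale_inj (x : M) (b c : B) : x != 0 -> b *: x = c *: x -> b = c.
Proof.
move=> x0 /eqP; rewrite -subr_eq0 -scalerBl => /eqP/torsion_free[/eqP|xE].
  by rewrite subr_eq0 => /eqP.
by rewrite xE eqxx in x0.
Qed.

Lemma exists_denominator : exists C, denominator C.
Proof.
have [gs gsP] := fin_gen.
have [C [C0 HC]] : exists C, C != 0 /\
    forall g, g \in gs -> exists b, C *: g = b *: s0.
  elim: gs {gsP} => [|g gs [C [C0 HC]]]; first by exists 1; split=> //; exact: oner_neq0.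
  have [b [c [c0 cg]]] := rank_one g.
  exists (C * c); split; first exact: (domain_mulf domainB).
  move=> h; rewrite inE => /orP[/eqP->|/HC[b' Cg]].
    by exists (C * b); rewrite -scalerA cg scalerA.
  by exists (c * b'); rewrite mulrC -scalerA Cg scalerA.
exists C; split=> //; apply: (gsP [set s | exists b, C *: s = b *: s0]) => //=.
- by exists 0; rewrite scaler0 scale0r.
- by move=> s t [b Cs] [c Ct]; exists (b + c); rewrite scalerDr scalerDl Cs Ct.
- by move=> c s [b Cs]; exists (c * b); rewrite scalerA mulrC -scalerA Cs scalerA.
Qed.

Lemma denominator_top C : denominator C -> denominator (cB (N C) C).
Proof.
move=> [C0 HC]; split; first exact: N_top.
have hom n s : grM n s -> exists b, cB (N C) C *: s = b *: s0.
  move=> sn; have [b Cs] := HC s.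
  have := component_scale_gr gradedB gradedM gr_scale (n + N C)%N C sn.
  rewrite leq_addr addKn Cs => <-.
  have := component_scale_gr gradedB gradedM gr_scale (n + N C)%N b s0_gr => ->.
  case: ifP => _; last by exists 0; rewrite scale0r.
  by exists (cB (n + N C - 1) b).
move=> s; have [K [-> _]] := component_sum gradedM s.
rewrite scaler_sumr; elim/big_ind: _ => [|x y [b ->] [c ->]|i _].
- by exists 0; rewrite scale0r.
- by exists (b + c); rewrite scalerDl.
- by apply: hom; apply: (component_gr gradedM).
Qed.

(** Take C homogeneous of least degree p among the denominators, and let f s
    be C s / s0.  As s0 has degree 1, f raises degrees by p - 1, which the
    equation i + 1 = n + p expresses without subtraction.  If g divides the
    whole image, it divides C = f s0, and C / g is again a denominator; so g
    has degree 0. *)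
Theorem rank_one_embedding :
  exists p (C : B) (f : M -> B),
    [/\ C != 0, grB p C, f s0 = C, injective f &
        [/\ forall (b : B) s t, f (b *: s + t) = b * f s + f t,
          forall n i s, i.+1 = (n + p)%N -> grM n s <-> grB i (f s),
          forall n x, range f x -> range f (cB n x),
          forall i s, (i.+1 < p)%N -> cB i (f s) = 0 &
          forall g, (forall x, range f x -> divides g x) -> invertible g]].
Proof.
pose D n := `[< exists C, denominator C /\ N C = n >].
have exD : exists n, D n.
  by have [C HC] := exists_denominator; exists (N C); apply/asboolP; exists C.
have [p /asboolP[C' [HC' NC']] pmin] := ex_minnP exD.
pose C := cB (N C') C'.
have [C0 HC] : denominator C := denominator_top HC'.
have Cp : grB p C by rewrite -NC'; apply: (component_gr gradedB).
have NC : N C = p := N_gr C0 Cp.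
have [f fP] := choice HC.
have fE s b : C *: s = b *: s0 -> f s = b.
  by rewrite fP; apply: scale_inj.
have fs0 : f s0 = C by apply: fE.
have finj : injective f.
  move=> s t fst; apply/eqP; rewrite -subr_eq0; apply/eqP.
  have [/eqP|//] : C = 0 \/ s - t = 0.
    by apply: torsion_free; rewrite scalerBr !fP fst subrr.
  by rewrite (negbTE C0).
have flin (b : B) s t : f (b *: s + t) = b * f s + f t.
  by apply: fE; rewrite scalerDr scalerDl -fP -scalerA -fP !scalerA mulrC.
have f0 : f 0 = 0 by apply: fE; rewrite scaler0 scale0r.
have fcomp n i s : i.+1 = (n + p)%N -> f (cM n s) = cB i (f s).
  move=> inp; apply: fE.
  have := component_gr_scale gradedB gradedM gr_scale (n + p)%N s Cp.
  rewrite leq_addl addnK => <-; rewrite fP.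
  rewrite (component_scale_gr gradedB gradedM gr_scale _ _ s0_gr) -inp ltn0Sn.
  by rewrite subn1.
have flow i s : (i.+1 < p)%N -> cB i (f s) = 0.
  move=> ip.
  have := component_gr_scale gradedB gradedM gr_scale i.+1 s Cp.
  rewrite leqNgt ip fP (component_scale_gr gradedB gradedM gr_scale _ _ s0_gr) ltn0Sn.
rewrite subn1 /= => /torsion_free[//|/eqP].
  by rewrite (negbTE s0_neq0).
have deg i : (p <= i.+1)%N -> i.+1 = ((i.+1 - p) + p)%N by move=> pi; rewrite subnK.
exists p, C, f; split=> //; split=> //.
- move=> n i s inp; split=> [sn|fsi].
    rewrite -(component_id gradedM sn) (fcomp n i) //; exact: (component_gr gradedB).
  apply: (gr_of_components gradedM) => j jn; apply: finj; rewrite f0.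
  have [jp0|] := eqVneq (j + p)%N 0%N.
    have /eqP := jp0; rewrite addn_eq0 => /andP[/eqP j0 /eqP p0].
    have := component_gr_scale gradedB gradedM gr_scale 0%N s Cp.
    rewrite p0 leq0n subn0 fP (component_scale_gr gradedB gradedM gr_scale _ _ s0_gr) /=.
    move=> /esym/torsion_free[/eqP|]; first by rewrite (negbTE C0).
    by rewrite j0 => ->.
  rewrite -lt0n => jp; rewrite (fcomp j (j + p).-1) ?prednK //.
  apply: (component_neq gradedB fsi); apply: contra jn => /eqP E.
  by rewrite -(eqn_add2r p) -inp -E prednK.
- move=> i _ [s _ <-]; have [pi|ip] := leqP p i.+1.
    by exists (cM (i.+1 - p) s) => //; apply: fcomp; apply: deg.
  by exists 0 => //; rewrite f0 flow.
- move=> g gdiv; have [q CE] : divides g C by apply: gdiv; exists s0.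
  have g0 : g != 0 by apply: contraNneq C0 => g0; rewrite CE g0 mulr0.
  have q0 : q != 0 by apply: contraNneq C0 => q0; rewrite CE q0 mul0r.
  have /pmin : D (N q).
    apply/asboolP; exists q; split=> //; split=> // s.
    have [b fb] : divides g (f s) by apply: gdiv; exists s.
    exists b; have := fP s; rewrite CE fb [q * g]mulrC [b * g]mulrC -!scalerA.
    move/eqP; rewrite -subr_eq0 -scalerBr => /eqP/torsion_free[/eqP|/eqP].
      by rewrite (negbTE g0).
    by rewrite subr_eq0 => /eqP.
  rewrite -NC CE N_norm.1 // -{2}[N q]addn0 leq_add2l leqn0 => /eqP.
  exact: N_norm.2.
Qed.

End RankOne.

(** * Transport along an isomorphism with a polynomial ring *)

Section PolynomialRing.
Variables (k : fieldType) (d : nat) (B : comNzRingType).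
Variable lam : {rmorphism B -> {mpoly k[d]}}.
Hypothesis lam_bij : bijective lam.
Variable grB : nat -> set B.
Implicit Types x y : B.
Hypothesis grB_homog : forall n x, grB n x <-> lam x \is n.-homog.

Definition poly_degree (x : B) : nat := (msize (lam x)).-1.

Lemma lam_eq0 x : (lam x == 0) = (x == 0).
Proof. by rewrite -(rmorph0 lam) (inj_eq (bij_inj lam_bij)). Qed.

Lemma polynomial_domain (x y : B) : x * y = 0 -> x = 0 \/ y = 0.
Proof.
move=> /eqP; rewrite -lam_eq0 rmorphM mulf_eq0 !lam_eq0.
by case/orP => /eqP; [left|right].
Qed.

Lemma polynomial_norm : additive_norm poly_degree.
Proof.
have [ND N0] := mpoly_norm k d; split=> [x y x0 y0|x x0 Nx].
  by rewrite /poly_degree rmorphM ND // lam_eq0.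
have [||p px] := N0 (lam x); rewrite ?lam_eq0 //.
have [g gK Kg] := lam_bij; exists (g p); apply: (bij_inj lam_bij).
by rewrite rmorphM Kg px rmorph1.
Qed.

Lemma polynomial_gr_mul i j x y : grB i x -> grB j y -> grB (i + j)%N (x * y).
Proof. by rewrite !grB_homog rmorphM; apply: dhomogM. Qed.

Lemma polynomial_degree_gr n x : x != 0 -> grB n x -> poly_degree x = n.
Proof.
move=> x0 /grB_homog xn; have lx0 : lam x != 0 by rewrite lam_eq0.
exact: (dhomog_uniq lx0 (dhomog_msize xn) xn).
Qed.

Lemma polynomial_irreducibles_prime : irreducibles_prime B.
Proof. exact: irreducibles_prime_transport lam_bij (mpoly_irreducibles_prime (k := k) (n := d)). Qed.

Lemma polynomial_grading : exists cB, [/\ grading grB cB,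
  forall x, x != 0 -> cB (poly_degree x) x != 0 &
  forall x i, (poly_degree x < i)%N -> cB i x = 0].
Proof.
have [g gK Kg] := lam_bij; have linj := bij_inj lam_bij.
pose cB n x := g (pihomog mdeg n (lam x)).
have cBE n x : lam (cB n x) = pihomog mdeg n (lam x) by rewrite Kg.
have c0 x i : (poly_degree x < i)%N -> cB i x = 0.
  move=> xi; apply: linj; rewrite cBE rmorph0; apply/mpolyP => u.
  rewrite mcoeff_pihomog mcoeff0; case: eqP => // ui.
  apply/memN_msupp_eq0/msize_mdeg_ge; rewrite ui.
  by apply: leq_trans xi; rewrite /poly_degree; case: (msize _).
exists cB; split=> //; last first.
  move=> x x0; rewrite -lam_eq0 cBE; have lx0 : lam x != 0 by rewrite lam_eq0.
  apply/eqP => /(congr1 (mcoeff (mlead (lam x)))); rewrite mcoeff_pihomog mcoeff0.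
  by rewrite /poly_degree -mlead_deg // eqxx => /eqP; rewrite mleadc_eq0 (negbTE lx0).
split.
- by move=> n x y; apply: linj; rewrite rmorphD !cBE rmorphD raddfD.
- by move=> n x; apply/grB_homog; rewrite cBE; apply: pihomogP.
- move=> x; exists (msize (lam x)); split.
    apply: linj; rewrite rmorph_sum [LHS](pihomog_partitionE (mf := mdeg) (leqnn _)).
    by apply: eq_bigr => i _; rewrite /= cBE.
  move=> i; rewrite leq_eqVlt => /orP[/eqP<-|xi].
    apply: linj; rewrite cBE rmorph0; apply/mpolyP => u.
    rewrite mcoeff_pihomog mcoeff0; case: eqP => // ui.
    by apply/memN_msupp_eq0/msize_mdeg_ge; rewrite ui.
  by apply: c0; apply: leq_ltn_trans xi; apply: leq_pred.
- by move=> n x /grB_homog xn; apply: linj; rewrite cBE pihomog_dE.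
- move=> n i x /grB_homog xn ne; apply: linj; rewrite cBE rmorph0.
  by apply: (pihomog_ne0 _ xn); rewrite eq_sym.
Qed.

End PolynomialRing.

(** The quotient by m is a commutative ring without inversion; the inverse is
    chosen. *)
Lemma residue_field (A : comNzRingType) (m : idealr A) :
  (forall x, x \notin m -> invertible x) ->
  exists (k : fieldType) (pi : {rmorphism A -> k}),
    (forall x, exists a, pi a = x) /\ (forall x, pi x = 0 <-> x \in m).
Proof.
move=> minv; pose k0 := {ideal_quot m}.
have pi0 x : (\pi_(k0) x)%qT = 0 <-> x \in m.
  have E : (x - 0 \in m) = ((\pi_(k0) x)%qT == (\pi_(k0) 0)%qT) := Quotient.idealrBE _ _ _.
  rewrite subr0 rmorph0 in E; rewrite E; split=> [->|/eqP//]; exact: eqxx.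
have ex_inv (x : k0) : exists y : k0, (x != 0 -> y * x = 1) /\ (x = 0 -> y = 0).
  have [->|x0] := eqVneq x 0; first by exists 0.
  have xm : repr x \notin m.
    by apply: contra x0 => /pi0; rewrite reprK => ->.
  have [y yx] := minv _ xm; exists (\pi_(k0) y)%qT.
  split=> // [_|x00]; last by rewrite x00 eqxx in x0.
  have : (\pi_(k0) (y * repr x))%qT = 1 by rewrite yx rmorph1.
  by rewrite rmorphM => <-; congr (_ * _); apply/esym/reprK.
have [inv invP] := choice ex_inv.
have mulV (x : k0) : x != 0 -> inv x * x = 1 by case: (invP x).
have inv0 : inv 0 = 0 by case: (invP 0) => _; apply.
pose k : fieldType := HB.pack k0 (GRing.ComNzRing_isField.Build k0 mulV inv0).
pose f (x : A) : k := (\pi_(k0) x)%qT.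
have fB : {morph f : x y / x - y} by move=> x y; rewrite /f rmorphB.
have fM : monoid_morphism f by split=> [|x y]; rewrite /f ?rmorph1 ?rmorphM.
pose pi : {rmorphism A -> k} := HB.pack f
  (GRing.isZmodMorphism.Build _ _ f fB) (GRing.isMonoidMorphism.Build _ _ f fM).
exists k, pi; split; last exact: pi0.
by move=> x; exists (repr (x : k0)); apply: reprK.
Qed.

(** * The Sally module *)

Section SallyModule.
Variables (A : comNzRingType) (Q I : set A) (QI : Q `<=` I).
Hypothesis Q_ideal : is_ideal Q.
Hypothesis I_ideal : is_ideal I.
Local Notation IR := (IR_lmod QI).
Local Notation S := (sally QI).

Definition sally_pi (x : IR) : S := quot_lmod_pi (IT_submod QI) x.
Definition IR_poly (x : IR) : {poly A} := IR_val x.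

Lemma sally_pi_surj (s : S) : exists x, sally_pi x = s.
Proof. by exists (repr (s : {ideal_quot (@IT_pred A Q I QI)})); apply: reprK. Qed.

Lemma sally_piB : {morph sally_pi : x y / x - y}.
Proof. by move=> x y; apply: (raddfB (\pi_({ideal_quot (@IT_pred A Q I QI)}))%qT). Qed.

Lemma sally_piZ (t : rees_ring Q) x : t *: sally_pi x = sally_pi (t *: x).
Proof. exact: quot_lmod_pi_scale. Qed.

Lemma sally_pi_eq0 x : sally_pi x = 0 <-> ext_set I Q (IR_poly x).
Proof.
have E : (x - 0 \in @IT_pred A Q I QI) = (sally_pi x == sally_pi 0).
  exact: Quotient.idealrBE.
have z : sally_pi 0 = 0 by rewrite -[X in sally_pi X](subrr (0 : IR)) sally_piB subrr.
rewrite subr0 z in E; split=> [/eqP|xm]; last by apply/eqP; rewrite -E; apply/asboolP.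
by rewrite -E => /asboolP.
Qed.

Lemma sally_pi0 : sally_pi 0 = 0.
Proof. by rewrite -[X in sally_pi X](subrr (0 : IR)) sally_piB subrr. Qed.

Lemma sally_piD : {morph sally_pi : x y / x + y}.
Proof. by move=> x y; apply: (raddfD (\pi_({ideal_quot (@IT_pred A Q I QI)}))%qT). Qed.

Lemma IR_polyB (x y : IR) : IR_poly (x - y) = IR_poly x - IR_poly y.
Proof. by []. Qed.

Lemma IR_coef (x : IR) n : prod_set I (ideal_pow I n) (IR_poly x)`_n.
Proof.
by case: x => p /= /asboolP /(ext_set_coefP _ I_ideal I_ideal).
Qed.

Definition IR_monomial n (c : A) : IR := insubd (0 : IR) (c *: 'X^n : {poly A}).

Lemma IR_monomialE n c : prod_set I (ideal_pow I n) c ->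
  IR_poly (IR_monomial n c) = c *: 'X^n.
Proof.
move=> Ic; apply: insubdK; rewrite unfold_in; apply/asboolP.
apply/(ext_set_coefP _ I_ideal I_ideal) => i; rewrite coefZ coefXn.
have [->|_] := eqVneq i n; rewrite ?mulr1 // mulr0.
exact: prod_set0.
Qed.

Lemma sally_eq0P x :
  sally_pi x = 0 <-> forall n, prod_set I (ideal_pow Q n) (IR_poly x)`_n.
Proof. by rewrite sally_pi_eq0; apply: ext_set_coefP. Qed.

(** The component of degree n of a chosen representative in I R; the choice is
    immaterial by [sally_component_pi]. *)
Definition sally_component n (s : S) : S :=
  let x := repr (s : {ideal_quot (@IT_pred A Q I QI)}) in
  sally_pi (IR_monomial n (IR_poly x)`_n).

Lemma IR_poly_component n (x : IR) :
  IR_poly (IR_monomial n (IR_poly x)`_n) = (IR_poly x)`_n *: 'X^n.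
Proof. exact/IR_monomialE/IR_coef. Qed.

Lemma sally_component_pi n x :
  sally_component n (sally_pi x) = sally_pi (IR_monomial n (IR_poly x)`_n).
Proof.
rewrite /sally_component; set y := repr _.
have xy : sally_pi (y - x) = 0.
  by rewrite sally_piB [sally_pi y]reprK subrr.
apply/eqP; rewrite -subr_eq0 -sally_piB; apply/eqP/sally_eq0P => i.
rewrite IR_polyB !IR_poly_component coefB !coefZ -mulrBl -coefB coefXn.
have [->|_] := eqVneq i n; rewrite ?mulr1; first by have /sally_eq0P := xy.
by rewrite mulr0; exact: prod_set0.
Qed.

Lemma sally_gr_monomial n c : prod_set I (ideal_pow I n) c ->
  sally_gr QI n (sally_pi (IR_monomial n c)).
Proof.
move=> Ic; exists (IR_monomial n c) => //= i.
rewrite -[IR_val _]/(IR_poly _) IR_monomialE // coefZ coefXn.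
by have [->|_] := eqVneq i n; rewrite ?mulr0 ?eqxx.
Qed.

Lemma sally_grP (n : nat) s : sally_gr QI n s ->
  exists2 c, prod_set I (ideal_pow I n) c & s = sally_pi (IR_monomial n c).
Proof.
move=> [x xn <-]; exists (IR_poly x)`_n; first exact: IR_coef.
apply/eqP; rewrite -subr_eq0 -[quot_lmod_pi _ _]/(sally_pi x) -sally_piB.
apply/eqP/sally_eq0P => i; rewrite IR_polyB IR_poly_component coefB coefZ coefXn.
have [->|ne] := eqVneq i n.
  by rewrite mulr1 subrr; exact: prod_set0.
rewrite mulr0 subr0 (_ : _`_i = 0); first exact: prod_set0.
apply/eqP; apply: contraNT ne => /(xn i)/eqP.
by rewrite eqz_nat.
Qed.

Lemma sally_gr_negative n s : sally_gr QI (Negz n) s -> s = 0.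
Proof.
move=> [x xn <-]; apply/sally_eq0P => i.
rewrite (_ : _`_i = 0); first exact: prod_set0.
by apply/eqP; apply: contraT => /(xn i).
Qed.

(** Both I R and I T have degree-zero component I. *)
Lemma sally_gr_zero s : sally_gr QI 0%N s -> s = 0.
Proof.
move=> /sally_grP[c Ic ->]; apply/sally_eq0P => i; rewrite IR_monomialE //.
rewrite coefZ coefXn; case: i => [|i]; rewrite ?mulr1 // mulr0.
exact: prod_set0.
Qed.

Lemma sally_monomial_eq0 n c : prod_set I (ideal_pow I n) c ->
  sally_pi (IR_monomial n c) = 0 <-> prod_set I (ideal_pow Q n) c.
Proof.
move=> Ic; rewrite sally_eq0P; split=> [/(_ n)|Hc i]; rewrite IR_monomialE // coefZ coefXn.
  by rewrite eqxx mulr1.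
have [->|_] := eqVneq i n; rewrite ?mulr1 // mulr0.
exact: prod_set0.
Qed.

Lemma sally_grading : grading (fun n : nat => sally_gr QI n) sally_component.
Proof.
split.
- move=> n s t; have [x <-] := sally_pi_surj s; have [y <-] := sally_pi_surj t.
  rewrite -sally_piD !sally_component_pi -sally_piD; congr sally_pi.
  apply: val_inj; rewrite -[LHS]/(IR_poly _) -[RHS]/(IR_poly _ + IR_poly _).
  by rewrite !IR_poly_component -[IR_poly (x + y)]/(IR_poly x + IR_poly y) coefD scalerDl.
- move=> n s; have [x <-] := sally_pi_surj s; rewrite sally_component_pi.
  exact/sally_gr_monomial/IR_coef.
- move=> s; have [x <-] := sally_pi_surj s; exists (size (IR_poly x)); split.
    under eq_bigr do rewrite sally_component_pi.
    rewrite -(big_morph _ sally_piD sally_pi0); congr sally_pi; apply: val_inj.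
    rewrite raddf_sum /= -[LHS]coefK poly_def; apply: eq_bigr => i _.
    by rewrite -[RHS]/(IR_poly _) IR_poly_component.
  move=> i xi; rewrite sally_component_pi nth_default //.
  apply/sally_monomial_eq0; exact: prod_set0.
- move=> n s /sally_grP[c Ic ->]; rewrite sally_component_pi IR_monomialE //.
  by rewrite coefZ coefXn eqxx mulr1.
- move=> n i s /sally_grP[c Ic ->] /negbTE ne; rewrite sally_component_pi IR_monomialE //.
  rewrite coefZ coefXn ne mulr0.
  apply/sally_monomial_eq0; exact: prod_set0.
Qed.

End SallyModule.

Section SallyStructure.
Variables (A : comNzRingType) (Q I : set A) (QI : Q `<=` I).
Hypothesis I_ideal : is_ideal I.
Local Notation mono := (@IR_monomial A Q I QI).
Local Notation spi := (@sally_pi A Q I QI).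

Lemma IR_monomialD n c e : prod_set I (ideal_pow I n) c ->
  prod_set I (ideal_pow I n) e -> mono n (c + e) = mono n c + mono n e.
Proof.
move=> Ic Ie; apply: val_inj.
rewrite -[LHS]/(IR_poly _) -[RHS]/(IR_poly (mono n c) + IR_poly (mono n e)).
by rewrite !IR_monomialE ?scalerDl //; apply: prod_setD.
Qed.

Definition rees_monomial_of n q (Hq : ideal_pow Q n q) : rees_ring Q :=
  ReesRing (asboolT (rees_monomial Hq)).

Lemma rees_monomial_scale i j q (Hq : ideal_pow Q i q) c :
  prod_set I (ideal_pow I j) c -> prod_set I (ideal_pow I (i + j)) (q * c) ->
  rees_monomial_of Hq *: spi (mono j c) = spi (mono (i + j) (q * c)).
Proof.
move=> Ic Iqc; rewrite sally_piZ; congr sally_pi; apply: val_inj.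
rewrite -[LHS]/(_ *: 'X^i * IR_poly (mono j c)) -[RHS]/(IR_poly _) !IR_monomialE //.
by rewrite -scalerAl -scalerAr scalerA -exprD.
Qed.

Hypothesis noethA : noetherian A.
Hypothesis Q_ideal : is_ideal Q.
Hypothesis Q_reduction : exists r, ideal_pow I r.+1 = prod_set Q (ideal_pow I r).

Lemma ideal_pow_reduction : exists r, forall n, (r <= n)%N ->
  ideal_pow I n.+1 `<=` prod_set Q (ideal_pow I n).
Proof.
have [r rE] := Q_reduction; exists r; elim=> [|n IH].
  by rewrite leqn0 => /eqP r0; move: rE; rewrite r0 => ->.
rewrite leq_eqVlt => /orP[/eqP<-|/IH sub]; first by rewrite rE.
have Pid := prod_set_ideal Q (ideal_pow_ideal I n.+1).
rewrite ideal_powS; apply: prod_set_min => // x y Ix /sub.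
rewrite mulrC; move=> yQ; apply: (prod_set_gen Pid _ yQ Ix) => u v w Qu Iv Iw.
by rewrite -mulrA; apply: prod_set_mem => //; rewrite mulrC; apply: prod_set_mem.
Qed.

(** Finite generation in the form in which it is used, for T-submodules.  The
    generators are taken in degrees at most r, where I^(n+1) = Q I^n for
    n >= r; beyond, S_(n+1) is T_1 S_n. *)
Lemma sally_generated : exists gs : seq (sally QI), forall P : set (sally QI),
  P 0 -> (forall s t, P s -> P t -> P (s + t)) ->
  (forall (t : rees_ring Q) s, P s -> P (t *: s)) ->
  (forall g, g \in gs -> P g) -> forall s, P s.
Proof.
have Pid n : is_ideal (prod_set I (ideal_pow I n)) := ideal_pow_ideal I n.+1.
have /choice[l Hl] : forall n, exists l, exists x : 'I_l -> A,
    prod_set I (ideal_pow I n) = gen_ideal x.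
  by move=> n; have [l [x xE]] := noethA (Pid n); exists l, x.
have /all_sig[x xE] : forall n, {x : 'I_(l n) -> A | prod_set I (ideal_pow I n) = gen_ideal x}.
  by move=> n; apply: cid; apply: Hl.
have [r rP] := ideal_pow_reduction.
exists (flatten [seq [seq spi (mono n (x n i)) | i <- enum 'I_(l n)] | n <- iota 0 r.+1]).
move=> P P0 PD PZ Pgs.
pose K n := [set c | prod_set I (ideal_pow I n) c /\ P (spi (mono n c))].
have Kid n : is_ideal (K n).
  split=> [|c e [Ic Pc] [Ie Pe]|q c [Ic Pc]].
  - split; first exact: prod_set0.
    suff -> : spi (mono n 0) = 0 by [].
    by apply/(sally_monomial_eq0 QI Q_ideal I_ideal); exact: prod_set0.
  - split; first exact: prod_setD.
    by rewrite IR_monomialD // sally_piD; apply: PD.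
  - have Iqc : prod_set I (ideal_pow I n) (q * c) by apply: idealM.
    have T : ideal_pow Q 0 q by [].
    split=> //; rewrite -(rees_monomial_scale (i := 0) T) //.
    exact: PZ.
have IK n : prod_set I (ideal_pow I n) `<=` K n.
  elim: n => [|n IH].
    rewrite xE; apply: gen_ideal_min => // i; split.
      by rewrite xE; apply: gen_ideal_gen.
    apply: Pgs; apply/flatten_mapP; exists 0%N => //.
    by apply/mapP; exists i => //; rewrite mem_enum.
  have [nr|rn] := ltnP n r.
    rewrite xE; apply: gen_ideal_min => // i; split.
      by rewrite xE; apply: gen_ideal_gen.
    apply: Pgs; apply/flatten_mapP; exists n.+1; first by rewrite mem_iota.
    by apply/mapP; exists i => //; rewrite mem_enum.
  apply: (subset_trans (rP n.+1 (leqW rn))); apply: prod_set_min => // q c Qq Ic.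
  have Q1 : ideal_pow Q 1 q by rewrite -[q]mulr1; apply: prod_set_mem.
  have Iqc : prod_set I (ideal_pow I n.+1) (q * c).
    by apply: prod_set_mem => //; apply: QI.
  split=> //; rewrite -[n.+1]/(1 + n)%N -(rees_monomial_scale Q1) //.
  by apply: PZ; have [] := IH _ Ic.
move=> s; have grS := sally_grading QI Q_ideal I_ideal.
have [N [-> _]] := component_sum grS s.
elim/big_ind: _ => // n _.
have [c Ic ->] := sally_grP Q_ideal I_ideal (component_gr grS n s).
by have [] := IK n _ Ic.
Qed.

(** If S_1 = 0, then I^2 = I Q, and hence I^(n+1) = I Q^n for all n. *)
Lemma sally_degree_one : (exists s : sally QI, s != 0) ->
  exists2 s : sally QI, s != 0 & sally_gr QI 1%N s.
Proof.
move=> [s s0]; apply: contrapT => no; move/eqP: s0; apply.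
have I1 : prod_set I (ideal_pow I 1) `<=` prod_set I (ideal_pow Q 1).
  move=> c Ic; apply/(sally_monomial_eq0 QI Q_ideal I_ideal Ic).
  apply: contrapT => /eqP c0; apply: no; exists (spi (mono 1 c)) => //.
  exact: sally_gr_monomial.
have In n : prod_set I (ideal_pow I n) `<=` prod_set I (ideal_pow Q n).
  elim: n => // n IH.
  have Pid := prod_set_ideal I (ideal_pow_ideal Q n.+1).
  apply: prod_set_min => // x w Ix /IH Iw; rewrite mulrC.
  apply: (prod_set_gen Pid _ Iw Ix) => y z x' Iy Qz Ix'.
  have : prod_set I (ideal_pow Q 1) (y * x').
    by apply: I1; apply: prod_set_mem => //; rewrite -[x']mulr1; apply: prod_set_mem.
  rewrite mulrAC => yx; apply: (prod_set_gen Pid _ yx Qz) => u v z' Iu Qv Qz'.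
  by rewrite -mulrA; apply: prod_set_mem => //; apply: (ideal_powM Qv Qz').
have grS := sally_grading QI Q_ideal I_ideal.
apply: (component_eq0 grS) => n.
have [c Ic ->] := sally_grP Q_ideal I_ideal (component_gr grS n s).
by apply/(sally_monomial_eq0 QI Q_ideal I_ideal) => //; apply: In.
Qed.

End SallyStructure.

Section SallyRelation.
Variables (A : comNzRingType) (d : nat) (b : nat -> A) (Q I : set A) (QI : Q `<=` I).
Hypothesis QE : Q = gen_ideal (fun i : 'I_d => b i).
Hypothesis b_regular : forall i, (i < d)%N ->
  regular_on (gen_ideal (fun j : 'I_i => b j)) (b i).
Hypothesis I_ideal : is_ideal I.
Variables (k : fieldType) (pi : {rmorphism A -> k}).
Hypothesis pi_surj : forall x, exists a, pi a = x.
Hypothesis pi_local : forall a, pi a != 0 -> invertible a.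

Lemma sally_cancel_forms s (F : 'I_s -> {mpoly A[d]}) p n :
  (forall l, F l \is p.-homog) ->
  (forall Y : 'I_s -> {mpoly k[d]}, (forall l, (msize (Y l) <= n.+1)%N) ->
     \sum_l Y l * map_mpoly pi (F l) = 0 -> forall l, Y l = 0) ->
  forall x : 'I_s -> sally QI, (forall l, sally_gr QI n (x l)) ->
    \sum_l rees_lift QE (F l) *: x l = 0 -> forall l, x l = 0.
Proof.
move=> Fp Finj x xn; have Q_ideal : is_ideal Q by rewrite QE; apply: gen_ideal_is_ideal.
have /choice[c Hc] : forall l, exists c, prod_set I (ideal_pow I n) c /\
    x l = sally_pi (IR_monomial QI n c).
  by move=> l; have [c ? ?] := sally_grP Q_ideal I_ideal (xn l); exists c.
have HcI l := (Hc l).1; have HcE l := (Hc l).2.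
under eq_bigr do rewrite HcE sally_piZ.
rewrite -(big_morph _ (@sally_piD _ _ _ QI) (@sally_pi0 _ _ _ QI)).
move=> /(sally_eq0P Q_ideal I_ideal _)/(_ (n + p)%N) H l.
rewrite HcE; apply/(sally_monomial_eq0 QI Q_ideal I_ideal) => //; rewrite QE ideal_pow_power prod_set_power //.
apply: (power_cancel_forms b_regular pi_surj pi_local Fp Finj) => //; first by rewrite -QE.
rewrite -prod_set_power // -ideal_pow_power -QE.
suff <- : (IR_poly (\sum_l rees_lift QE (F l) *: IR_monomial QI n (c l)))`_(n + p) =
    \sum_l c l * ev b (F l) by [].
rewrite /IR_poly -[IR_val _]/(val _) raddf_sum /= [LHS]coef_sum; apply: eq_bigr => l' _.
rewrite -[_`_ _]/((rees_eval b (F l') * IR_poly (IR_monomial QI n (c l')))`_(n + p)).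
rewrite IR_monomialE // (rees_eval_homog _ (Fp l')) -scalerAl -scalerAr -exprD addnC.
by rewrite scalerA coefZ coefXn eqxx mulr1 mulrC.
Qed.

End SallyRelation.

Lemma fraction_surj (R : idomainType) (z : {fraction R}) :
  exists n d : R, d != 0 /\ z = FracField.tofrac n / FracField.tofrac d.
Proof.
elim/quotW: z => x; exists (frac x).1, (frac x).2.
have d0 := denom_ratioP x; split=> //.
have dF : FracField.tofrac (frac x).2 != 0 by rewrite tofrac_eq0.
apply: (mulIf dF); rewrite mulfVK //.
rewrite -[LHS]/(FracField.mul _ _) !piE; apply/eqmodP.
rewrite /= FracField.equivfE /FracField.mulf !numden_Ratio ?mulr1 ?oner_neq0 ?mulf_neq0 ?oner_neq0 //.
by rewrite mulrC.
Qed.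

(** * Modules that embed into the fiber ring *)

Section SallyRank.
Variables (A : comNzRingType) (m : idealr A) (Q I : set A) (QI : Q `<=` I).
Variables (k : fieldType) (d : nat).
Local Notation B := (fiber_ring Q m).
Local Notation S := (sally QI).
Variable lam : {rmorphism B -> {mpoly k[d]}}.
Hypothesis lam_bij : bijective lam.

Lemma embedding_annih (f : {linear S -> B}) : injective f -> sally_annih QI m.
Proof.
move=> finj c s cm; apply: finj; rewrite linearZ raddf0.
rewrite -[LHS]/(fiber_pi m (rees_const Q c) * f s).
suff -> : fiber_pi m (rees_const Q c) = 0 by rewrite mul0r.
apply/fiber_pi_eq0; rewrite -[rees_const Q c]mulr1.
by apply: prod_set_mem => //; exists c.
Qed.

(** The fraction field is that of the polynomial ring, and psi is the embedding
    followed by the inclusion of B into it. *)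
Lemma embedding_rank (f : {linear S -> B}) (mS : sally_annih QI m) :
  injective f -> (exists2 x, range f x & x != 0) -> has_rank (sally_fiber mS) 1.
Proof.
move=> finj [_ [x0 _ <-] fx0].
pose P := {mpoly k[d]}; pose K : fieldType := {fraction P}.
pose phi0 (x : B) : K := FracField.tofrac (lam x).
have phiB : {morph phi0 : x y / x - y}.
  by move=> x y; rewrite /phi0 rmorphB tofracB.
have phiM : monoid_morphism phi0.
  by split=> [|x y]; rewrite /phi0 ?rmorph1 ?rmorphM ?tofrac1 ?tofracM.
pose phi : {rmorphism B -> K} := HB.pack phi0
  (GRing.isZmodMorphism.Build _ _ phi0 phiB) (GRing.isMonoidMorphism.Build _ _ phi0 phiM).
have phi_eq0 x : phi x = 0 -> x = 0.
  by move/eqP; rewrite /= /phi0 tofrac_eq0 (lam_eq0 lam_bij) => /eqP.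
have phi_inj : injective phi.
  move=> x y xy; apply/eqP; rewrite -subr_eq0; apply/eqP/phi_eq0.
  by rewrite rmorphB xy subrr.
have [g gK Kg] := lam_bij.
have phi_frac z : exists b s, s != 0 /\ z = phi b / phi s.
  have [n [e [e0 ->]]] := fraction_surj z; exists (g n), (g e); split.
    by rewrite -(lam_eq0 lam_bij) Kg.
  by rewrite /= /phi0 !Kg.
pose M : lmodType B := sally_fiber mS.
have fM (x : B) (s : M) : f (x *: s : M) = x * f s.
  have [t <-] : exists t, fiber_pi m t = x by exists (repr x); apply: reprK.
  rewrite -[RHS]/(t *: f s) -linearZ; congr (f _).
  exact: (annih_scale_pi (sally_annih_fiber mS)).
pose psi0 (s : M) : K^o := phi (f s).
have psiL : linear_for (phi \; *:%R) psi0.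
  move=> x s t; rewrite /psi0; have -> : f (x *: s + t : M) = f (x *: s : M) + f t by apply: raddfD.
  by rewrite fM rmorphD rmorphM.
pose psi : {linear M -> K^o | phi \; *:%R} :=
  HB.pack psi0 (GRing.isLinear.Build B M K^o (phi \; *:%R) psi0 psiL).
have f_eq0 s : f s = 0 -> s = 0 by move=> fs; apply: finj; rewrite fs raddf0.
exists K, phi, K^o, psi; split.
- by split.
- split=> [s|v].
    split=> [/phi_eq0/f_eq0->|[x xn xs]].
      by exists 1; rewrite ?oner_neq0 // scaler0.
    have := fM x s; rewrite xs raddf0 => /esym/(polynomial_domain lam_bij)[/eqP|fs].
      by rewrite (negbTE xn).
    by rewrite /= /psi0 fs rmorph0.
  have [b [s [s0 ->]]] := phi_frac v.
  exists (s * f x0), (b *: (x0 : M)); split; first exact: (domain_mulf (polynomial_domain lam_bij)).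
  rewrite -[RHS]/((phi (s * f x0))^-1 * phi (f (b *: (x0 : M)))) fM !(rmorphM phi).
  have pf : phi (f x0) != 0 by apply: contra fx0 => /eqP/phi_eq0/eqP.
  by rewrite invfM mulrACA mulVf // mulr1 mulrC.
- by rewrite dimvf.
Qed.

End SallyRank.

(** * Sally modules of rank one *)

(** Torsion-freeness makes psi injective; in a space of dimension 1 the images
    of s and s0 are proportional, with a ratio phi b / phi c. *)
Lemma rank_dependent (B : comNzRingType) (M : lmodType B) : has_rank M 1 ->
  (forall (b : B) (x : M), b *: x = 0 -> b = 0 \/ x = 0) ->
  (exists x : M, x != 0) /\
  forall s0 s : M, s0 != 0 -> exists b c : B, c != 0 /\ c *: s = b *: s0.
Proof.
move=> [K [phi [V [psi [[phi_inj phi_frac] [psi_ker psi_surj] dimV]]]]] tf.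
have psi_eq0 x : psi x = 0 -> x = 0.
  by move=> /psi_ker[b b0 /tf[/eqP|//]]; rewrite (negbTE b0).
split.
  apply: contrapT => no; have V0 v : v = 0 :> V.
    have [s [x [_ ->]]] := psi_surj v.
    suff -> : x = 0 by rewrite raddf0 scaler0.
    by apply/eqP; apply: contrapT => /negP x0; apply: no; exists x.
  have := dimV; suff -> : ({:V} = 0)%VS by rewrite dimv0.
  by apply/eqP; rewrite -subv0; apply/subvP => v _; rewrite (V0 v) mem0v.
move=> s0 s s00; have p0 : psi s0 != 0 by apply: contra s00 => /eqP/psi_eq0/eqP.
have /vlineP[kap kapE] : psi s \in <[psi s0]>%VS.
  suff -> : (<[psi s0]> = {:V})%VS by apply: memvf.
  by apply/eqP; rewrite eqEdim subvf dim_vline p0 dimV.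
have [b [c [c0 kE]]] := phi_frac kap; exists b, c; split=> //.
have pc0 : phi c != 0 by apply: contra c0 => /eqP; rewrite -(rmorph0 phi) => /phi_inj->.
apply/eqP; rewrite -subr_eq0; apply/eqP/psi_eq0.
have psiZ (e : B) x : psi (e *: x) = phi e *: psi x by apply: linearZ.
have psiB x y : psi (x - y) = psi x - psi y by apply: raddfB.
by rewrite psiB !psiZ kapE kE scalerA mulrCA divff // mulr1 subrr.
Qed.

Section Forward.
Variables (A : comNzRingType) (m : idealr A) (d : nat) (b : nat -> A).
Variables (Q I : set A) (QI : Q `<=` I).
Hypothesis noethA : noetherian A.
Hypothesis QE : Q = gen_ideal (fun i : 'I_d => b i).
Hypothesis b_regular : forall i, (i < d)%N ->
  regular_on (gen_ideal (fun j : 'I_i => b j)) (b i).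
Hypothesis Qm : Q `<=` [set` m].
Hypothesis I_ideal : is_ideal I.
Hypothesis Q_reduction : exists r, ideal_pow I r.+1 = prod_set Q (ideal_pow I r).
Variables (k : fieldType) (pi : {rmorphism A -> k}).
Hypothesis pi_surj : forall x, exists a, pi a = x.
Hypothesis pi_local : forall a, pi a != 0 -> invertible a.

Local Notation B := (fiber_ring Q m).
Local Notation S := (sally QI).

Variable lam : {rmorphism B -> {mpoly k[d]}}.
Hypothesis lam_bij : bijective lam.
Hypothesis lamE : forall F, lam (fiber_pi m (rees_lift QE F)) = map_mpoly pi F.
Hypothesis lam_homog : forall (n : nat) x, fiber_gr Q m n x <-> lam x \is n.-homog.
Hypothesis fiber_gr_negative : forall n x, fiber_gr Q m (Negz n) x -> x = 0.

Variable mS : sally_annih QI m.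
Let M : lmodType B := sally_fiber mS.
Let grB (n : nat) : set B := fiber_gr Q m n.
Let grM (n : nat) : set M := sally_gr QI n.

Let Q_ideal : is_ideal Q.
Proof. by rewrite QE; apply: gen_ideal_is_ideal. Qed.

Let scaleM (t : rees_ring Q) (s : S) : fiber_pi m t *: (s : M) = t *: s.
Proof. exact: (annih_scale_pi (sally_annih_fiber mS)). Qed.

Let gradedM : grading grM (@sally_component A Q I QI).
Proof. exact: (sally_grading QI Q_ideal I_ideal). Qed.

Let lift_homog n (x : B) : grB n x -> exists F : {mpoly A[d]},
  [/\ F \is n.-homog, fiber_pi m (rees_lift QE F) = x & map_mpoly pi F = lam x].
Proof.
move=> /lam_homog /(map_mpoly_homog_surj pi_surj)[F Fn FE]; exists F; split=> //.
by apply: (bij_inj lam_bij); rewrite lamE.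
Qed.

Let gr_scale i j (x : B) (s : M) : grB i x -> grM j s -> grM (i + j)%N (x *: s).
Proof.
move=> xi /(sally_grP Q_ideal I_ideal)[c Ic ->].
have [F [Fi <- _]] := lift_homog xi.
rewrite scaleM sally_piZ; exists (rees_lift QE F *: IR_monomial QI j c) => // n.
rewrite -[IR_val _]/(rees_eval b F * IR_poly (IR_monomial QI j c)) IR_monomialE //.
rewrite (rees_eval_homog _ Fi) -scalerAl -scalerAr -exprD scalerA coefZ coefXn.
by have [->|_] := eqVneq n (i + j)%N; rewrite ?mulr0 ?eqxx.
Qed.

Let gr_torsion_free i j (x : B) (s : M) : grB i x -> grM j s ->
  x *: s = 0 -> x = 0 \/ s = 0.
Proof.
move=> xi sj xs; have [->|x0] := eqVneq x 0; [by left|right].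
have [F [Fi xE FE]] := lift_homog xi.
apply: (@sally_cancel_forms A d b Q I QI QE b_regular I_ideal k pi pi_surj pi_local 1
  (fun=> F) i j _ _ (fun=> s) _ _ ord0) => // [Y _|].
  rewrite big_ord1 FE => /eqP; rewrite mulf_eq0 (lam_eq0 lam_bij) (negbTE x0) orbF.
  by move=> /eqP Y0 l; rewrite (ord1 l).
by rewrite big_ord1 -scaleM xE.
Qed.

Let N := poly_degree lam.

(** The embedding f of [rank_one_embedding] has p = 0 when its image J is B and
    p = 1 otherwise; the latter is where two coprime forms in J are used. *)
Lemma sally_rank_one : has_rank (sally_fiber mS) 1 ->
  graded_iso_onto (M := S) (N := B)
     (sally_gr QI) (shift_gr (fiber_gr Q m) (-1)) setT \/
  exists J : set B,
     [/\ graded_ideal (fiber_gr Q m) J, J <> setT, height_ge 2 J &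
         graded_iso_onto (M := S) (N := B) (sally_gr QI) (fiber_gr Q m) J].
Proof.
move=> rkS.
have [cB [gradedB N_top N_max]] := polynomial_grading lam_bij lam_homog.
have domB := polynomial_domain lam_bij.
have N_norm := polynomial_norm lam_bij.
have gr_mul := polynomial_gr_mul lam_homog.
have N_gr := polynomial_degree_gr lam_bij lam_homog.
have B_prime := polynomial_irreducibles_prime lam_bij.
have tf : forall (x : B) (s : M), x *: s = 0 -> x = 0 \/ s = 0.
  exact: (graded_torsion_free gradedB gradedM gr_scale N_top N_max gr_torsion_free).
have [[s' s'0] dep] := rank_dependent (M := M) rkS tf.
have [|s0 s00 s0_gr] := sally_degree_one I_ideal Q_ideal (QI := QI); first by exists s'.
have fin_gen : exists gs : seq M, forall P : set M,
    P 0 -> (forall s t, P s -> P t -> P (s + t)) ->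
    (forall (x : B) s, P s -> P (x *: s)) ->
    (forall g, g \in gs -> P g) -> forall s, P s.
  have [gs gsP] := sally_generated QI I_ideal noethA Q_ideal Q_reduction.
  exists gs => P P0 PD PZ Pg; apply: gsP => // t s Ps.
  by rewrite -scaleM; apply: PZ.
have [p [C [f [C0 Cp fs0 finj [flin fgr fcomp flow fdiv]]]]] :=
  rank_one_embedding gradedB domB N_norm N_gr N_top gradedM gr_scale tf
    (s0 := s0) s00 s0_gr (fun s => dep s0 s s00) fin_gen.
have fB : {morph f : s t / s + t}.
  by move=> s t; have := flin 1 s t; rewrite scale1r mul1r.
have f0 : f 0 = 0 by apply: (addrI (f 0)); rewrite -fB !addr0.
have fZ (x : B) s : f (x *: s) = x * f s by have := flin x s 0; rewrite f0 !addr0.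
pose J := range f.
have Jid : is_ideal J.
  split=> [|_ _ [s _ <-] [t _ <-]|x _ [s _ <-]]; first by exists 0.
    by exists (s + t).
  by exists (x *: s).
have JC : J C by exists s0.
have J0 : exists2 x, J x & x != 0 by exists C.
have fT : linear_for *:%R (f : S -> B).
  move=> t s u; have := flin (fiber_pi m t) s u; rewrite scaleM => ->.
  by [].
pose fl : {linear S -> B} :=
  HB.pack (f : S -> B) (GRing.isLinear.Build (rees_ring Q) S B *:%R (f : S -> B) fT).
have gr1B : grB 0 1 by apply: (gr1 gradedB N_norm N_max).
have grM0 s : grM 0 s -> s = 0 by apply: (sally_gr_zero Q_ideal I_ideal).
have zB j : fiber_gr Q m j (f 0).
  by exists 0; [move=> i; rewrite coef0 eqxx|rewrite f0; exact: fiber_pi0].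
have zS j : sally_gr QI j 0.
  by exists 0; [move=> i; rewrite coef0 eqxx|exact: sally_pi0].
have [J1|J1] := EM (J 1).
  left; have JT : J = setT.
    by rewrite eqEsubset; split=> // x _; rewrite -[x]mulr1; apply: idealM.
  have [s1 _ fs1] := J1.
  (* the preimage s1 of 1 has degree 1 - p, and S vanishes in degree 0 *)
  have p0 : p = 0%N.
    case: p Cp fgr flow => [//|[|p]] Cp fgr flow.
      have : grM 0 s1 by apply/(fgr 0%N 0%N) => //; rewrite fs1.
      by move/grM0 => s10; move/eqP: fs1; rewrite s10 f0 eq_sym oner_eq0.
    have := flow 0%N s1 isT; rewrite fs1 (component_id gradedB gr1B) => /eqP.
    by rewrite oner_eq0.
  subst p; exists fl; split=> // -[[|n]|n]; rewrite setTI /shift_gr.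
  - rewrite eqEsubset; split=> [_ [s /grM0 -> <-]|x /fiber_gr_negative ->]; first exact: zB.
    by exists 0; [exact: zS|exact: f0].
  - have -> : -1 + n.+1%:Z = n%:Z by rewrite -[n.+1]add1n PoszD addKr.
    rewrite eqEsubset; split=> [_ [s sn <-]|x xn].
      by apply/(fgr n.+1 n); rewrite // addn0.
    have [s _ fs] : J x by rewrite JT.
    by exists s => //; apply/(fgr n.+1 n); rewrite ?addn0 // fs.
  - rewrite eqEsubset; split=> [_ [s /(sally_gr_negative Q_ideal I_ideal) -> <-]|x]; first exact: zB.
    have -> : -1 + Negz n = Negz n.+1 by rewrite !NegzE -opprD -PoszD add1n.
    by move=> /fiber_gr_negative ->; exists 0; [exact: zS|exact: f0].
right; exists J.
have p_pos : (0 < p)%N := proper_degree N_norm N_gr Jid J1 JC C0 Cp.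
have p1 : p = 1%N.
  apply/eqP; rewrite eqn_leq p_pos andbT leqNgt; apply/negP => p2.
  have [q [a [g [[s1 _ fs1] [s2 _ fs2] cop] [pq q0 Cq gq]]]] :=
    coprime_pair gradedB gr_mul domB N_norm N_gr N_top N_max B_prime
      Jid fcomp J0 fdiv J1 JC C0 Cp.
  have u0 : C ^+ a != 0 by apply: (domain_expf_neq0 domB).
  set u := C ^+ a in fs1 u0 cop Cq.
  have nE : q.+1 = ((q.+1 - p) + p)%N by rewrite subnK // leqW.
  set n := (q.+1 - p)%N in nE.
  have nq : (n < q)%N by rewrite /n ltn_subLR ?leqW // -add2n leq_add2r.
  have s1n : grM n s1 by apply/(fgr n q) => //; rewrite fs1.
  have s2n : grM n s2 by apply/(fgr n q) => //; rewrite fs2.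
  have [F [Fq FE FL]] := lift_homog Cq; have [G [Gq GE GL]] := lift_homog gq.
  have rel : g *: (s1 : M) - u *: (s2 : M) = 0.
    by apply: finj; rewrite f0 fB -scaleN1r -[in RHS](subrr (g * u)) fZ fZ fZ fs1 fs2 mulN1r (mulrC u).
  (* apply cancellation to the forms G, F of the relation g s1 - u s2 = 0 *)
  have s10 : s1 = 0.
    pose X (l : 'I_2) : S := if l == ord0 then s1 else - s2.
    pose FF (l : 'I_2) := if l == ord0 then G else F.
    apply: (@sally_cancel_forms A d b Q I QI QE b_regular I_ideal k pi pi_surj pi_local 2
      FF q n _ _ X _ _ ord0) => [l|Y Ys|l|].
    - by rewrite /FF; case: ifP.
    - rewrite big_ord_recl big_ord1 /FF /= GL FL => YE.
      have [h hK Kh] := lam_bij.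
      (* u divides Y_0 g and is coprime to g, but Y_0 has smaller degree than u *)
      have Y0 : Y ord0 = 0.
        apply: contrapT => /eqP Y0.
        have y0 : h (Y ord0) != 0 by rewrite -(lam_eq0 lam_bij) Kh.
        have [r yE] : divides u (h (Y ord0)).
          apply: (coprime_divides domB N_norm B_prime u0 cop).
          exists (- h (Y (lift ord0 ord0))); apply: (bij_inj lam_bij).
          rewrite !rmorphM rmorphN !Kh mulNr; apply/eqP.
          by rewrite -addr_eq0 mulrC YE.
        have r0 : r != 0 by apply: contraNneq y0 => r0; rewrite yE r0 mul0r.
        have : (q <= N (h (Y ord0)))%N.
          by rewrite yE /N N_norm.1 // (N_gr _ _ u0 Cq) leq_addl.
        rewrite leqNgt => /negP; apply; apply: leq_ltn_trans nq.
        by rewrite /N /poly_degree Kh; have := Ys ord0; case: (msize _).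
      move=> l; case: (unliftP ord0 l) => [j|] -> //.
      move/eqP: YE; rewrite Y0 mul0r add0r mulf_eq0 (lam_eq0 lam_bij) (negbTE u0) orbF.
      by move/eqP; rewrite (ord1 j).
    - by rewrite /X; case: ifP => // _; apply: (grN gradedM).
    - rewrite big_ord_recl big_ord1 /X /FF /= -!scaleM GE FE -rel.
      by congr (_ + _); apply: (scalerN u (s2 : M)).
  by move/eqP: fs1; rewrite s10 f0 eq_sym (negbTE u0).
have fgr1 n s : grM n s <-> grB n (f s) by apply: fgr; rewrite p1 addn1.
split.
- split=> // x Jx; have [K [xE _]] := component_sum gradedB x.
  exists K, (fun i : 'I_K => cB i x); split=> // i; split; first exact: fcomp.
  by exists (i : nat)%:Z; apply: (component_gr gradedB).
- by move=> JT; apply: J1; rewrite JT.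
- exact: (divisor_free_height domB N_norm B_prime J0 fdiv).
exists fl; split=> // -[n|n]; rewrite eqEsubset; split.
- by move=> _ [s sn <-]; split; [exists s|apply/(fgr1 n s)].
- by move=> _ [[s _ <-] xn]; exists s => //; apply/(fgr1 n s).
- move=> _ [s /(sally_gr_negative Q_ideal I_ideal) -> <-]; split; [by exists 0|exact: zB].
- by move=> x [_ /fiber_gr_negative ->]; exists 0; [exact: zS|exact: f0].
Qed.

End Forward.

(** * The theorem *)

Lemma ideal_pow_exp (A : comNzRingType) (I : set A) x n : I x -> ideal_pow I n (x ^+ n).
Proof.
move=> Ix; elim: n => // n IH; rewrite exprS ideal_powS.
exact: prod_set_mem.
Qed.

(** If J = 0, then (0) is a prime that contains J and no chain of positive length ends
    there. *)
Lemma height_ge_neq0 (B : comNzRingType) (J : set B) n :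
  (forall x y : B, x * y = 0 -> x = 0 \/ y = 0) -> (0 < n)%N -> is_ideal J ->
  height_ge n J -> exists2 x, J x & x != 0.
Proof.
move=> domB n0 Jid hJ; apply: contrapT => no.
have J0 : J `<=` [set 0].
  by move=> x Jx; apply/eqP; apply: contrapT => /negP x0; apply: no; exists x.
have zprime := zero_prime domB.
have [c [cp cl cn]] := hJ _ zprime J0.
have [_] := cl n.-1 (ltac:(by rewrite prednK)).
rewrite prednK // cn; apply => _ ->.
have [[+ _ _] _ _] := cp n.-1 (leq_pred n); exact.
Qed.

Unset Implicit Arguments.
Theorem theorem2p4 (A : comNzRingType) (m : idealr A) (d : nat)
    (hCM : cohen_macaulay_local m d) (hd : (0 < d)%N)
    (hk : infinite_set [set: {ideal_quot m}])
    (I : set A) (hI : primary_to m I)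
    (a : 'I_d -> A) (hQ : minimal_reduction (gen_ideal a) I) :
  let Q := gen_ideal a in
  let QI := minimal_reduction_sub hQ in
  let B := fiber_ring Q m in
  let S := sally QI in
  (exists mS : sally_annih QI m, has_rank (sally_fiber mS) 1)
  <->
  (graded_iso_onto (M := S) (N := B)
     (sally_gr QI) (shift_gr (fiber_gr Q m) (-1)) setT \/
   exists J : set B,
     [/\ graded_ideal (fiber_gr Q m) J, J <> setT, height_ge 2 J &
         graded_iso_onto (M := S) (N := B) (sally_gr QI) (fiber_gr Q m) J]).
Proof.
move=> Q QI B S.
have [noethA localA _ [[x [xm xreg]] _]] := hCM.
have [[I_ideal _ _] radI] := hI.
have [[Q_ideal _ [r redQ]] _] := hQ.
have Im : I `<=` [set` m] by move=> y Iy; rewrite -radI; exists 1%N; rewrite expr1.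
have Qm : Q `<=` [set` m] := subset_trans QI Im.
have radQ y : y \in m -> radical Q y.
  move=> ym; have : [set` m] y by [].
  rewrite -radI => -[n Iyn]; exists (n * r.+1)%N; rewrite exprM.
  have := ideal_pow_exp r.+1 Iyn; rewrite redQ.
  by apply: prod_set_min => // u v Qu _; apply: idealMr_set.
have am i : a i \in m by apply: Qm; apply: gen_ideal_gen.
have [b [bE b_regular]] := regular_generators noethA localA hk am radQ
  (regular_seq_depth_ge xm xreg).
have QE : Q = gen_ideal (fun i : 'I_d => b i) by rewrite bE.
have m_inv := local_invertible noethA localA.
have [k [pi [pi_surj pi_ker]]] := residue_field m_inv.
have pi_local y : pi y != 0 -> invertible y.
  by move=> y0; apply: m_inv; apply: contra y0 => /pi_ker/eqP.
have [lam [lam_bij lamE lam_homog gr_neg]] :=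
  fiber_ring_polynomial QE b_regular Qm pi_surj pi_ker.
have domB := polynomial_domain lam_bij.
have embed (f : {linear S -> B}) : injective f ->
    (exists2 y, range f y & y != 0) ->
    exists mS : sally_annih QI m, has_rank (sally_fiber mS) 1.
  move=> finj f0; have mS := embedding_annih finj; exists mS.
  exact: (embedding_rank lam_bij mS finj).
split=> [[mS rk]|[[f [finj fT _]]|[J [[Jid _] _ hJ [f [finj fJ _]]]]]].
- exact: (sally_rank_one noethA b_regular I_ideal (ex_intro _ r redQ) pi_surj pi_local
    lam_bij lamE lam_homog gr_neg rk).
- by apply: embed finj _; exists 1; rewrite ?fT ?oner_neq0.
- by apply: embed finj _; rewrite fJ; apply: height_ge_neq0 hJ.
Qed.
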